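(* For every integer $n\ge1$ and each choice of sign $\pm$, the value $\mathcal{J}(n+\sqrt{n^2\pm1})$ is a rational linear combination of $\zeta(2)$, $\log(2)\log(n+\sqrt{n^2\pm1})$, and the values $\varrho(\mathcal{B})$ for at most four narrow classes $\mathcal{B}$ of quadratic forms of discriminant $4^{a}(n^2\pm1)$ with $a\in\{0,1,-1\}$.
   Context: For $x>0$ let $J(x)=\int_0^1\frac{\log(1+t^x)}{1+t}\,dt$ and $\mathcal{J}(x)=J(x)-\frac{\log^22}{2}+\frac{\pi^2}{24}\bigl(x-\frac1x\bigr)$. For a positive non-square discriminant $D$ let $\mathcal{O}_D=\mathbb{Z}+\mathbb{Z}\frac{D+\sqrt D}{2}$ be the quadratic order of discriminant $D$, and $\varepsilon=\varepsilon_D$ the smallest unit $>1$ of $\mathcal{O}_D$ of norm $1$. Narrow classes of primitive integral binary quadratic forms of discriminant $D$ (i.e. $\mathrm{PSL}_2(\mathbb{Z})$-equivalence classes) correspond bijectively to narrow ideal classes of invertible fractional $\mathcal{O}_D$-ideals (two ideals being equivalent if their quotient is $\lambda\mathcal{O}_D$ with $N(\lambda)>0$). For such a class $\mathcal{B}$, let $\zeta(\mathcal{B},s)=\sum_{\mathfrak a}N(\mathfrak a)^{-s}$, summed over invertible integral $\mathcal{O}_D$-ideals $\mathfrak a$ in $\mathcal{B}$, and \[\varrho(\mathcal{B})=\lim_{s\to1}\Bigl(D^{s/2}\zeta(\mathcal{B},s)-\frac{\log\varepsilon_D}{s-1}\Bigr).\] *)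

(* Defs.v *)
From HB Require Import structures.
From mathcomp Require Export all_boot all_order all_algebra.
From mathcomp Require Export finmap.
From mathcomp Require Export all_classical all_reals all_analysis.

Set Implicit Arguments.
Unset Strict Implicit.
Unset Printing Implicit Defensive.

Import Order.TTheory GRing.Theory Num.Theory.
Import numFieldNormedType.Exports.

Local Open Scope classical_set_scope.
Local Open Scope ring_scope.

Section HerglotzJ.
Variable R : realType.
Implicit Types x s : R.

Definition Jfun x : R :=
  \int[lebesgue_measure]_(t in `[0, 1]) (ln (1 + t `^ x) / (1 + t)).

Definition calJ x : R :=
  Jfun x - ln 2 ^+ 2 / 2 + pi ^+ 2 / 24 * (x - x^-1).

Definition riemann_zeta s : R := limn (series (riemannR s)).

End HerglotzJ.

Definition is_discriminant (D : int) : Prop :=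
  [/\ 0 < D, (D %% 4)%Z = 0 \/ (D %% 4)%Z = 1 & forall m : int, D <> m ^+ 2].

(* QForm a b c is the form a X^2 + b X Y + c Y^2. *)
Record qform := QForm { qa : int; qb : int; qc : int }.

Definition qeval (Q : qform) (x y : int) : int :=
  qa Q * x ^+ 2 + qb Q * x * y + qc Q * y ^+ 2.

Definition qdisc (Q : qform) : int := qb Q ^+ 2 - 4 * qa Q * qc Q.

Definition qprimitive (Q : qform) : Prop :=
  gcdz (gcdz (qa Q) (qb Q)) (qc Q) = 1.

Definition qequiv (Q Q' : qform) : Prop :=
  exists p q r s : int, p * s - q * r = 1 /\
    forall x y, qeval Q' x y = qeval Q (p * x + q * y) (r * x + s * y).

Definition narrow_form_class (D : int) (B : set qform) : Prop :=
  exists Q, [/\ qprimitive Q, qdisc Q = D & B = [set Q' | qequiv Q Q']].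

(* Q(sqrt D), its orders and its ideals are taken inside the real numbers,
   via the embedding for which sqrt D > 0. *)
Section Orders.
Variables (R : realType) (D : int).
Implicit Types (I J : set R) (B : set qform) (s : R).

Definition sqrtD : R := Num.sqrt D%:~R.

(* l lies in Q(sqrt D) and its norm (down to Q) is v; v is determined by l
   when D is not a square. *)
Definition has_norm (l : R) (v : rat) : Prop :=
  exists p q : rat,
    l = ratr p + ratr q * sqrtD /\ v = p ^+ 2 - D%:~R * q ^+ 2.

Definition quad_field : set R := [set l | exists v, has_norm l v].

Definition quad_order : set R :=
  [set l | exists x y : int, l = x%:~R + y%:~R * ((D%:~R + sqrtD) / 2)].

Definition smallest_unit (eps : R) : Prop :=
  let U := [set u : R | [/\ quad_order u, quad_order u^-1, 1 < u
                          & has_norm u 1]] in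
  U eps /\ forall u, U u -> eps <= u.

Definition fractional_ideal I : Prop :=
  [/\ I `<=` quad_field,
      exists2 x, I x & x != 0,
      forall x y, I x -> I y -> I (x - y),
      forall a x, quad_order a -> I x -> I (a * x)
    & exists d, [/\ quad_order d, d != 0
                  & forall x, I x -> quad_order (d * x)]].

Definition ideal_mul I J : set R :=
  [set z | exists (m : nat) (x y : 'I_m -> R),
    [/\ forall i, I (x i), forall i, J (y i) & z = \sum_i x i * y i]].

Definition ideal_inverse I J : Prop :=
  [/\ fractional_ideal I, fractional_ideal J & ideal_mul I J = quad_order].

Definition invertible_ideal I : Prop := exists J, ideal_inverse I J.

(* The quotient I J^-1 is l O_D with N(l) > 0. *)
Definition narrow_equiv I J : Prop :=
  exists J' l v, [/\ fractional_ideal I, ideal_inverse J J', has_norm l v,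
    0 < v & ideal_mul I J' = [set l * a | a in quad_order]].

Definition form_ideal (Q : qform) : set R :=
  [set z | exists x y : int,
    z = x%:~R * (qa Q)%:~R + y%:~R * ((- (qb Q)%:~R + sqrtD) / 2)].

(* The narrow ideal class corresponding to the class B of forms.  The form
   [a, b, c] with a > 0 corresponds to the ideal Z a + Z (- b + sqrt D) / 2;
   as D > 0, each class contains forms with a > 0, and the restriction a > 0
   makes the narrow class of that ideal depend on B only. *)
Definition ideal_class B : set (set R) :=
  [set I | exists Q, [/\ B Q, 0 < qa Q & narrow_equiv I (form_ideal Q)]].

(* The index of I in O_D, for an integral ideal I <> 0. *)
Definition ideal_norm I : nat :=
  #|` fset_set [set [set y | I (y - x)] | x in quad_order] |.

Definition zeta_class B s : \bar R :=
  \esum_(I in [set I | [/\ invertible_ideal I, I `<=` quad_order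
                         & ideal_class B I]])
    ((ideal_norm I)%:R `^ (- s))%:E.

(* r is the value of varrho at B.  The limit is taken over real s > 1, where
   the series converges, and in the extended reals. *)
Definition is_varrho B (r : R) : Prop :=
  exists2 eps, smallest_unit eps &
    ((D%:~R `^ (s / 2))%:E * zeta_class B s - (ln eps / (s - 1))%:E)%E
      @[s --> (1 : R)^'+] --> r%:E.

End Orders.

(* Main.v *)
(* Put d = n^2 + e, x = n + sqrt d, D = 4 d, and let u > 1 be the unit of norm 1
   equal to x if e = -1 and to x^2 if e = 1.  A fundamental domain of multiplication
   by u^2 on the totally positive elements q + m x is given by q > 0, m >= 0 (and
   m < 2 n q if e = 1).  With f(q, m) = q^2 + 2 n q m - e m^2, the sum Z0 of f^-s
   over this domain is therefore a multiple of the zeta function of the principal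
   form, and the sum Z1 over the pairs with q and m of equal parity is, up to a
   power of 2, a multiple of that of [2, 2n+2, c] or [1, n+1, c/2], where
   c = (2n+1-e)/2 decides by its parity which of the two is primitive.  Comparing
   the expansions at s = 1 expresses lim (2 Z1 - Z0) by two values of varrho and
   log 2 log x.  On the other hand 2 Z1 - Z0 is the sum of (-1)^(q+m) f^-s; at s = 1
   the factorisation of f over Q(sqrt d) splits it into the series
   W(y) = sum_q (-1)^(q-1)/q beta(q y), beta(z) = sum_m (-1)^m/(z+m), at y = x and
   y = 1/x.  Since J(y) = sum_q (-1)^(q-1)/q beta(q y + 1), these are J(x) and J(1/x)
   up to zeta(2), and J(x) + J(1/x) = log^2 2.

   The polar part of Z0 comes from summing over m first: phi(m/q)^-s has q I(s) + O(1)
   as its sum over m, with I the integral of phi^-s over the sector. *)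
Require Import Defs.
From mathcomp Require Import ring lra zify.
Import Order.TTheory GRing.Theory Num.Theory.
Import numFieldNormedType.Exports.
Local Open Scope classical_set_scope.
Local Open Scope ring_scope.

Set Implicit Arguments.
Unset Strict Implicit.

(** The double sums diverge absolutely at [s = 1], so they cannot be rearranged there. The
    alternation is used inside one row [q] at a time: it gains a factor [1 / q], and the rows become
    dominated by a multiple of [1 / q ^ 2] uniformly for [s] near 1, which lets the limit pass
    inside the sum over [q].

    The unit [u] need not be the smallest one. It is [eps ^+ j] for some [j] that is never computed;
    the sum over the cone and [ln u] are both [j] times those of [eps], so [j] disappears into the
    rational coefficients.

    The term [log 2 log x] has its origin in the normalisation: once the powers of 2 are collected,
    the second zeta function carries an extra factor [2 ^ (s - 1)], whose derivative at [s = 1]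
    meets the residue [ln u].

    For [n = 1], [e = - 1] one has [d = 0] and [x = 1]; there is no quadratic field, and the
    reflection formula alone gives [J(1)].

    Rows are indexed by [k = q - 1], so equal parity of [q] and [m] is written [odd k != odd m]. *)

Lemma rat_sqr_int (q : rat) (D : int) :
  q ^+ 2 = D%:~R -> exists m : int, D = m ^+ 2.
Proof.
move=> hq.
have hn : numq q ^+ 2 = D * denq q ^+ 2.
  apply: (@intr_inj rat); rewrite rmorphXn /= intrM rmorphXn /= -hq.
  by rewrite -{2}(divq_num_den q) expr_div_n mulfVK // expf_neq0 // intr_eq0 denq_neq0.
have : coprimez (numq q ^+ 2) (denq q ^+ 2).
  by apply: coprimezXl; apply: coprimezXr; rewrite coprimezE coprime_num_den.
rewrite hn coprimezE abszM coprimeMl => /andP[_]; rewrite /coprime gcdnn => /eqP h1.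
exists (numq q); rewrite hn.
have -> : denq q ^+ 2 = 1 by rewrite -(gez0_abs (sqr_ge0 (denq q))) h1.
by rewrite mulr1.
Qed.

(** * Conjugation and norm on the quadratic field *)

Section QuadraticField.
Variables (R : realType) (D : int).
Hypothesis hD : is_discriminant D.

Local Notation w := (sqrtD R D).
Local Notation K := (@quad_field R D).

Lemma sqrtD_gt0 : 0 < w.
Proof. by case: hD => hp _ _; rewrite sqrtr_gt0 ltr0z. Qed.

Lemma sqrtD_sqr : w ^+ 2 = D%:~R.
Proof. by case: hD => hp _ _; rewrite sqr_sqrtr // ler0z ltW. Qed.

Lemma sqrtD_indep (p q : rat) : ratr p + ratr q * w = 0 -> p = 0 /\ q = 0.
Proof.
move=> h; have [q0|q0] := eqVneq q 0.
  by move: h; rewrite q0 raddf0 mul0r addr0 => /eqP; rewrite fmorph_eq0 => /eqP.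
exfalso; have hw : ratr (- p / q) = w :> R.
  rewrite rmorphM /= fmorphV /= rmorphN /=; apply: (mulIf (x := ratr q)).
    by rewrite fmorph_eq0.
  by rewrite mulfVK ?fmorph_eq0 // mulrC; apply/eqP; rewrite eq_sym -addr_eq0 addrC h.
have : (- p / q) ^+ 2 = D%:~R.
  by apply: (@fmorph_inj _ _ (@ratr R)); rewrite rmorphXn /= hw sqrtD_sqr ratr_int.
by move/rat_sqr_int => [m hm]; case: hD => _ _ /(_ m).
Qed.

Lemma sqrtD_inj (p q p' q' : rat) :
  ratr p + ratr q * w = ratr p' + ratr q' * w -> p = p' /\ q = q'.
Proof.
move=> /eqP; rewrite -subr_eq0 => /eqP h.
have [] := @sqrtD_indep (p - p') (q - q').
  by rewrite !rmorphB /= -h; ring.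
by move=> /eqP; rewrite subr_eq0 => /eqP -> /eqP; rewrite subr_eq0 => /eqP ->.
Qed.

Lemma sqrtD_intinj (p q p' q' : int) (t : R) (r s : rat) :
  t = ratr r + ratr s * w -> s != 0 ->
  p%:~R + q%:~R * t = p'%:~R + q'%:~R * t -> p = p' /\ q = q'.
Proof.
move=> -> s0 h.
have [] := @sqrtD_inj (p%:~R + q%:~R * r) (q%:~R * s) (p'%:~R + q'%:~R * r) (q'%:~R * s).
  rewrite !rmorphD !rmorphM /= !ratr_int.
  by move: h; rewrite !mulrDr !addrA !mulrA.
move=> h1 /(mulIf s0) /intr_inj qq; move: h1; rewrite qq => /addIr /intr_inj.
by move->.
Qed.

(* Irrationality of sqrt D makes the coordinates chosen by [xget] unique. *)
Definition qconj (z : R) : R :=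
  let pq := xget (0, 0) [set pq : rat * rat | z = ratr pq.1 + ratr pq.2 * w] in
  ratr pq.1 - ratr pq.2 * w.

Lemma qconjE (p q : rat) : qconj (ratr p + ratr q * w) = ratr p - ratr q * w.
Proof.
rewrite /qconj; case: xgetP => [[p' q'] _ /= /sqrtD_inj [-> ->] //|].
by move=> /(_ (p, q)) /=.
Qed.

Lemma quad_fieldE z : K z <-> exists p q : rat, z = ratr p + ratr q * w.
Proof.
split=> [[v [p [q [-> _]]]]|[p [q ->]]]; first by exists p, q.
by exists (p ^+ 2 - D%:~R * q ^+ 2), p, q.
Qed.

Lemma quad_field_rat q : K (ratr q).
Proof. by apply/quad_fieldE; exists q, 0; rewrite raddf0 mul0r addr0. Qed.

Lemma quad_field_int (x : int) : K x%:~R.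
Proof. by rewrite -(ratr_int _ x); apply: quad_field_rat. Qed.

Lemma quad_fieldD x y : K x -> K y -> K (x + y).
Proof.
move=> /quad_fieldE [p [q ->]] /quad_fieldE [p' [q' ->]]; apply/quad_fieldE.
by exists (p + p'), (q + q'); rewrite !rmorphD /=; ring.
Qed.

Lemma quad_fieldM x y : K x -> K y -> K (x * y).
Proof.
move=> /quad_fieldE [p [q ->]] /quad_fieldE [p' [q' ->]]; apply/quad_fieldE.
exists (p * p' + q * q' * D%:~R), (p * q' + q * p').
rewrite !rmorphD /= !rmorphM /= ratr_int -sqrtD_sqr; ring.
Qed.

Lemma quad_fieldN x : K x -> K (- x).
Proof.
by rewrite -mulN1r; apply: quad_fieldM; rewrite -(rmorphN1 (intr : int -> R)); exact: quad_field_int.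
Qed.

Lemma qconj_field x : K x -> K (qconj x).
Proof.
move=> /quad_fieldE [p [q ->]]; rewrite qconjE; apply/quad_fieldE.
by exists p, (- q); rewrite rmorphN /= mulNr.
Qed.

Lemma qconjD x y : K x -> K y -> qconj (x + y) = qconj x + qconj y.
Proof.
move=> /quad_fieldE [p [q ->]] /quad_fieldE [p' [q' ->]].
have -> : ratr p + ratr q * w + (ratr p' + ratr q' * w) =
  ratr (p + p') + ratr (q + q') * w by rewrite !rmorphD /=; ring.
by rewrite !qconjE !rmorphD /=; ring.
Qed.

Lemma qconjM x y : K x -> K y -> qconj (x * y) = qconj x * qconj y.
Proof.
move=> /quad_fieldE [p [q ->]] /quad_fieldE [p' [q' ->]].
have -> : (ratr p + ratr q * w) * (ratr p' + ratr q' * w) =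
  ratr (p * p' + q * q' * D%:~R) + ratr (p * q' + q * p') * w.
  by rewrite !rmorphD /= !rmorphM /= ratr_int -sqrtD_sqr; ring.
by rewrite !qconjE !rmorphD /= !rmorphM /= ratr_int -sqrtD_sqr; ring.
Qed.

Lemma qconj_rat q : qconj (ratr q) = ratr q.
Proof. by have := qconjE q 0; rewrite raddf0 mul0r subr0 addr0. Qed.

Lemma qconj_int (x : int) : qconj x%:~R = x%:~R.
Proof. by rewrite -(ratr_int _ x) qconj_rat. Qed.

Lemma qconj1 : qconj 1 = 1. Proof. exact: (qconj_int 1). Qed.

Lemma qconjN x : K x -> qconj (- x) = - qconj x.
Proof.
move=> Kx; rewrite -mulN1r qconjM //; last by apply: (quad_field_int (-1)).
by rewrite (qconj_int (-1)) mulN1r.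
Qed.

Lemma qconjK x : K x -> qconj (qconj x) = x.
Proof.
move=> /quad_fieldE [p [q ->]]; rewrite qconjE -mulNr -rmorphN /= qconjE.
by rewrite rmorphN /= mulNr opprK.
Qed.

Lemma has_norm_qconj l v : has_norm D l v -> K l /\ l * qconj l = ratr v.
Proof.
move=> h; split; first by exists v.
case: h => p [q [-> ->]]; rewrite qconjE rmorphB rmorphM /= ratr_int -sqrtD_sqr.
by rewrite !rmorphXn /=; ring.
Qed.

Lemma qconj_has_norm l : K l -> exists2 v, has_norm D l v & l * qconj l = ratr v.
Proof. by move=> [v hv]; exists v => //; have [] := has_norm_qconj hv. Qed.

Lemma qconj_eq0 x : K x -> qconj x = 0 -> x = 0.
Proof.
by move=> Kx h; rewrite -(qconjK Kx) h; exact: (qconj_int 0).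
Qed.

Lemma qnorm_neq0 x : K x -> x != 0 -> x * qconj x != 0.
Proof.
by move=> Kx x0; rewrite mulf_neq0 //; apply: contra_neq x0; exact: qconj_eq0.
Qed.

Lemma quad_fieldV x : K x -> K x^-1.
Proof.
move=> Kx; have [->|x0] := eqVneq x 0; first by rewrite invr0; exact: (quad_field_int 0).
have := qnorm_neq0 Kx x0; have [v _ hv] := qconj_has_norm Kx; rewrite hv => v0.
rewrite (_ : x^-1 = qconj x * ratr v^-1).
  by apply: quad_fieldM; [exact: qconj_field | exact: quad_field_rat].
rewrite fmorphV /= -hv; have := v0; rewrite -hv mulf_eq0 negb_or => /andP[_ h].
by field; rewrite x0 h.
Qed.

Lemma qconjV x : K x -> qconj x^-1 = (qconj x)^-1.
Proof.
move=> Kx; have [->|x0] := eqVneq x 0.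
  by rewrite invr0 (qconj_int 0) invr0.
have h := qnorm_neq0 Kx x0; move: h; rewrite mulf_eq0 negb_or => /andP[_ h].
apply: (mulIf h); rewrite mulVf // -qconjM ?mulVf ?qconj1 //; exact: quad_fieldV.
Qed.

End QuadraticField.

(** * Lattices of rank two in the reals *)

Section Lattice.
Variable R : realType.
Implicit Types (al be z : R).

Definition lat2 al be : set R :=
  [set z | exists x y : int, z = x%:~R * al + y%:~R * be].

Lemma lat2l al be : lat2 al be al.
Proof. by exists 1, 0; rewrite mul1r mul0r addr0. Qed.

Lemma lat2r al be : lat2 al be be.
Proof. by exists 0, 1; rewrite mul1r mul0r add0r. Qed.

Lemma lat20 al be : lat2 al be 0.
Proof. by exists 0, 0; rewrite !mul0r add0r. Qed.

Lemma lat2D al be y z : lat2 al be y -> lat2 al be z -> lat2 al be (y + z).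
Proof.
move=> [m [k ->]] [m' [k' ->]]; exists (m + m'), (k + k').
by rewrite !rmorphD /=; ring.
Qed.

Lemma lat2B al be y z : lat2 al be y -> lat2 al be z -> lat2 al be (y - z).
Proof.
move=> [m [k ->]] [m' [k' ->]]; exists (m - m'), (k - k').
by rewrite !rmorphB /=; ring.
Qed.

Lemma lat2Z al be (x : int) z : lat2 al be z -> lat2 al be (x%:~R * z).
Proof.
by move=> [m [k ->]]; exists (x * m), (x * k); rewrite !rmorphM /=; ring.
Qed.

Lemma lat2_scale l al be : [set l * z | z in lat2 al be] = lat2 (l * al) (l * be).
Proof.
apply/seteqP; split=> z.
  by move=> [_ [x [y ->]] <-]; exists x, y; ring.
by move=> [x [y ->]]; exists (x%:~R * al + y%:~R * be); [exists x, y|ring].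
Qed.

Lemma lat2_base al be al' be' (p q r s : int) : p * s - q * r = 1 ->
  al' = p%:~R * al + q%:~R * be -> be' = r%:~R * al + s%:~R * be ->
  lat2 al' be' = lat2 al be.
Proof.
move=> hdet -> ->; apply/seteqP; split=> z.
  by move=> [x [y ->]]; exists (x * p + y * r), (x * q + y * s); rewrite !rmorphD !rmorphM /=; ring.
have h : (p%:~R * s%:~R - q%:~R * r%:~R = 1 :> R) by rewrite -!rmorphM -rmorphB hdet.
(* Coordinates with respect to the inverse matrix, which is the adjugate because the determinant is
   1. *)
move=> [x [y ->]]; exists (x * s - y * r), (y * p - x * q).
rewrite !rmorphB !rmorphM /=.
transitivity ((x%:~R * al + y%:~R * be) * (p%:~R * s%:~R - q%:~R * r%:~R)).
  by rewrite h mulr1.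
by ring.
Qed.

End Lattice.

Lemma subgroup_sum (R : realType) (I : set R) m (F : 'I_m -> R) :
  I 0 -> (forall x y, I x -> I y -> I (x + y)) -> (forall i, I (F i)) -> I (\sum_i F i).
Proof. by move=> I0 ID hF; apply: big_ind => // i _; apply: hF. Qed.

Lemma qdisc_parity Q : exists k : int, qdisc Q = qb Q + 2 * k.
Proof.
have [k [h|h]] : exists k : int, qb Q = 2 * k \/ qb Q = 2 * k + 1.
  by exists (qb Q %/ 2)%Z; lia.
- by exists (k * (2 * k - 1) - 2 * qa Q * qc Q); rewrite /qdisc h; ring.
- by exists (k * (2 * k + 1) - 2 * qa Q * qc Q); rewrite /qdisc h; ring.
Qed.

(** * The ideal of a form and its inverse *)

Section FormIdeal.
Variables (R : realType) (D : int) (Q : qform).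
Hypothesis hD : is_discriminant D.
Hypothesis hQ : qdisc Q = D.
Hypothesis ha : 0 < qa Q.
Hypothesis hp : qprimitive Q.

Local Notation w := (sqrtD R D).
Local Notation K := (@quad_field R D).
Local Notation O := (@quad_order R D).
Local Notation a := ((qa Q)%:~R : R).
Local Notation b := ((qb Q)%:~R : R).
Local Notation c := ((qc Q)%:~R : R).

(** This is [a] times a root of [a X ^ 2 + b X + c]. Unlike the root itself it is integral, and
    together with 1 it is a basis of the order. *)
Definition form_root : R := (- b + w) / 2.
Local Notation t := form_root.
Local Notation tc := (- b - t).

Lemma form_root_sqr : t * t = - b * t - a * c.
Proof.
have h : w * w = b * b - 4 * a * c.
  by rewrite -expr2 sqrtD_sqr // -hQ /qdisc rmorphB !rmorphM /=.
by rewrite /form_root; lra.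
Qed.

Lemma form_root_field : K t.
Proof.
apply/quad_fieldE => //; exists (- (qb Q)%:~R / 2), (1 / 2).
by rewrite /form_root !rmorphM /= rmorphN /= !fmorphV /= !ratr_int rmorph1 (ratr_nat _ 2); field.
Qed.

Lemma qconj_form_root : qconj D t = tc.
Proof.
have -> : t = ratr (- (qb Q)%:~R / 2) + ratr (1 / 2) * w.
  by rewrite /form_root !rmorphM /= rmorphN /= !fmorphV /= !ratr_int rmorph1 (ratr_nat _ 2); field.
by rewrite qconjE // !rmorphM /= rmorphN /= !fmorphV /= !ratr_int rmorph1 (ratr_nat _ 2); field.
Qed.

Lemma qconj_lat (x y : R) (k m : int) : K x -> K y ->
  qconj D (k%:~R * x + m%:~R * y) = k%:~R * qconj D x + m%:~R * qconj D y.
Proof.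
move=> Kx Ky; have Ki := @quad_field_int R D.
by rewrite qconjD ?(qconjM hD (Ki _)) ?qconj_int //; apply: quad_fieldM.
Qed.

Lemma qconj_root_lat (k m : int) :
  qconj D (k%:~R + m%:~R * t) = k%:~R + m%:~R * tc.
Proof.
have := @qconj_lat 1 t k m (@quad_field_int R D 1) form_root_field.
by rewrite qconj1 // qconj_form_root !mulr1.
Qed.

(** [D] and [b] have the same parity, so [(D + w) / 2] and [t] differ by an integer. *)
Lemma lat2_quad_order : O = lat2 1 t.
Proof.
have [k] := qdisc_parity Q; rewrite hQ => hk.
have e : (D%:~R + w) / 2 = (k + qb Q)%:~R + t.
  by rewrite {1}hk /form_root !rmorphD rmorphM /=; field.
apply/seteqP; split=> z [x [y ->]].
  by exists (x + y * (k + qb Q)), y; rewrite e !rmorphD rmorphM /= !rmorphD /=; ring.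
exists (x - y * (k + qb Q)), y; rewrite e rmorphB rmorphM !rmorphD /=; ring.
Qed.

Lemma form_idealE : form_ideal D Q = lat2 a t.
Proof. by []. Qed.

Lemma quad_order_int (x : int) : O x%:~R.
Proof. by rewrite lat2_quad_order; exists x, 0; rewrite mulr1 mul0r addr0. Qed.

Lemma quad_order_root : O t.
Proof. by rewrite lat2_quad_order; exact: lat2r. Qed.

Lemma quad_order_field z : O z -> K z.
Proof.
rewrite lat2_quad_order => -[x [y ->]]; rewrite mulr1.
apply: quad_fieldD => //; first exact: quad_field_int.
by apply: quad_fieldM => //; [exact: quad_field_int|exact: form_root_field].
Qed.

(** As the order is spanned by 1 and [t], stability has to be tested only for [t] on the two
    generators. *)
Lemma lat2_stable (al be o z : R) : lat2 al be (t * al) -> lat2 al be (t * be) ->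
  O o -> lat2 al be z -> lat2 al be (o * z).
Proof.
rewrite lat2_quad_order => h1 h2 [x [y ->]] [x' [y' ->]].
have -> : (x%:~R * 1 + y%:~R * t) * (x'%:~R * al + y'%:~R * be) =
  (x%:~R * (x'%:~R * al + y'%:~R * be)) + (y%:~R * (x'%:~R * (t * al) + y'%:~R * (t * be))).
  by ring.
apply: lat2D; apply: lat2Z; first by exists x', y'.
by apply: lat2D; apply: lat2Z.
Qed.

Lemma quad_orderM x y : O x -> O y -> O (x * y).
Proof.
move=> Ox; rewrite lat2_quad_order; apply: lat2_stable => //.
  by rewrite mulr1; exact: lat2r.
by exists (- (qa Q * qc Q)), (- qb Q); rewrite form_root_sqr !rmorphN !rmorphM /=; ring.
Qed.

Lemma quad_orderD x y : O x -> O y -> O (x + y).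
Proof. by rewrite lat2_quad_order; apply: lat2D. Qed.

Lemma quad_orderB x y : O x -> O y -> O (x - y).
Proof. by rewrite lat2_quad_order; apply: lat2B. Qed.

Lemma quad_order1 : O 1. Proof. exact: (quad_order_int 1). Qed.

Lemma quad_order_trace x : O x -> exists k : int, x + qconj D x = k%:~R.
Proof.
rewrite lat2_quad_order => -[k [y ->]]; exists (2 * k - y * qb Q).
by rewrite !mulr1 qconj_root_lat rmorphB !rmorphM /=; ring.
Qed.

Lemma quad_order_norm x : O x -> exists k : int, x * qconj D x = k%:~R.
Proof.
rewrite lat2_quad_order => -[k [y ->]]; exists (k ^+ 2 - k * y * qb Q + y ^+ 2 * (qa Q * qc Q)).
rewrite mulr1 qconj_root_lat rmorphD rmorphB !rmorphM /=.
have h2 := congr1 (fun z => y%:~R ^+ 2 * z) form_root_sqr; rewrite /= in h2.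
by lra.
Qed.

Lemma quad_field_denom l : K l -> exists2 N : int, N != 0 & O (N%:~R * l).
Proof.
move=> /quad_fieldE [p [q ->]].
exists (denq p * denq q); first by rewrite mulf_neq0 ?denq_neq0.
rewrite lat2_quad_order.
exists (numq p * denq q + numq q * denq p * qb Q), (2 * numq q * denq p).
have ew : w = 2 * t + b by rewrite /form_root; field.
have hr (r : rat) : ratr r = (numq r)%:~R / (denq r)%:~R :> R by [].
rewrite (hr p) (hr q) {1}ew !rmorphD !rmorphM /=; field.
by rewrite !intr_eq0 !denq_neq0.
Qed.

Lemma fractional_lat2 (al be : R) : K al -> K be -> al != 0 ->
  lat2 al be (t * al) -> lat2 al be (t * be) -> fractional_ideal D (lat2 al be).
Proof.
move=> Ka Kb a0 h1 h2; split.
- move=> _ [x [y ->]]; apply: quad_fieldD => //; apply: quad_fieldM => //; exact: quad_field_int.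
- by exists al => //; exact: lat2l.
- by move=> x y; exact: lat2B.
- by move=> o x; exact: lat2_stable.
- have [N N0 ON] := quad_field_denom Ka; have [M M0 OM] := quad_field_denom Kb.
  exists (N * M)%:~R; split; first exact: quad_order_int.
    by rewrite intr_eq0 mulf_neq0.
  move=> _ [x [y ->]].
  have -> : (N * M)%:~R * (x%:~R * al + y%:~R * be) =
    (M * x)%:~R * (N%:~R * al) + (N * y)%:~R * (M%:~R * be) by rewrite !rmorphM /=; ring.
  by apply: quad_orderD; apply: quad_orderM => //; exact: quad_order_int.
Qed.

Definition ideal_of (l : R) : set R := lat2 (l * a) (l * t).
(* The conjugate of [ideal_of], divided by the norm of the form ideal: at [l^-1] it is
   the inverse of [ideal_of l]. *)
Definition coideal_of (l : R) : set R := lat2 l (l * (tc / a)).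

Let a_neq0 : a != 0. Proof. by rewrite intr_eq0 gt_eqF. Qed.

Lemma ideal_of_stable l o z : O o -> ideal_of l z -> ideal_of l (o * z).
Proof.
apply: lat2_stable; first by exists 0, (qa Q); ring.
exists (- qc Q), (- qb Q); rewrite mulrCA form_root_sqr !rmorphN /=; ring.
Qed.

Lemma coideal_of_stable l o z : O o -> coideal_of l z -> coideal_of l (o * z).
Proof.
have h := form_root_sqr.
apply: lat2_stable; first by exists (- qb Q), (- qa Q); rewrite !rmorphN /=; field.
exists (qc Q), 0; rewrite mul0r addr0.
have -> : t * (l * (tc / a)) = l * (- b * t - t * t) / a by field.
by rewrite h; field.
Qed.

Lemma ideal_of_fractional l : K l -> l != 0 -> fractional_ideal D (ideal_of l).
Proof.
move=> Kl l0; apply: fractional_lat2.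
- by apply: quad_fieldM => //; exact: quad_field_int.
- by apply: quad_fieldM => //; exact: form_root_field.
- by rewrite mulf_neq0.
- by apply: ideal_of_stable; [exact: quad_order_root|exact: lat2l].
- by apply: ideal_of_stable; [exact: quad_order_root|exact: lat2r].
Qed.

Lemma coideal_of_fractional l : K l -> l != 0 -> fractional_ideal D (coideal_of l).
Proof.
move=> Kl l0; apply: fractional_lat2 => //.
- apply: quad_fieldM => //; apply: quad_fieldM => //; last first.
    by apply: quad_fieldV => //; exact: quad_field_int.
  apply: quad_fieldD => //; apply: quad_fieldN => //; [exact: quad_field_int|exact: form_root_field].
- by apply: coideal_of_stable; [exact: quad_order_root|exact: lat2l].
- by apply: coideal_of_stable; [exact: quad_order_root|exact: lat2r].
Qed.

Lemma form_coeff_bezout : exists u v s : int, u * qa Q + v * qb Q + s * qc Q = 1.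
Proof.
have [u1 [v1 h1]] := Bezoutz (qa Q) (qb Q).
have [u2 [v2 h2]] := Bezoutz (gcdz (qa Q) (qb Q)) (qc Q).
exists (u2 * u1), (u2 * v1), v2.
by rewrite -hp -h2 -h1; ring.
Qed.

(** Up to the factor [l * k], the four products of generators are [a], [t], [- b - t] and [c]. They
    lie in the order, and they generate it because [a], [b], [c] have no common divisor: primitivity
    is what makes the ideal invertible. *)
Lemma ideal_of_mul l k :
  ideal_mul (ideal_of l) (coideal_of k) = [set l * k * o | o in O].
Proof.
have h := form_root_sqr.
apply/seteqP; split=> z.
  move=> [m [x [y [hx hy ->]]]]; rewrite {1}lat2_quad_order lat2_scale.
  apply: subgroup_sum; [exact: lat20|by move=> ? ?; exact: lat2D|move=> i].
  have [p [q ->]] := hx i; have [r [s ->]] := hy i.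
  exists (p * r * qa Q - p * s * qb Q + q * s * qc Q), (q * r - p * s).
  have -> : q%:~R * (l * t) = q%:~R * l * t by ring.
  rewrite !rmorphD !rmorphN !rmorphM /=.
  transitivity (l * k * (p%:~R * r%:~R * a + q%:~R * r%:~R * t
    + p%:~R * s%:~R * tc + q%:~R * s%:~R * (- b * t - t * t) / a)); first by field.
  by rewrite h; field.
move=> [om Oom <-]; have [u [v [s huvs]]] := form_coeff_bezout.
have huvsR : u%:~R * a + v%:~R * b + s%:~R * c = 1 :> R.
  by rewrite -!rmorphM -!rmorphD huvs.
(* Since [b = - t - tc] and [c = t * tc / a], the Bezout relation [u a + v b + s c = 1] groups into
   one term for each generator of [coideal_of k]. *)
exists 2%N, (fun i => if i == ord0 then om * (u%:~R * (l * a) + (- v)%:~R * (l * t))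
   else om * ((- v)%:~R * (l * a) + s%:~R * (l * t))),
  (fun i => if i == ord0 then k else k * (tc / a)); split.
- by move=> i; case: ifP => _; apply: ideal_of_stable => //; [exists u, (- v)|exists (- v), s].
- by move=> i; case: ifP => _; [exact: lat2l|exact: lat2r].
- rewrite big_ord_recl big_ord1 /= !rmorphN /=.
  transitivity (l * k * om * (u%:~R * a + v%:~R * b + s%:~R * ((- b * t - t * t) / a))); last by field.
  have -> : (- b * t - t * t) / a = c by rewrite h; field.
  by rewrite huvsR mulr1.
Qed.

Lemma ideal_of_inverse l : K l -> l != 0 -> ideal_inverse D (ideal_of l) (coideal_of l^-1).
Proof.
move=> Kl l0; split; first exact: ideal_of_fractional.
  by apply: coideal_of_fractional; [exact: quad_fieldV|rewrite invr_neq0].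
rewrite ideal_of_mul divff //; apply/seteqP; split=> z; first by move=> [om ? <-]; rewrite mul1r.
by move=> Oz; exists z => //; rewrite mul1r.
Qed.

Lemma fractional_closed I : fractional_ideal D I ->
  I (0 : R) /\ forall x y, I x -> I y -> I (x + y).
Proof.
move=> [_ [x Ix _] hB _ _]; have I0 : I 0 by rewrite -(subrr x); apply: (hB).
split=> // y z Iy Iz; rewrite -[z]opprK; apply: (hB) => //.
by rewrite -sub0r; apply: hB.
Qed.

(** Write 1 as a sum of products [x_i * y_i] with [x_i] in [J] and [y_i] in [J']. For [z] in [I]
    each [z * y_i] lies in [l * O], so [z], the sum of the [z * y_i * x_i], lies in [l * J]. The
    other inclusion expands [l] itself as an element of [I J']. *)
Lemma ideal_quotient I J J' (l : R) : fractional_ideal D I -> fractional_ideal D J ->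
  ideal_mul J J' = O -> ideal_mul I J' = [set l * o | o in O] ->
  I = [set l * z | z in J].
Proof.
move=> fI fJ hJ hI; have [I0 ID] := fractional_closed fI.
have [J0 JD] := fractional_closed fJ.
case: fI => _ _ _ stI _; case: fJ => _ _ _ stJ _.
apply/seteqP; split=> z.
  move=> Iz; have := quad_order1; rewrite -hJ => -[m [x [y [hx hy h1]]]].
  have /choice [om hom] : forall i, exists v, O v /\ z * y i = l * v.
    move=> i; have : ideal_mul I J' (z * y i).
      by exists 1%N, (fun=> z), (fun=> y i); split => //; rewrite big_ord1.
    by rewrite hI => -[v Ov <-]; exists v.
  exists (\sum_i om i * x i).
    by apply: subgroup_sum => // i; apply: stJ => //; case: (hom i).
  rewrite -[RHS]mulr1 h1 !mulr_sumr; apply: eq_bigr => i _.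
  by rewrite mulrA -(hom i).2; ring.
move=> [x Jx <-].
have : [set l * o | o in O] l by exists 1; [exact: quad_order1|rewrite mulr1].
rewrite -hI => -[m [x' [y [hz hy ->]]]]; rewrite mulr_suml.
apply: subgroup_sum => // i; rewrite -mulrA mulrC; apply: stI => //.
by rewrite -hJ; exists 1%N, (fun=> x), (fun=> y i); split => //; rewrite big_ord1 mulrC.
Qed.

End FormIdeal.

(** The primitive vector [(q', s')] is completed to a matrix of determinant 1; this is the step that
    brings a lattice to Hermite form. *)
Lemma unimodular_basis (q s : int) : (q != 0) || (s != 0) ->
  exists g q' s' u v : int,
    [/\ 0 < g, q = g * q', s = g * s' & s' * v + q' * u = 1].
Proof.
move=> qs; have [u [v huv]] := Bezoutz q s.
have g0 : 0 < gcdz q s.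
  rewrite lt_neqAle; apply/andP; split; last by [].
  by rewrite eq_sym gcdz_eq0 negb_and.
have /dvdzP [q' hq] := dvdz_gcdl q s; have /dvdzP [s' hs] := dvdz_gcdr q s.
exists (gcdz q s), q', s', u, v; split=> //; [by rewrite mulrC|by rewrite mulrC|].
apply: (mulfI (lt0r_neq0 g0)); rewrite mulr1 -[RHS]huv.
by transitivity (u * (q' * gcdz q s) + v * (s' * gcdz q s)); [ring|rewrite -hq -hs].
Qed.

(** * Ideals of a narrow class and their norms *)

Section Classes.
Variables (R : realType) (D : int) (Q : qform).
Hypothesis hD : is_discriminant D.
Hypothesis hQ : qdisc Q = D.
Hypothesis ha : 0 < qa Q.
Hypothesis hp : qprimitive Q.

Local Notation w := (sqrtD R D).
Local Notation K := (@quad_field R D).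
Local Notation O := (@quad_order R D).
Local Notation a := ((qa Q)%:~R : R).
Local Notation b := ((qb Q)%:~R : R).
Local Notation t := (form_root R D Q).
Local Notation tc := (- b - t).
Local Notation conj := (@qconj R D).
Local Notation ideal := (@ideal_of R D Q).
Local Notation coideal := (@coideal_of R D Q).

Let a_neq0 : a != 0. Proof. by rewrite intr_eq0 gt_eqF. Qed.
Let Ki := @quad_field_int R D.
Let Kt := @form_root_field R D Q.
Let t2 := @form_root_sqr R D Q hD hQ.

(** A substitution in the form is a change of basis of the ideal followed by a dilation by [m]. The
    norm of [m] is the quotient of the two leading coefficients, so their positivity keeps the
    narrow class. *)
Lemma qequiv_ideal Q' : qequiv Q Q' -> 0 < qa Q' ->
  exists m, [/\ K m, 0 < m * conj m & form_ideal D Q' = ideal m].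
Proof.
move=> [p [q [r [s [hdet hev]]]]] ha'.
have e1 : qa Q' = qa Q * p ^+ 2 + qb Q * p * r + qc Q * r ^+ 2.
  by have := hev 1 0; rewrite /qeval; lia.
have e3 : qc Q' = qa Q * q ^+ 2 + qb Q * q * s + qc Q * s ^+ 2.
  by have := hev 0 1; rewrite /qeval; lia.
have e2 : qb Q' = 2 * qa Q * p * q + qb Q * (p * s + q * r) + 2 * qc Q * r * s.
  have := hev 1 1; rewrite /qeval e1 e3; lia.
(* Its norm is [a * Q(p, r)], and [Q(p, r)] is the leading coefficient of [Q']. *)
pose th := p%:~R * a - r%:~R * tc.
have Kth : K th.
  apply: quad_fieldD => //; first exact: quad_fieldM.
  apply: quad_fieldN => //; apply: quad_fieldM => //; apply: quad_fieldD => //; exact: quad_fieldN.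
have cth : conj th = p%:~R * a - r%:~R * t.
  have -> : th = (p * qa Q + r * qb Q)%:~R + r%:~R * t.
    by rewrite /th rmorphD !rmorphM /=; ring.
  by rewrite qconj_root_lat // rmorphD !rmorphM /=; ring.
have cm : conj (th / a) = conj th / a.
  by rewrite qconjM ?qconjV ?qconj_int //; apply: quad_fieldV.
have nm : th / a * conj (th / a) = (qa Q')%:~R / a.
  rewrite cm cth /th e1 !rmorphD !rmorphM /=.
  transitivity ((p%:~R ^+ 2 * a ^+ 2 + p%:~R * r%:~R * a * b
     + r%:~R ^+ 2 * (- b * t - t * t)) / a ^+ 2); first by field.
  by rewrite t2; field.
exists (th / a); split.
- by apply: quad_fieldM => //; apply: quad_fieldV.
- by rewrite nm divr_gt0 // ltr0z.
- rewrite form_idealE /ideal_of.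
  apply: (@lat2_base _ _ _ _ _ p (- r) (- q) s); first by rewrite -hdet; ring.
    rewrite e1 /th !rmorphD !rmorphN !rmorphM /=.
    transitivity (p%:~R ^+ 2 * a + p%:~R * r%:~R * b
     + r%:~R ^+ 2 * ((- b * t - t * t) / a)); first by rewrite t2; field.
    by field.
  have hdetR : p%:~R * s%:~R - q%:~R * r%:~R = 1 :> R.
    by rewrite -!rmorphM -rmorphB hdet.
  rewrite {1}/form_root e2 /th !rmorphD !rmorphN !rmorphM /=.
  have ew : w = (2 * t + b) * (p%:~R * s%:~R - q%:~R * r%:~R).
    by rewrite hdetR /form_root; field.
  rewrite {1}ew.
  transitivity (- p%:~R * q%:~R * a + p%:~R * s%:~R * t + q%:~R * r%:~R * tc
     - r%:~R * s%:~R * ((- b * t - t * t) / a)); first by rewrite t2 !rmorphD !rmorphM /=; field.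
  by field.
Qed.

Lemma form_ideal_ideal_of1 : form_ideal D Q = ideal 1.
Proof. by rewrite form_idealE /ideal_of !mul1r. Qed.

Lemma ideal_ofM l k : [set l * z | z in ideal k] = ideal (l * k).
Proof. by rewrite lat2_scale /ideal_of !mulrA. Qed.

Lemma ideal_mul11 : ideal_mul (ideal 1) (coideal 1) = O.
Proof.
rewrite ideal_of_mul //; apply/seteqP; split=> z.
  by move=> [v Ov <-]; rewrite !mul1r.
by move=> Oz; exists z => //; rewrite !mul1r.
Qed.

Lemma coideal_of_field l : coideal 1 l -> K l.
Proof.
have [h _ _ _ _] := coideal_of_fractional hD hQ ha (Ki 1) (oner_neq0 R).
exact: h.
Qed.

(** [coideal 1] is the inverse of [ideal 1]: expanding 1 as a sum of products of their elements
    shows that whatever multiplies [ideal 1] into the order belongs to it. *)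
Lemma ideal_of_subO l : ideal l `<=` O <-> coideal 1 l.
Proof.
split=> [hl|hl z].
  have := quad_order1 R hQ; rewrite -ideal_mul11 => -[m [x [y [hx hy h1]]]].
  have -> : l = \sum_i (l * x i) * y i.
    rewrite -[LHS]mulr1 [X in _ * X]h1 mulr_sumr.
    by apply: eq_bigr => i _; rewrite mulrA.
  apply: subgroup_sum; [exact: lat20|by move=> ? ?; exact: lat2D|move=> i].
  apply: coideal_of_stable => //; apply: hl.
  by rewrite -[X in ideal X]mulr1 -ideal_ofM; exists (x i).
rewrite -[X in ideal X]mulr1 -ideal_ofM => -[x hx <-].
rewrite -ideal_mul11; exists 1%N, (fun=> x), (fun=> l).
by split=> //; rewrite big_ord1 mulrC.
Qed.

(** The sum over ideals becomes a sum over elements of positive norm in one fixed lattice. An ideal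
    comes from many [l], differing by units; the cone below selects one of them. *)
Lemma class_idealsE (I : set R) :
  [/\ invertible_ideal D I, I `<=` O & ideal_class D [set Q' | qequiv Q Q'] I] <->
  exists l, [/\ coideal 1 l, 0 < l * conj l & I = ideal l].
Proof.
split.
  move=> [_ IO [Q' [/= hQ' ha' [J' [l [v [fI [fQ' _ hinv] hl v0 hmul]]]]]]].
  have [m [Km Nm em]] := qequiv_ideal hQ' ha'.
  have [Kl Nl] := has_norm_qconj hD hl.
  have eI : I = ideal (l * m).
    by rewrite (ideal_quotient hQ fI fQ' hinv hmul) em ideal_ofM.
  exists (l * m); split=> //; first by apply/ideal_of_subO; rewrite -eI.
  rewrite qconjM // mulrACA Nl mulr_gt0 //.
  by rewrite ltr0q.
move=> [l [hl Nl ->]]; have Kl := coideal_of_field hl.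
have l0 : l != 0 by apply: contraTneq Nl => ->; rewrite mul0r ltxx.
split; [by exists (coideal l^-1); exact: ideal_of_inverse|exact/ideal_of_subO|].
exists Q; split => //; first by exists 1, 0, 0, 1; split=> // x y; rewrite !mul1r !mul0r addr0 add0r.
have [v hv ev] := qconj_has_norm hD Kl.
exists (coideal 1), l, v; split=> //.
- exact: ideal_of_fractional.
- rewrite form_ideal_ideal_of1; split; last exact: ideal_mul11.
    by apply: ideal_of_fractional => //; exact: (Ki 1).
  by apply: coideal_of_fractional => //; exact: (Ki 1).
- by rewrite -(ltr0q R) -ev.
- by rewrite ideal_of_mul // mulr1.
Qed.

Lemma ideal_of_eqP l k : K l -> K k -> l != 0 -> k != 0 -> ideal l = ideal k -> O (l / k).
Proof.
move=> Kl Kk l0 k0 e; have [_ _ h] := ideal_of_inverse hD hQ ha hp Kk k0.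
rewrite -h -e ideal_of_mul //; exists 1; last by rewrite mulr1.
exact: (quad_order1 _ hQ).
Qed.

Lemma ideal_of_unit u l : O u -> O u^-1 -> u != 0 -> ideal (u * l) = ideal l.
Proof.
move=> Ou Ov u0; apply/seteqP; split=> z; rewrite -ideal_ofM.
  by move=> [x hx <-]; exact: ideal_of_stable.
move=> hz; exists (u^-1 * z); first exact: ideal_of_stable.
by rewrite mulrA divff // mul1r.
Qed.

Lemma root_lat_inj (p q p' q' : int) :
  p%:~R + q%:~R * t = p'%:~R + q'%:~R * t -> p = p' /\ q = q'.
Proof.
apply: (@sqrtD_intinj R D hD _ _ _ _ t (- (qb Q)%:~R / 2) (1 / 2)) => //.
by rewrite /form_root !rmorphM /= rmorphN /= !fmorphV /= !ratr_int rmorph1 (ratr_nat _ 2); field.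
Qed.

(** The cosets are represented by [i + j t] with [0 <= i < A] and [0 <= j < C], numbered by
    [k = j * A + i]. *)
Lemma hermite_index (A C : nat) (B : int) : (0 < A)%N -> (0 < C)%N ->
  ideal_norm D (lat2 (A%:Z%:~R) (B%:~R + C%:Z%:~R * t)) = (A * C)%N.
Proof.
move=> A0 C0; set I := lat2 _ _.
have IB x y : I x -> I y -> I (x - y) by exact: lat2B.
have ID x y : I x -> I y -> I (x + y) by exact: lat2D.
have I0 : I 0 by exact: lat20.
pose co (x : R) := [set y | I (y - x)].
have coE x y : I (x - y) -> co x = co y.
  move=> h; apply/seteqP; split=> z; rewrite /co /= => hz.
    by rewrite (_ : z - y = (z - x) + (x - y)); [apply: ID|ring].
  by rewrite (_ : z - x = (z - y) - (x - y)); [apply: IB|ring].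
pose f (k : nat) := co ((k %% A)%N%:Z%:~R + (k %/ A)%N%:Z%:~R * t).
apply: card_fset_set.
have -> : [set [set y | I (y - x)] | x in O] = f @` `I_(A * C).
  apply/seteqP; split=> z [x].
    rewrite (lat2_quad_order R hQ) => -[i [j ->]] <-.
    (* The [t]-coordinate is reduced first, since subtracting [k] times the second generator also
       moves the constant coordinate by [k * B]. *)
    pose j0 := (j %% C%:Z)%Z; pose k := (j %/ C%:Z)%Z.
    pose i0 := ((i - k * B) %% A%:Z)%Z; pose m := ((i - k * B) %/ A%:Z)%Z.
    have hj0 : 0 <= j0 < C%:Z by rewrite /j0; lia.
    have hi0 : 0 <= i0 < A%:Z by rewrite /i0; lia.
    have hj : j = k * C%:Z + j0 by exact: divz_eq.
    have hi : i = k * B + m * A%:Z + i0.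
      have := divz_eq (i - k * B) A%:Z; rewrite -/m -/i0; lia.
    exists (`|j0| * A + `|i0|)%N; first by rewrite /=; nia.
    rewrite /f modnMDl divnMDl // modn_small; last by lia.
    rewrite divn_small; last by lia.
    rewrite addn0 !gez0_abs; [|by lia|by lia].
    apply/esym/coE; exists m, k; rewrite {1}hi {1}hj !rmorphD !rmorphM /=; ring.
  rewrite /= => hx <-; exists ((x %% A)%N%:Z%:~R + (x %/ A)%N%:Z%:~R * t) => //.
  by rewrite (lat2_quad_order R hQ); exists (x %% A)%N%:Z, (x %/ A)%N%:Z; rewrite mulr1.
apply: inj_card_eq => x y; rewrite !inE /= => hx hy hf.
have : co ((x %% A)%N%:Z%:~R + (x %/ A)%N%:Z%:~R * t) ((x %% A)%N%:Z%:~R + (x %/ A)%N%:Z%:~R * t).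
  by rewrite /co /= subrr.
rewrite -/(f x) hf /f /co /= => -[m [k h]].
have [e1 e2] : (x %% A)%N%:Z - (y %% A)%N%:Z = m * A%:Z + k * B /\ (x %/ A)%N%:Z - (y %/ A)%N%:Z = k * C%:Z.
  apply: root_lat_inj.
  rewrite !rmorphB !rmorphD !rmorphM /=.
  transitivity (m%:~R * A%:Z%:~R + k%:~R * (B%:~R + C%:Z%:~R * t)); last by ring.
  by rewrite -h; ring.
have hx1 : (x %/ A < C)%N by rewrite ltn_divLR // mulnC.
have hy1 : (y %/ A < C)%N by rewrite ltn_divLR // mulnC.
have k0 : k = 0 by nia.
rewrite k0 mul0r addr0 in e1; rewrite k0 mul0r in e2.
have hx2 : (x %% A < A)%N by rewrite ltn_mod.
have hy2 : (y %% A < A)%N by rewrite ltn_mod.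
have m0 : m = 0 by nia.
rewrite m0 mul0r in e1.
by rewrite (divn_eq x A) (divn_eq y A); congr (_ * _ + _)%N; lia.
Qed.

(** A unimodular change of basis clears the [t]-coordinate of one generator and leaves a triangular
    basis with diagonal [A], [g], where [A * g] is the determinant. *)
Lemma lat2_index (p q r s : int) : (0 < p * s - q * r)%R ->
  ideal_norm D (lat2 (p%:~R + q%:~R * t) (r%:~R + s%:~R * t)) =
  absz (p * s - q * r)%R.
Proof.
move=> hdet.
have [|g [q' [s' [u [v [g0 hq hs h1]]]]]] := @unimodular_basis q s.
  by apply: contraTT hdet; rewrite negb_or !negbK => /andP[/eqP -> /eqP ->]; rewrite mulr0 mul0r subrr ltxx.
pose A := s' * p - q' * r; pose B := u * p + v * r.
have hA : A * g = p * s - q * r by rewrite /A hq hs; ring.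
have A0 : 0 < A by rewrite -(pmulr_lgt0 _ g0) hA.
have hg : u * q + v * s = g by rewrite -[RHS]mulr1 -h1 hq hs; ring.
rewrite -(@lat2_base R _ _ (A%:~R) (B%:~R + g%:~R * t) s' (- q') u v).
- rewrite -hA abszM -(hermite_index B) ?absz_gt0 ?lt0r_neq0 //.
  by rewrite !gez0_abs // ltW.
- by rewrite -h1; ring.
- rewrite /A hq hs !rmorphD !rmorphN !rmorphM /=; ring.
- rewrite /B -hg !rmorphD !rmorphM /=; ring.
Qed.

Lemma ideal_of_norm l : coideal 1 l -> 0 < l * conj l ->
  (ideal_norm D (ideal l))%:R = a * (l * conj l).
Proof.
move=> hl Nl; have Kl := coideal_of_field hl.
have /ideal_of_subO hO := hl.
have : O (l * a) by apply: hO; exact: lat2l.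
have : O (l * t) by apply: hO; exact: lat2r.
rewrite (lat2_quad_order R hQ) => -[r [s e2]] [p [q e1]]; rewrite mulr1 in e1; rewrite mulr1 in e2.
have c1 := congr1 conj e1; have c2 := congr1 conj e2.
rewrite qconjM ?qconj_root_lat ?qconj_int // in c1.
rewrite (qconjM hD Kl Kt) qconj_root_lat // qconj_form_root // in c2.
have hw : t - tc = w by rewrite /form_root; field.
have w0 : w != 0 by rewrite gt_eqF // sqrtD_gt0.
(* The determinant formed by [l * a], [l * t] and their conjugates is computed twice: from the
   factor [l], and from the coordinates in the basis [1, t]. *)
have det : a * (l * conj l) = (p * s - q * r)%:~R.
  apply: (mulIf w0); rewrite -hw rmorphB !rmorphM /=.
  transitivity ((conj l * a) * (l * t) - (l * a) * (conj l * tc)); first by ring.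
  by rewrite c1 c2 e1 e2; ring.
have dpos : 0 < p * s - q * r.
  by rewrite -(ltr0z R) -det mulr_gt0 // ltr0z.
rewrite /ideal_of e1 e2 lat2_index // det -[in RHS](gtz0_abs dpos).
by rewrite -pmulrn.
Qed.

End Classes.

(** * Units of norm 1 and the class zeta function as a sum over a cone *)

Lemma exprn_gt_some (R : realType) (x y : R) : 1 < x -> exists k, y < x ^+ k.
Proof.
move=> x1; have x0 : 0 < x - 1 by rewrite subr_gt0.
have bern k : 1 + k%:R * (x - 1) <= x ^+ k.
  elim: k => [|k IH]; first by rewrite mul0r addr0 expr0.
  rewrite exprS -natr1.
  have h : x * (1 + k%:R * (x - 1)) <= x * x ^+ k by rewrite ler_pM2l //; lra.
  by have := mulr_ge0 (ler0n R k) (sqr_ge0 (x - 1)); nra.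
have := archi_boundP (normr_ge0 (y / (x - 1))); set k := Num.bound _ => hk.
exists k; apply: lt_le_trans (bern k).
have := le_lt_trans (ler_norm _) hk; rewrite ltr_pdivrMr //; lra.
Qed.

Lemma exprn_between (R : realType) (x y : R) : 1 < x -> 1 <= y ->
  exists k, x ^+ k <= y < x ^+ k.+1.
Proof.
move=> x1 y1; have := exprn_gt_some y x1 => h.
have [[|k] hk hmin] := ex_minnP h; first by rewrite expr0 in hk; lra.
exists k; rewrite hk andbT leNgt; apply/negP => /hmin; by rewrite ltnn.
Qed.

Lemma int_mul_eq1 (m m' : int) : 0 < m -> m * m' = 1 -> m = 1.
Proof.
move=> m0 h; have m1 : 0 < m' by rewrite -(pmulr_rgt0 _ m0) h.
by nia.
Qed.

Section ClassZeta.
Variables (R : realType) (D : int) (Q : qform).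
Hypothesis hD : is_discriminant D.
Hypothesis hQ : qdisc Q = D.
Hypothesis ha : 0 < qa Q.
Hypothesis hp : qprimitive Q.

Local Notation w := (sqrtD R D).
Local Notation K := (@quad_field R D).
Local Notation O := (@quad_order R D).
Local Notation a := ((qa Q)%:~R : R).
Local Notation b := ((qb Q)%:~R : R).
Local Notation c := ((qc Q)%:~R : R).
Local Notation t := (form_root R D Q).
Local Notation tc := (- b - t).
Local Notation conj := (@qconj R D).
Local Notation ideal := (@ideal_of R D Q).
Local Notation coideal := (@coideal_of R D Q).

Let a_neq0 : a != 0. Proof. by rewrite intr_eq0 gt_eqF. Qed.
Let a_gt0 : 0 < a. Proof. by rewrite ltr0z. Qed.
Let Ki := @quad_field_int R D.
Let Kt := @form_root_field R D Q.
Let KO := @quad_order_field R D Q hD hQ.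

Definition unit1 (u : R) := [/\ O u, O u^-1 & u * conj u = 1].

Lemma unit1_neq0 u : unit1 u -> u != 0.
Proof. by move=> [_ _ h]; apply: contra_eq_neq h => ->; rewrite mul0r eq_sym oner_neq0. Qed.

Lemma unit1_conj u : unit1 u -> conj u = u^-1.
Proof.
move=> hu; have u0 := unit1_neq0 hu; case: hu => _ _ h.
by apply: (mulfI u0); rewrite h divff.
Qed.

Lemma unit1M u v : unit1 u -> unit1 v -> unit1 (u * v).
Proof.
move=> [h1 h2 h3] [k1 k2 k3]; split.
- exact: (quad_orderM hD hQ).
- by rewrite invfM; exact: (quad_orderM hD hQ).
- by rewrite (qconjM hD (KO h1) (KO k1)) mulrACA h3 k3 mulr1.
Qed.

Lemma unit1V u : unit1 u -> unit1 u^-1.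
Proof.
move=> hu; have := unit1_conj hu => hc; case: hu => h1 h2 h3; split=> //.
  by rewrite invrK.
by rewrite qconjV; [rewrite -invfM h3 invr1| | exact: KO].
Qed.

Lemma unit1_1 : unit1 1.
Proof.
split; [exact: (quad_order1 _ hQ)|rewrite invr1; exact: (quad_order1 _ hQ)|].
by rewrite qconj1 // mulr1.
Qed.

Lemma unit1X u k : unit1 u -> unit1 (u ^+ k).
Proof.
move=> hu; elim: k => [|k IH]; first by rewrite expr0; exact: unit1_1.
by rewrite exprS; exact: unit1M.
Qed.

Lemma unit1E u : unit1 u <-> [/\ O u, O u^-1 & has_norm D u 1].
Proof.
split=> -[h1 h2 h3]; split=> //.
  have [v hv] := qconj_has_norm hD (KO h1).
  by rewrite h3 -(rmorph1 (ratr : rat -> R)) => /fmorph_inj ->.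
by have [_ ->] := has_norm_qconj hD h3; rewrite rmorph1.
Qed.

Lemma smallest_unitE eps : smallest_unit D eps <->
  [/\ unit1 eps, 1 < eps & forall u, unit1 u -> 1 < u -> eps <= u].
Proof.
split=> [[[h1 h2 h3 h4] hmin]|[/unit1E [h1 h2 h4] h3 hmin]].
  by split=> // [|u /unit1E [k1 k2 k3] k4]; [apply/unit1E|apply: hmin].
by split=> // u [k1 k2 k3 k4]; apply: hmin => //; apply/unit1E.
Qed.

(** A smallest unit exists because, for a unit [v > 1] of norm 1, the trace [v + v^-1] is a natural
    number and increases with [v]: a unit of least trace is smallest. Dividing [u] by the largest
    power of [eps] below it then leaves 1. *)
Lemma unit_power u : unit1 u -> 1 < u ->
  exists eps k, [/\ smallest_unit D eps, (0 < k)%N & u = eps ^+ k].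
Proof.
move=> hu u1.
have tr v : unit1 v -> 1 < v -> exists k : nat, v + v^-1 = k%:R.
  move=> hv v1; have hc := unit1_conj hv; case: hv => Ov _ _.
  have [k] := quad_order_trace hD hQ Ov; rewrite hc => hk.
  have k0 : 0 <= k by rewrite -(ler0z R) -hk addr_ge0 ?invr_ge0; lra.
  by exists `|k|%N; rewrite hk -[in LHS](gez0_abs k0) pmulrn.
pose P (k : nat) := `[< exists v, [/\ unit1 v, 1 < v & v + v^-1 = k%:R] >].
have exP : exists k, P k.
  by have [k hk] := tr _ hu u1; exists k; apply/asboolP; exists u.
have [k0 /asboolP [eps [he e1 hk0]] hmin] := ex_minnP exP.
have min v : unit1 v -> 1 < v -> eps <= v.
  move=> hv v1; have [k hk] := tr _ hv v1.
  have : (k0 <= k)%N by apply: hmin; apply/asboolP; exists v.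
  rewrite -(ler_nat R) -hk0 -hk => hle; rewrite leNgt; apply/negP => lt.
  have p1 : v * eps > 1 by nra.
  have : (eps - v) * (1 - (v * eps)^-1) > 0.
    by rewrite mulr_gt0 ?subr_gt0 // invf_lt1 //; lra.
  rewrite (_ : _ * _ = eps + eps^-1 - (v + v^-1)); first by lra.
  by field; apply/andP; split; lra.
have [k /andP[hk1 hk2]] := exprn_between e1 (ltW u1).
have ek0 : 0 < eps ^+ k by rewrite exprn_gt0 //; lra.
have hv : unit1 (u / eps ^+ k) by apply: unit1M => //; apply: unit1V; exact: unit1X.
have e : u / eps ^+ k = 1.
  apply/eqP; rewrite eq_le; apply/andP; split; last by rewrite ler_pdivlMr // mul1r.
  rewrite leNgt; apply/negP => /(min _ hv); rewrite leNgt => /negP; apply.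
  by rewrite ltr_pdivrMr // -exprS.
have eu : u = eps ^+ k by rewrite -[RHS]mul1r -e mulfVK // gt_eqF.
exists eps, k; split=> //; first by apply/smallest_unitE; split.
by rewrite lt0n; apply: contraTneq u1 => k00; rewrite eu k00 expr0 ltxx.
Qed.

(** Multiplication by a unit [u] of norm 1 multiplies [l / conj l] by [u ^+ 2], hence the half-open
    range for this ratio. *)
Definition cone (u : R) : set R :=
  [set l | [/\ coideal 1 l, 0 < conj l & conj l <= l < u ^+ 2 * conj l]].

Lemma coideal_unit u l : unit1 u -> coideal 1 l -> coideal 1 (u * l).
Proof. by move=> [Ou _ _]; exact: coideal_of_stable. Qed.

Lemma conj_unit u l : unit1 u -> coideal 1 l -> conj (u * l) = u^-1 * conj l.
Proof.
move=> hu hl; rewrite qconjM // ?(unit1_conj hu) //; first by case: hu => /KO.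
exact: (coideal_of_field hD hQ ha hl).
Qed.

(** Two elements of the cone with the same ideal differ by a unit of norm 1 lying strictly between
    [eps^-1] and [eps], which is 1. Conversely, a sign and a power of [eps] move any [l] of positive
    norm into the cone without changing its ideal. *)
Lemma class_ideals_bij eps : smallest_unit D eps ->
  set_bij (cone eps) [set I | [/\ invertible_ideal D I, I `<=` O
     & ideal_class D [set Q' | qequiv Q Q'] I]] ideal.
Proof.
move=> /smallest_unitE [he e1 hmin].
have e0 : 0 < eps by lra.
have Kc l := @coideal_of_field R D Q hD hQ ha l.
split.
- move=> l [hl c0 /andP[h1 h2]]; apply/(class_idealsE hD hQ ha hp); exists l.
  by split=> //; rewrite mulr_gt0 //; lra.
- move=> l k; rewrite !inE => -[hl c0 /andP[h1 h2]] [hk c0' /andP[h1' h2']] e.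
  have l0 : 0 < l by lra.
  have k0 : 0 < k by lra.
  have O1 := ideal_of_eqP hD hQ ha hp (Kc _ hl) (Kc _ hk) (lt0r_neq0 l0) (lt0r_neq0 k0) e.
  have O2 := ideal_of_eqP hD hQ ha hp (Kc _ hk) (Kc _ hl) (lt0r_neq0 k0) (lt0r_neq0 l0) (esym e).
  have Kv : K k^-1 by apply: quad_fieldV => //; exact: Kc.
  have cE : conj (l / k) = conj l / conj k.
    by rewrite qconjM ?qconjV //; exact: Kc.
  have hu : unit1 (l / k).
    split=> //; first by rewrite invf_div.
    have [m hm] := quad_order_norm hD hQ O1; have [m' hm'] := quad_order_norm hD hQ O2.
    (* The norms of [l / k] and [k / l] are integers with product 1, and the first is positive. *)
    have mm : m * m' = 1.
      apply: (@intr_inj R); rewrite rmorphM /= -hm -hm' mulrACA -qconjM //; [|exact: KO|exact: KO].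
      by rewrite (_ : l / k * (k / l) = 1) ?qconj1 ?mulr1 //; field; rewrite !gt_eqF.
    have m0 : 0 < m by rewrite -(ltr0z R) -hm cE mulr_gt0 ?divr_gt0.
    by rewrite hm (int_mul_eq1 m0 mm).
  have hc := unit1_conj hu; rewrite cE invf_div in hc.
  have d : conj l * l = k * conj k.
    by move: hc; move/(congr1 (fun z => z * conj k * l)); rewrite mulfVK ?gt_eqF // -!mulrA => ->; field; rewrite gt_eqF.
  have no u : unit1 u -> 1 < u -> u < eps -> False.
    by move=> h3 h4; rewrite ltNge hmin.
  (* With equal norms, [x ^ 2 < eps ^ 2 * (x * conj x) = eps ^ 2 * (y * conj y) <= (eps * y) ^
     2]. *)
  have sq x y : 0 < x -> 0 < y -> 0 < conj y -> conj y <= y -> x < eps ^+ 2 * conj x ->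
      x * conj x = conj y * y -> x < eps * y.
    move=> x0 y0 cy g1 g2 g3.
    rewrite -(ltr_pXn2r (n := 2)) ?nnegrE ?mulr_ge0 ?(ltW e0) ?(ltW x0) ?(ltW y0) //.
    have A1 : x * x < eps ^+ 2 * conj x * x by rewrite ltr_pM2r.
    have A2 : eps ^+ 2 * (conj y * y) <= eps ^+ 2 * (y * y).
      by rewrite ler_pM2l ?exprn_gt0 // ler_pM2r.
    by have A3 := congr1 (fun z => eps ^+ 2 * z) g3; rewrite /= in A3; lra.
  have [lt|lt|//] := ltgtP l k.
    case: (no (k / l)); first by rewrite -invf_div; exact: unit1V.
      by rewrite ltr_pdivlMr // mul1r.
    rewrite ltr_pdivrMr //; exact: (sq _ _ k0 l0 c0 h1 h2' (esym d)).
  case: (no (l / k)) => //; first by rewrite ltr_pdivlMr // mul1r.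
  rewrite ltr_pdivrMr //; apply: (sq _ _ l0 k0 c0' h1' h2); rewrite mulrC d mulrC //.
- move=> I /(class_idealsE hD hQ ha hp) [l [hl Nl ->]].
  wlog c0 : l hl Nl / 0 < conj l.
    move=> hw; have [c0|c0] := ltP 0 (conj l); first exact: hw.
    have -> : ideal l = ideal (- l).
      by rewrite /ideal_of !mulNr; apply/esym; apply: (@lat2_base _ _ _ _ _ (-1) 0 0 (-1)) => //; ring.
    have cN : conj (- l) = - conj l by rewrite qconjN //; exact: Kc.
    apply: hw.
    - by have := lat2B (lat20 _ _) hl; rewrite sub0r.
    - by rewrite cN mulrNN.
    - by rewrite cN oppr_gt0 lt_neqAle c0 andbT; apply: contraTneq Nl => ->; rewrite mulr0 ltxx.
  have l0 : 0 < l by move: Nl; rewrite pmulr_lgt0.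
  have e2 : 1 < eps ^+ 2 by rewrite expr2; nra.
  (* A high power of [eps] brings [l / conj l] above 1; the power to be divided out afterwards is
     then a natural number. *)
  wlog ge : l hl Nl c0 l0 / conj l <= l.
    move=> hw; have [N hN] := exprn_gt_some (conj l / l) e2.
    have hu := unit1X N he; have u0 := unit1_neq0 hu.
    have uN0 : 0 < eps ^+ N by rewrite exprn_gt0.
    rewrite -(@ideal_of_unit R D Q hD hQ (eps ^+ N) l); [|by case: hu|by case: hu|by []].
    have cu := conj_unit hu hl; rewrite ltr_pdivrMr // in hN.
    apply: hw => //; first exact: coideal_unit.
    - by rewrite cu mulrACA divff // mul1r.
    - by rewrite cu mulr_gt0 // invr_gt0.
    - by rewrite mulr_gt0.
    - rewrite cu mulrC ler_pdivrMr //; apply: ltW; apply: (lt_le_trans hN).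
      by rewrite -exprM mulnC exprM; nra.
  have ge1 : 1 <= l / conj l by rewrite ler_pdivlMr // mul1r.
  have [k /andP[hk1 hk2]] := exprn_between e2 ge1.
  rewrite ler_pdivlMr // in hk1; rewrite ltr_pdivrMr // in hk2.
  have hu := unit1V (unit1X k he); have u0 := unit1_neq0 hu.
  have ek : 0 < eps ^+ k by rewrite exprn_gt0.
  have eE : eps ^+ 2 ^+ k = eps ^+ k * eps ^+ k by rewrite -exprM mulnC exprM expr2.
  exists ((eps ^+ k)^-1 * l); last first.
    by apply: ideal_of_unit => //; case: hu.
  split; first exact: coideal_unit.
    by rewrite conj_unit // invrK mulr_gt0.
  rewrite conj_unit // invrK; apply/andP; split.
    by rewrite [X in _ <= X]mulrC ler_pdivlMr //; move: hk1; rewrite eE; lra.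
  by rewrite [X in X < _]mulrC ltr_pdivrMr //; move: hk2; rewrite (exprS (eps ^+ 2) k) eE; lra.
Qed.

Lemma zeta_class_cone eps s : smallest_unit D eps ->
  zeta_class D [set Q' | qequiv Q Q'] s =
  \esum_(l in cone eps) ((a * (l * conj l)) `^ (- s))%:E.
Proof.
move=> he; rewrite /zeta_class (reindex_esum _ _ _ _ (class_ideals_bij he)).
apply: eq_esum => l [hl c0 /andP[h1 h2]].
by rewrite (ideal_of_norm hD hQ ha hp hl) // mulr_gt0 //; lra.
Qed.

(** [cone (eps ^+ k.+1)] is the disjoint union of [cone eps] and [eps] times [cone (eps ^+ k)], and
    the summand is invariant under [eps]. *)
Lemma esum_cone_power eps (g : R -> \bar R) k : unit1 eps -> 1 < eps ->
  (forall l, (0 <= g l)%E) -> (forall l, coideal 1 l -> g (eps * l) = g l) ->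
  \esum_(l in cone (eps ^+ k)) g l = (k%:R%:E * \esum_(l in cone eps) g l)%E.
Proof.
move=> he e1 g0 gi; have e0 : 0 < eps by lra.
have e2 : 1 < eps ^+ 2 by rewrite expr2; nra.
elim: k => [|k IH].
  rewrite mul0e (_ : cone _ = set0) ?esum_set0 //; apply/seteqP; split=> // l.
  by move=> [_ c0 /andP[h1]]; rewrite expr0 expr1n mul1r; lra.
rewrite (esumID (cone eps)) // -natr1 EFinD ge0_muleDl ?lee_fin // mul1e addeC.
congr (_ + _)%E; last first.
  congr esum; apply/seteqP; split=> l; first by case.
  move=> h; split=> //; case: h => hl c0 /andP[h1 h2]; split=> //; rewrite h1 /=.
  apply: (lt_le_trans h2); rewrite ler_pM2r // -exprM.
  by apply: ler_weXn2l; [lra|lia].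
rewrite -IH (reindex_esum (cone (eps ^+ k)) _ (fun l => eps * l)).
  by apply: eq_esum => l [hl _ _]; exact: gi.
split.
- move=> l [hl c0 /andP[h1 h2]].
  have cu := conj_unit he hl; have hul := coideal_unit he hl.
  have ci : 0 < conj (eps * l) by rewrite cu mulr_gt0 ?invr_gt0.
  have ce : eps * conj (eps * l) = conj l by rewrite cu mulrA divff ?mul1r // gt_eqF.
  split.
    split=> //; apply/andP; split.
      have : eps * conj (eps * l) <= eps * (eps * l); last by rewrite ler_pM2l.
      by rewrite ce; nra.
    rewrite (exprS eps k); move: h2; set E := eps ^+ k => h2.
    have : eps ^+ 2 * l < eps ^+ 2 * (E ^+ 2 * conj l) by rewrite ltr_pM2l ?exprn_gt0.
    rewrite -[in X in _ < X]ce => h3; rewrite -(ltr_pM2l e0); lra.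
  move=> [_ _ /andP[_]]; apply/negP; rewrite -leNgt expr2 -!mulrA ce ler_pM2l //.
- move=> l k'; rewrite !inE => _ _ /mulfI; apply; lra.
- move=> l [[hl c0 /andP[h1 h2]] nc].
  have ge : eps ^+ 2 * conj l <= l.
    by rewrite leNgt; apply/negP => lt; apply: nc; split=> //; rewrite h1.
  exists (eps^-1 * l); last by rewrite mulrA divff ?mul1r //; lra.
  have hv := unit1V he; have cu := conj_unit hv hl; rewrite invrK in cu.
  split; [exact: coideal_unit|by rewrite cu mulr_gt0|].
  rewrite cu [eps^-1 * l]mulrC; apply/andP; split.
    by rewrite ler_pdivlMr //; move: ge; rewrite expr2; nra.
  by rewrite ltr_pdivrMr //; move: h2; rewrite (exprS eps k); lra.
Qed.

(** The cone in the variables of the form, dilated by [a]: here [l * l' = a * Q(p.1, p.2)]. *)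
Definition form_cone (u : R) : set (int * int) :=
  [set p | let l' := p.1%:~R * a + p.2%:~R * ((b - w) / 2) in
           let l := p.1%:~R * a + p.2%:~R * ((b + w) / 2) in
           0 < l' /\ l' <= l < u ^+ 2 * l'].

(** Any unit of norm 1 will do for the cone: passing from the smallest one to its power [u] only
    multiplies the zeta function by the exponent. *)
Lemma zeta_class_form_cone u : unit1 u -> 1 < u ->
  exists eps k, [/\ smallest_unit D eps, (0 < k)%N, u = eps ^+ k &
    forall s : R, (k%:R%:E * zeta_class D [set Q' | qequiv Q Q'] s)%E =
      \esum_(p in form_cone u) (((qeval Q p.1 p.2)%:~R : R) `^ (- s))%:E].
Proof.
move=> hu u1; have [eps [k [he k0 eu]]] := unit_power hu u1.
exists eps, k; split=> // s; rewrite (zeta_class_cone _ he).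
have /smallest_unitE [hu' e1 _] := he.
rewrite -esum_cone_power // -?eu //; last 2 first.
- by move=> l; rewrite lee_fin powR_ge0.
- move=> l hl; congr ((_ `^ _)%:E); rewrite conj_unit //; congr (_ * _).
  by rewrite mulrACA divff ?mul1r // gt_eqF //; lra.
(* The sign of the second generator is chosen so that [a] times the norm of [f p] is [Q(p.1, p.2)]
   and not [Q(p.1, - p.2)]. *)
pose f (p : int * int) : R := p.1%:~R + p.2%:~R * (- (tc / a)).
have Ktca : K (- (tc / a)).
  apply: quad_fieldN => //; apply: quad_fieldM => //; last exact: quad_fieldV.
  by apply: quad_fieldD => //; exact: quad_fieldN.
have fE p : f p = (p.1%:~R * a + p.2%:~R * ((b + w) / 2)) / a.
  by rewrite /f /form_root; field.
have cfE p : conj (f p) = (p.1%:~R * a + p.2%:~R * ((b - w) / 2)) / a.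
  have -> : f p = (p.1 * qa Q + p.2 * qb Q)%:~R / a + p.2%:~R / a * t.
    by rewrite /f rmorphD !rmorphM /=; field.
  have Kai : K a^-1 by exact: quad_fieldV.
  have Kpa (x : int) : K (x%:~R / a) by exact: quad_fieldM.
  rewrite qconjD ?(qconjM hD (Kpa _) Kt) ?(qconjM hD (Ki _) Kai) ?qconjV ?qconj_int ?qconj_form_root //; last exact: quad_fieldM.
  by rewrite rmorphD !rmorphM /= /form_root; field.
rewrite (reindex_esum (form_cone u) _ f).
  apply: eq_esum => p _; congr ((_ `^ _)%:E).
  rewrite cfE fE /qeval.
  have hw : w ^+ 2 = b ^+ 2 - 4 * a * c.
    by rewrite sqrtD_sqr // -hQ /qdisc rmorphB !rmorphM.
  rewrite !rmorphD !rmorphM /=.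
  transitivity ((p.1%:~R * a) ^+ 2 / a + p.1%:~R * p.2%:~R * b
    + p.2%:~R ^+ 2 * (b ^+ 2 - w ^+ 2) / (4 * a)); first by field.
  by rewrite hw; field.
split.
- move=> p [c0 /andP[h1 h2]]; split.
  + by exists p.1, (- p.2); rewrite /f rmorphN /=; ring.
  + by rewrite cfE divr_gt0.
  + rewrite cfE fE ler_pM2r ?invr_gt0 // h1 /= [X in _ < X]mulrA ltr_pM2r ?invr_gt0 //.
- move=> [x y] [x' y'] _ _; rewrite /f /= => h.
  have [] := @root_lat_inj R D Q hD (x * qa Q + y * qb Q) y (x' * qa Q + y' * qb Q) y'.
    rewrite !rmorphD !rmorphM /=.
    transitivity ((x%:~R + y%:~R * - (tc / a)) * a); first by field.
    by rewrite h; field.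
  by move=> h1 h2; rewrite h2 in h1 *; move/addIr/(mulIf (lt0r_neq0 ha)): h1 => ->.
- move=> l [[x [y hl]] c0 h]; have e : l = f (x, - y).
    by rewrite hl /f /= rmorphN /=; ring.
  exists (x, - y) => //; rewrite /form_cone /=.
  have := cfE (x, - y); have := fE (x, - y); rewrite -e /= => e3 e4.
  move: c0 h; rewrite e4 {1}e3 => c0 /andP[h1 h2].
  rewrite pmulr_lgt0 ?invr_gt0 // in c0; rewrite ler_pM2r ?invr_gt0 // in h1.
  split=> //; rewrite h1 /=; move: h2; rewrite e3 [X in _ < X]mulrA ltr_pM2r ?invr_gt0 //.
Qed.

End ClassZeta.

(** * Dominated, alternating and double series *)

Section Series.
Variable R : realType.
Implicit Types u v M a : R ^nat.

Lemma nneg_series_le_lim M : (forall k, 0 <= M k) -> cvgn (series M) ->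
  forall n, series M n <= limn (series M).
Proof.
move=> M0 cM; apply: nondecreasing_cvgn_le => //.
by apply: (@nondecreasing_series _ _ xpredT) => k _ _; exact: M0.
Qed.

Lemma dominated_series u M : cvgn (series M) -> (forall k, `|u k| <= M k) ->
  cvgn (series u) /\
  forall N, `|limn (series u) - series u N| <= limn (series M) - series M N.
Proof.
move=> cM hM; have M0 k : 0 <= M k by apply: le_trans (hM k).
have cu : cvgn (series u).
  apply: normed_cvg; apply: (@series_le_cvg R (fun k => `|u k|) M) => //.
split=> // N.
have bnd n : (N <= n)%N -> `|series u n - series u N| <= limn (series M) - series M N.
  move=> Nn; apply: (@le_trans _ _ (series M n - series M N)).
    rewrite !sub_series_geq //; apply: le_trans (ler_norm_sum _ _ _) _.
    by apply: ler_sum => k _; exact: hM.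
  by rewrite lerD2r; exact: nneg_series_le_lim.
have : (fun n => `|series u n - series u N|) @ \oo --> `|limn (series u) - series u N|.
  by apply: cvg_norm; apply: cvgB => //; exact: cvg_cst.
by move/cvgr_to_le; apply; exists N => // n /=; exact: bnd.
Qed.

Lemma cvg_series_fun (F : set_system R) {FF : ProperFilter F} (u : R -> R ^nat) v N :
  (forall k, u s k @[s --> F] --> v k) -> series (u s) N @[s --> F] --> series v N.
Proof.
move=> hv; elim: N => [|N IH].
  rewrite /series /= big_geq //; under eq_fun do rewrite big_geq //.
  exact: cvg_cst.
rewrite seriesSr; under eq_fun do rewrite seriesSr.
exact: cvgD.
Qed.

Lemma tannery (F : set_system R) {FF : ProperFilter F} (u : R -> R ^nat) v M :
  cvgn (series M) -> (\forall s \near F, forall k, `|u s k| <= M k) ->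
  (forall k, u s k @[s --> F] --> v k) ->
  cvgn (series v) /\ limn (series (u s)) @[s --> F] --> limn (series v).
Proof.
move=> cM hM hv.
have hvM k : `|v k| <= M k.
  by apply: (cvgr_to_le (cvg_norm (hv k))); apply: filterS hM => s; exact.
have [cv tv] := dominated_series cM hvM; split=> //.
apply/cvgrPdist_le => e e0.
have e3 : 0 < e / 3 by lra.
have [N hN] : exists N, limn (series M) - series M N <= e / 3.
  move/cvgrPdist_le : cM => /(_ _ e3) [N _ h]; exists N.
  exact: le_trans (ler_norm _) (h N (leqnn N)).
have /cvgrPdist_le /(_ _ e3) hs := @cvg_series_fun F FF u v N hv.
apply: filterS2 hM hs => s h1 h2.
have [cus tus] := dominated_series cM h1.
have := tus N; have := tv N; move: h2 hN.
by rewrite !ler_norml; lra.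
Qed.

Lemma alt_sum_bounds a n : (forall k, 0 <= a k) -> (forall k, a k.+1 <= a k) ->
  0 <= \sum_(0 <= k < n) (-1) ^+ k * a k <= a 0%N.
Proof.
elim: n a => [|n IH] a a0 ad; first by rewrite big_geq // lexx a0.
rewrite big_nat_recl // expr0 mul1r.
have /andP[h1 h2] := IH (fun k => a k.+1) (fun k => a0 _) (fun k => ad _).
have -> : \sum_(0 <= i < n) (-1) ^+ i.+1 * a i.+1 = - \sum_(0 <= i < n) (-1) ^+ i * a i.+1.
  by rewrite -sumrN; apply: eq_bigr => i _; rewrite exprS mulN1r mulNr.
by have := ad 0%N; lra.
Qed.

Lemma alt_tail_bound a N n : (forall k, 0 <= a k) -> (forall k, a k.+1 <= a k) ->
  `|\sum_(N <= k < n) (-1) ^+ k * a k| <= a N.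
Proof.
move=> a0 ad; have [nN|Nn] := leqP n N; first by rewrite big_geq // normr0.
rewrite -{1}[N]add0n big_addn.
have -> : \sum_(0 <= i < n - N) (-1) ^+ (i + N) * a (i + N)%N =
    (-1) ^+ N * \sum_(0 <= i < n - N) (-1) ^+ i * a (i + N)%N.
  by rewrite mulr_sumr; apply: eq_bigr => i _; rewrite exprD; ring.
rewrite normrM normrX normrN1 expr1n mul1r.
have /andP[h1 h2] := @alt_sum_bounds (fun k => a (k + N)%N) (n - N) (fun k => a0 _) (fun k => ad _).
by rewrite ger0_norm.
Qed.

Lemma alt_series a : (forall k, 0 <= a k) -> (forall k, a k.+1 <= a k) ->
  a @ \oo --> 0 ->
  cvgn (series (fun k => (-1) ^+ k * a k)) /\
  forall N, `|limn (series (fun k => (-1) ^+ k * a k))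
              - series (fun k => (-1) ^+ k * a k) N| <= a N.
Proof.
move=> a0 ad ac; set u := fun k => _.
have cu : cvgn (series u).
  apply/cauchy_cvgP; apply/cauchy_seriesP => e e0.
  move/cvgrPdist_lt : ac => /(_ e e0) [N _ hN].
  exists ([set n | (N <= n)%N], [set n | (N <= n)%N]).
    by split; exists N.
  move=> [p q] /= [hp _]; apply: le_lt_trans (alt_tail_bound p q a0 ad) _.
  by have := hN p hp; rewrite /= sub0r normrN ger0_norm.
split=> // N.
have : (fun n => `|series u n - series u N|) @ \oo --> `|limn (series u) - series u N|.
  by apply: cvg_norm; apply: cvgB => //; exact: cvg_cst.
move/cvgr_to_le; apply; exists N => // n /= Nn.
by rewrite sub_series_geq //; exact: alt_tail_bound.
Qed.

Lemma cvg_inv_shift (z : R) : 0 < z -> (z + k%:R)^-1 @[k --> \oo] --> 0.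
Proof.
move=> z0; apply: (@squeeze_cvgr _ _ _ _ (fun=> 0) (@harmonic R \o predn)).
- exists 1%N => // -[//|k] _ /=; rewrite invr_ge0 addr_ge0 ?ler0n ?(ltW z0) //=.
  by rewrite lef_pV2 ?posrE ?ltr0Sn ?addr_gt0 ?ltr0Sn // lerDr ltW.
- exact: cvg_cst.
- by rewrite -(@cvg_shiftS R); exact: cvg_harmonic.
Qed.

(** Nielsen's beta function, as a conditionally convergent series. *)
Definition bet (z : R) : R := limn (series (fun k => (-1) ^+ k * (z + k%:R)^-1)).

Lemma bet_series z : 0 < z ->
  series (fun k => (-1) ^+ k * (z + k%:R)^-1) @ \oo --> bet z /\
  forall N, `|bet z - series (fun k => (-1) ^+ k * (z + k%:R)^-1) N| <= (z + N%:R)^-1.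
Proof.
move=> z0; apply: (@alt_series (fun k => (z + k%:R)^-1)).
- by move=> k; rewrite invr_ge0 addr_ge0 ?ler0n ?(ltW z0).
- move=> k; rewrite lef_pV2 ?posrE ?ltr_wpDr ?ler0n //.
  by rewrite lerD2l ler_nat.
- exact: cvg_inv_shift.
Qed.

Lemma bet_shift z N : 0 < z ->
  bet z = \sum_(0 <= k < N) (-1) ^+ k / (z + k%:R) + (-1) ^+ N * bet (z + N%:R).
Proof.
move=> z0; have zN : 0 < z + N%:R by rewrite ltr_wpDr ?ler0n.
have [h1 _] := bet_series z0; have [h2 _] := bet_series zN.
suff : series (fun k => (-1) ^+ k * (z + k%:R)^-1) @ \oo -->
    \sum_(0 <= k < N) (-1) ^+ k / (z + k%:R) + (-1) ^+ N * bet (z + N%:R).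
  by move=> h3; exact: (cvg_unique _ h1 h3).
rewrite -(@cvg_shiftn N R).
have -> : [sequence series (fun k => (-1) ^+ k * (z + k%:R)^-1) (n + N)%N]_n =
   (fun n => \sum_(0 <= k < N) (-1) ^+ k / (z + k%:R) +
     (-1) ^+ N * series (fun k => (-1) ^+ k * (z + N%:R + k%:R)^-1) n).
  apply/funext => n /=; rewrite series_addn; congr (_ + _).
  rewrite -{1}[N]add0n big_addn addnK mulr_sumr; apply: eq_bigr => i _.
  by rewrite exprD natrD; congr (_); rewrite [z + _ + _]addrAC -addrA; ring.
by apply: cvgD; [exact: cvg_cst|apply: cvgM => //; exact: cvg_cst].
Qed.

Lemma esum_series a : (forall k, 0 <= a k) -> cvgn (series a) ->
  \esum_(k in [set: nat]) (a k)%:E = (limn (series a))%:E.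
Proof.
move=> a0 ca; rewrite -nneseries_esumT; last by move=> k; rewrite lee_fin.
rewrite -EFin_lim //; congr (limn _); apply/funext => n /=.
by rewrite /series /= sumEFin.
Qed.

Lemma esum_pairs (H : nat -> nat -> R) : (forall q m, 0 <= H q m) ->
  (\esum_(p in [set: nat * nat]) (H p.1 p.2)%:E < +oo)%E ->
  [/\ forall q, cvgn (series (H q)),
      cvgn (series (fun q => limn (series (H q)))) &
      \esum_(p in [set: nat * nat]) (H p.1 p.2)%:E =
      (limn (series (fun q => limn (series (H q)))))%:E].
Proof.
move=> H0 fin.
have e : \esum_(p in [set: nat * nat]) (H p.1 p.2)%:E =
    \esum_(q in [set: nat]) \esum_(m in [set: nat]) (H q m)%:E.
  rewrite (@esum_esum R nat nat setT (fun=> setT) (fun q m => (H q m)%:E)); last by move=> *; rewrite lee_fin.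
  by congr esum; apply/seteqP; split=> // -[].
have row0 q : (0 <= \esum_(m in [set: nat]) (H q m)%:E)%E.
  by apply: esum_ge0 => m _; rewrite lee_fin.
have crow q : cvgn (series (H q)).
  apply: nnseries_is_cvg => //; rewrite nneseries_esumT; last by move=> k; rewrite lee_fin.
  apply: le_lt_trans fin; rewrite e; apply: esum_ge.
  exists [set q]; first by split.
  by rewrite fsbig_set1.
have er q : \esum_(m in [set: nat]) (H q m)%:E = (limn (series (H q)))%:E.
  exact: esum_series.
have lim0 q : 0 <= limn (series (H q)) by have := row0 q; rewrite er lee_fin.
have e2 : \esum_(p in [set: nat * nat]) (H p.1 p.2)%:E =
    \esum_(q in [set: nat]) (limn (series (H q)))%:E.
  by rewrite e; apply: eq_esum => q _.
have clim : cvgn (series (fun q => limn (series (H q)))).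
  by apply: nnseries_is_cvg => //; rewrite nneseries_esumT -?e2.
by split=> //; rewrite e2 esum_series.
Qed.

Lemma esum_rows (H : nat -> nat -> R) (r : R ^nat) : (forall q m, 0 <= H q m) ->
  (forall q, series (H q) @ \oo --> r q) -> cvgn (series r) ->
  \esum_(p in [set: nat * nat]) (H p.1 p.2)%:E = (limn (series r))%:E.
Proof.
move=> H0 hr cr.
have lr q : limn (series (H q)) = r q by apply/cvg_lim => //; exact: hr.
have er q : \esum_(m in [set: nat]) (H q m)%:E = (r q)%:E.
  by rewrite esum_series ?lr //; apply/cvg_ex; eexists; exact: hr.
have r0 q : 0 <= r q.
  by rewrite -lee_fin -er; apply: esum_ge0 => m _; rewrite lee_fin.
rewrite -esum_series //.
transitivity (\esum_(q in [set: nat]) \esum_(m in [set: nat]) (H q m)%:E).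
  rewrite (@esum_esum R nat nat setT (fun=> setT) (fun q m => (H q m)%:E)); last by move=> *; rewrite lee_fin.
  by congr esum; apply/seteqP; split=> // -[].
by apply: eq_esum => q _; exact: er.
Qed.

(** Twice the indicator of [odd q != odd m], minus 1, is [- (-1) ^ (q + m)]. The absolutely
    convergent double sum thus becomes an iterated alternating one, and the iterated form still
    makes sense at [s = 1]. *)
Lemma esum_alternating (G : nat -> nat -> R) (Z0 : R) : (forall q m, 0 <= G q m) ->
  \esum_(p in [set: nat * nat]) (G p.1 p.2)%:E = Z0%:E ->
  exists2 Z1 : R,
    \esum_(p in [set p : nat * nat | odd p.1 != odd p.2]) (G p.1 p.2)%:E = Z1%:E &
    2 * Z1 - Z0 = - limn (series (fun q => (-1) ^+ q *
                    limn (series (fun m => (-1) ^+ m * G q m)))).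
Proof.
move=> G0 eZ0.
have [|rG cG eG] := esum_pairs G0; first by rewrite eZ0 ltry.
pose H q m := if odd q != odd m then G q m else 0.
have H0 q m : 0 <= H q m by rewrite /H; case: ifP.
have HG q m : H q m <= G q m by rewrite /H; case: ifP.
have eH : \esum_(p in [set p : nat * nat | odd p.1 != odd p.2]) (G p.1 p.2)%:E =
    \esum_(p in [set: nat * nat]) (H p.1 p.2)%:E.
  rewrite esum_mkcond; apply: eq_esum => p _; rewrite /H.
  by case: ifPn => h; case: ifP => // h'; [rewrite inE /= h' in h|move: h; rewrite notin_setE /= h'].
have [|rH cH eH2] := esum_pairs H0.
  apply: (@le_lt_trans _ _ Z0%:E); last by rewrite ltry.
  by rewrite -eZ0; apply: le_esum => p _; rewrite lee_fin.
exists (limn (series (fun q => limn (series (H q))))); first by rewrite eH.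
have -> : Z0 = limn (series (fun q => limn (series (G q)))).
  by apply/EFin_inj; rewrite -eZ0.
rewrite -[LHS]opprK; congr (- _).
apply/esym/cvg_lim => //.
have -> : series (fun q => (-1) ^+ q * limn (series (fun m => (-1) ^+ m * G q m))) =
    (fun n => - (2 * series (fun q => limn (series (H q))) n - series (fun q => limn (series (G q))) n)).
  apply/funext => n; rewrite /series /= mulr_sumr -sumrB -sumrN; apply: eq_bigr => q _.
  have -> : limn (series (fun m => (-1) ^+ m * G q m)) =
     (-1) ^+ q * - (2 * limn (series (H q)) - limn (series (G q))).
    apply/cvg_lim => //.
    have -> : series (fun m => (-1) ^+ m * G q m) =
        (fun n => (-1) ^+ q * - (2 * series (H q) n - series (G q) n)).
      apply/funext => k; rewrite /series /= [in RHS]mulr_sumr -sumrB -sumrN mulr_sumr.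
      apply: eq_bigr => m _; rewrite /H -(signr_odd _ q) -(signr_odd _ m).
      by case: (odd q); case: (odd m) => /=; rewrite ?expr0 ?expr1; ring.
    apply: cvgM; first exact: cvg_cst.
    by apply: cvgN; apply: cvgB; [apply: cvgM; [exact: cvg_cst|exact: rH]|exact: rG].
  by rewrite mulrA -expr2 sqrr_sign mul1r.
by apply: cvgN; apply: cvgB; [apply: cvgM; [exact: cvg_cst|exact: cH]|exact: cG].
Qed.

End Series.

(** * Powers near [s = 1] and the pole of the zeta function *)

Section PowerAsymptotics.
Variable R : realType.
Implicit Types (a s x y z : R) (F : set_system R).

Lemma powR_expR y x : 0 < y -> y `^ x = expR (x * ln y).
Proof. by move=> y0; rewrite /powR gt_eqF. Qed.

Lemma powR_cvg {F} {FF : Filter F} (g : R -> R) y x : 0 < y ->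
  g s @[s --> F] --> x -> y `^ (g s) @[s --> F] --> y `^ x.
Proof.
move=> y0 hg; rewrite powR_expR //; under eq_fun do rewrite powR_expR //.
apply: continuous_cvg; first exact: continuous_expR.
by apply: cvgM => //; exact: cvg_cst.
Qed.

Lemma cvg_at1 : (s : R) @[s --> (1 : R)^'+] --> (1 : R).
Proof. by apply: cvg_at_right_filter; exact: cvg_id. Qed.

Lemma expR_quadratic z : `|z| <= 2^-1 -> `|expR z - 1 - z| <= 2 * z ^+ 2.
Proof.
rewrite ler_norml => /andP[z1 z2].
have lo := expR_ge1Dx z.
have hi : expR z <= (1 - z)^-1.
  rewrite -[z in expR z]opprK expRN lef_pV2 ?posrE ?expR_gt0 //; last lra.
  by have := expR_ge1Dx (- z).
have e : (1 - z)^-1 = 1 + z + z ^+ 2 * (1 - z)^-1 by field; lra.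
have i2 : (1 - z)^-1 <= 2 by rewrite -[leRHS]invrK lef_pV2 ?posrE; lra.
have := sqr_ge0 z => z0.
have : z ^+ 2 * (1 - z)^-1 <= z ^+ 2 * 2 by rewrite ler_wpM2l.
by rewrite ler_norml; lra.
Qed.

Lemma expR_quotient_cvg a :
  (expR (a * (s - 1)) - 1) / (s - 1) @[s --> (1 : R)^'+] --> a.
Proof.
apply/cvgrPdist_le => e e0.
have B0 : 0 < 2 * (a ^+ 2 + 1) by have := sqr_ge0 a; lra.
have A0 : 0 < 2 * (`|a| + 1) by have := normr_ge0 a; lra.
near=> s.
have s1 : 0 < s - 1 by rewrite subr_gt0; near: s; exact: nbhs_right_gt.
have h1 : s - 1 < (2 * (`|a| + 1))^-1.
  rewrite ltrBlDl; near: s; apply: nbhs_right_lt; rewrite ltrDl invr_gt0 //.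
have h2 : s - 1 < e / (2 * (a ^+ 2 + 1)).
  rewrite ltrBlDl; near: s; apply: nbhs_right_lt; rewrite ltrDl divr_gt0 //.
have hz : `|a * (s - 1)| <= 2^-1.
  rewrite normrM (gtr0_norm s1).
  have : (s - 1) * (2 * (`|a| + 1)) < 1 by rewrite -ltr_pdivlMr // div1r.
  by have := normr_ge0 a; lra.
have := expR_quadratic hz; set E := expR _ => hE.
have -> : a - (E - 1) / (s - 1) = - (E - 1 - a * (s - 1)) / (s - 1) by field; lra.
rewrite normrM normrN normfV (gtr0_norm s1) ler_pdivrMr //.
apply: le_trans hE _.
have : (s - 1) * (2 * (a ^+ 2 + 1)) < e by rewrite -ltr_pdivlMr.
rewrite exprMn => h3.
have : (s - 1) * (s - 1) * (2 * (a ^+ 2 + 1)) <= (s - 1) * e by rewrite -mulrA ler_pM2l // ltW.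
by have := mulr_gt0 s1 s1; lra.
Unshelve. all: by end_near. Qed.

Lemma powR_quotient_cvg a y : 0 < y ->
  (y `^ (a * (s - 1)) - 1) / (s - 1) @[s --> (1 : R)^'+] --> a * ln y.
Proof.
move=> y0; under eq_fun do rewrite powR_expR // mulrAC.
exact: expR_quotient_cvg.
Qed.

Lemma series_mull_cvg (c : R) (u : R ^nat) :
  cvgn (series u) -> cvgn (series (fun k => c * u k)).
Proof. by move=> cu; exact: (@is_cvg_seriesZ R u c cu). Qed.

Lemma inv_sqr_series_cvg : cvgn (series (fun k => (k.+1%:R ^+ 2)^-1 : R)).
Proof.
apply: (@series_le_cvg _ _ (fun k => 2 * ((k.+1%:R)^-1 - (k.+2%:R)^-1) : R)).
- by move=> k; rewrite invr_ge0 sqr_ge0.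
- move=> k; rewrite mulr_ge0 // subr_ge0 lef_pV2 ?posrE ?ltr0Sn // ler_nat //.
- move=> k; set y : R := k.+1%:R; have -> : k.+2%:R = y + 1 :> R by rewrite /y -natr1.
  have y1 : 1 <= y by rewrite /y ler1n.
  have -> : 2 * (y^-1 - (y + 1)^-1) = 2 * (y * (y + 1))^-1 by field; lra.
  have -> : 2 * (y * (y + 1))^-1 = (y * (y + 1) / 2)^-1 by field; lra.
  by rewrite lef_pV2 ?posrE; nra.
have -> : series (fun k => 2 * ((k.+1%:R)^-1 - (k.+2%:R)^-1) : R) = (fun n => 2 * (1 - (n.+1%:R)^-1)).
  apply/funext => n; rewrite /series /= -mulr_sumr; congr (_ * _).
  rewrite (telescope_sumr_eq (fun k => - (k.+1%:R)^-1 : R) _) //; last by move=> k _; ring.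
  by rewrite invr1; ring.
apply/cvg_ex; exists (2 * (1 - 0)); apply: cvgM; first exact: cvg_cst.
by apply: cvgB; [exact: cvg_cst|exact: cvg_harmonic].
Qed.

Lemma natpow_cvg0 a : 0 < a -> k.+1%:R `^ (- a) @[k --> \oo] --> (0 : R).
Proof.
move=> a0.
have -> : (fun k => k.+1%:R `^ (- a)) = (fun x : R => x `^ a) \o (@harmonic R).
  by apply/funext => k /=; rewrite powRN !powR_expR ?invr_gt0 ?ltr0Sn // lnV ?posrE ?ltr0Sn // mulrN expRN.
apply: (cvg_comp _ _ _ (powR_cvg0 a0)).
move=> A /=; rewrite /at_right /within /= => hA.
have := (@cvg_harmonic R) _ hA; rewrite /nbhs /=.
by apply: filterS => n; apply; exact: harmonic_gt0.
Qed.

Lemma powRN1D y (d : R) : 0 < y -> y `^ (- (1 + d)) = y `^ (- d) / y.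
Proof.
move=> y0; rewrite -[in RHS](powR_inv1 (ltW y0)) -powRD; first by congr (_ `^ _); ring.
by rewrite (lt0r_neq0 y0) implybT.
Qed.

(** The middle term is the integral of [y ^ (- (1 + d))] over [[k + 1, k + 2]], compared with the
    values at the two ends. The proof avoids integration by using [1 / (y + 1) <= ln (y + 1) - ln y
    <= 1 / y]. *)
Lemma natpow_diff_bounds (d : R) (k : nat) : 0 < d ->
  k.+2%:R `^ (- (1 + d)) <= (k.+1%:R `^ (- d) - k.+2%:R `^ (- d)) / d
    <= (k.+1%:R : R) `^ (- (1 + d)).
Proof.
move=> d0; set y : R := k.+1%:R; have -> : k.+2%:R = y + 1 :> R by rewrite /y -natr1.
have y0 : 0 < y by rewrite /y ltr0Sn.
clearbody y; have y10 : 0 < y + 1 by lra.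
have L1 : ln (y + 1) - ln y <= y^-1.
  rewrite -ln_div ?posrE // (_ : (y + 1) / y = 1 + y^-1); last by field; lra.
  by apply: le_ln1Dx; apply: (@lt_trans _ _ 0); rewrite ?invr_gt0 // ltrN10.
have L2 : (y + 1)^-1 <= ln (y + 1) - ln y.
  have : ln (1 + (- (y + 1)^-1)) <= - (y + 1)^-1.
    apply: le_ln1Dx; rewrite ltrN2 invf_lt1 //; lra.
  rewrite (_ : 1 + _ = y / (y + 1)); last by field; lra.
  by rewrite ln_div ?posrE //; lra.
set L := ln (y + 1) - ln y in L1 L2.
have P1 : y `^ (- (1 + d)) = y `^ (- d) / y by exact: powRN1D.
have P2 : (y + 1) `^ (- (1 + d)) = (y + 1) `^ (- d) / (y + 1) by exact: powRN1D.
have E1 : (y + 1) `^ (- d) = y `^ (- d) * expR (- (d * L)).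
  by rewrite !powR_expR // -expRD; congr expR; rewrite /L; ring.
have E2 : y `^ (- d) = (y + 1) `^ (- d) * expR (d * L).
  by rewrite !powR_expR // -expRD; congr expR; rewrite /L; ring.
have p1 := powR_gt0 (- d) y0; have p2 := powR_gt0 (- d) y10.
rewrite P1 P2; apply/andP; split.
  rewrite ler_pdivlMr // E2 -mulrA.
  have : (y + 1) `^ (- d) * ((y + 1)^-1 * d) <= (y + 1) `^ (- d) * (expR (d * L) - 1).
    rewrite ler_pM2l //.
    have : (y + 1)^-1 * d <= L * d by rewrite ler_pM2r.
    by have := expR_ge1Dx (d * L); lra.
  by lra.
rewrite ler_pdivrMr // E1 -mulrA.
have : y `^ (- d) * (1 - expR (- (d * L))) <= y `^ (- d) * (y^-1 * d).
  rewrite ler_pM2l //.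
  have : L * d <= y^-1 * d by rewrite ler_pM2r.
  by have := expR_ge1Dx (- (d * L)); lra.
by lra.
Qed.

(** The Riemann zeta function at [2 s - 1]. *)
Definition zetaodd s : R := limn (series (fun k => k.+1%:R `^ (1 - 2 * s))).

Lemma natpow_term_bound (d : R) (k : nat) : 0 < d <= 2 ->
  `|k.+1%:R `^ (- (1 + d)) - (k.+1%:R `^ (- d) - k.+2%:R `^ (- d)) / d|
    <= 3 * ((k.+1%:R : R) ^+ 2)^-1.
Proof.
move=> /andP[d0 d2]; have /andP[lo hi] := natpow_diff_bounds k d0.
rewrite ger0_norm ?subr_ge0 //.
(* The same bounds with exponent [1 + d] control the drop between consecutive terms; its factor
   [1 + d] is at most 3. *)
have [lo' hi'] := andP (@natpow_diff_bounds (1 + d) k ltac:(lra)).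
set y : R := k.+1%:R in lo hi lo' hi' *.
have y1 : 1 <= y by rewrite /y ler1n.
have h : y `^ (- (1 + d)) - k.+2%:R `^ (- (1 + d)) <= (1 + d) * y `^ (- (1 + (1 + d))).
  by rewrite mulrC -ler_pdivrMr //; lra.
have h2 : y `^ (- (1 + (1 + d))) <= (y ^+ 2)^-1.
  rewrite -powR_invn; last by lra.
  by apply: ler_powR => //; rewrite mulr2n; lra.
have h3 : (1 + d) * y `^ (- (1 + (1 + d))) <= 3 * (y ^+ 2)^-1.
  by apply: ler_pM => //; [lra|exact: powR_ge0|lra].
by apply: le_trans h3; apply: le_trans h; rewrite lerD2l lerN2.
Qed.

(** From each term the integral over the following unit interval is subtracted. The remainders are
    dominated by [3 / (k + 1) ^ 2] up to [s = 1], and the integrals telescope to the polar part. *)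
Lemma zetaodd_pole :
  (forall s, 1 < s -> cvgn (series (fun k => k.+1%:R `^ (1 - 2 * s) : R))) /\
  exists g : R, zetaodd s - (2 * (s - 1))^-1 @[s --> (1 : R)^'+] --> g.
Proof.
pose t s k : R := k.+1%:R `^ (- (1 + 2 * (s - 1)))
  - (k.+1%:R `^ (- (2 * (s - 1))) - k.+2%:R `^ (- (2 * (s - 1)))) / (2 * (s - 1)).
have cM : cvgn (series (fun k => 3 * ((k.+1%:R : R) ^+ 2)^-1)).
  by apply: series_mull_cvg; exact: inv_sqr_series_cvg.
have bnd s : 1 < s -> s <= 2 -> forall k, `|t s k| <= 3 * ((k.+1%:R : R) ^+ 2)^-1.
  by move=> s1 s2 k; apply: natpow_term_bound; apply/andP; split; lra.
have key s : 1 < s -> s <= 2 -> series (fun k => k.+1%:R `^ (1 - 2 * s) : R) @ \oo -->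
    limn (series (t s)) + (2 * (s - 1))^-1.
  move=> s1 s2; have [ct _] := dominated_series cM (bnd s s1 s2).
  have -> : series (fun k => k.+1%:R `^ (1 - 2 * s) : R) =
     (fun n => series (t s) n + (1 - n.+1%:R `^ (- (2 * (s - 1)))) / (2 * (s - 1))).
    apply/funext => n; rewrite /series /= /t.
    rewrite [in RHS]sumrB -[in RHS]mulr_suml.
    rewrite [X in _ - X / _](telescope_sumr_eq (fun k => - (k.+1%:R `^ (- (2 * (s - 1)))) : R) _) //; last first.
      by move=> k _; ring.
    rewrite powR1 opprK.
    have -> : \sum_(0 <= i < n) (i.+1%:R : R) `^ (- (1 + 2 * (s - 1))) = \sum_(0 <= i < n) i.+1%:R `^ (1 - 2 * s).
      by apply: eq_bigr => i _; congr (_ `^ _); lra.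
    by ring.
  have -> : limn (series (t s)) + (2 * (s - 1))^-1 =
      limn (series (t s)) + (1 - 0) / (2 * (s - 1)) by rewrite subr0 mul1r.
  apply: cvgD => //; apply: cvgM; last exact: cvg_cst.
  by apply: cvgB; [exact: cvg_cst|apply: natpow_cvg0; lra].
split.
  move=> s s1; have [s2|s2] := leP s 2; first by apply/cvg_ex; eexists; exact: key.
  apply: (@series_le_cvg _ _ (fun k => k.+1%:R `^ (1 - 2 * 2))).
  - by move=> k; exact: powR_ge0.
  - by move=> k; exact: powR_ge0.
  - by move=> k; apply: ler_powR; [rewrite ler1n|lra].
  - by apply/cvg_ex; eexists; apply: key; lra.
have hb : \forall s \near (1 : R)^'+, forall k, `|t s k| <= 3 * ((k.+1%:R : R) ^+ 2)^-1.
  near=> s; apply: bnd; first by near: s; exact: nbhs_right_gt.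
  by near: s; apply: nbhs_right_ltW; lra.
have hl k : t s k @[s --> (1 : R)^'+] --> (k.+1%:R)^-1 - (ln k.+2%:R - ln k.+1%:R).
  apply: cvgB.
    rewrite -powR_inv1 ?ler0n //; apply: powR_cvg; first by rewrite ltr0Sn.
    have e1 : - (1 + 2 * (1 - 1)) = -1 :> R by ring.
    have : - (1 + 2 * (s - 1)) @[s --> (1 : R)^'+] --> - (1 + 2 * (1 - 1) : R).
      apply: cvgN; apply: cvgD; first exact: cvg_cst.
      apply: cvgM; first exact: cvg_cst.
      by apply: cvgB; [exact: cvg_at1|exact: cvg_cst].
    by rewrite e1.
  have h1 := @powR_quotient_cvg (-2) k.+1%:R (ltr0Sn _ _).
  have h2 := @powR_quotient_cvg (-2) k.+2%:R (ltr0Sn _ _).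
  have -> : ln k.+2%:R - ln k.+1%:R = 2^-1 * (-2 * ln k.+1%:R - -2 * ln k.+2%:R) :> R by field.
  have h4 : 2^-1 * ((k.+1%:R `^ (-2 * (s - 1)) - 1) / (s - 1) -
      (k.+2%:R `^ (-2 * (s - 1)) - 1) / (s - 1)) @[s --> (1 : R)^'+] -->
      2^-1 * (-2 * ln k.+1%:R - -2 * ln k.+2%:R : R).
    by apply: cvgM; [exact: cvg_cst|exact: cvgB].
  apply: cvg_trans h4; apply: near_eq_cvg; near=> s.
  have s1 : s - 1 != 0 by rewrite subr_eq0 gt_eqF //; near: s; exact: nbhs_right_gt.
  by rewrite /= !mulNr; field.
have [_ ht] := tannery cM hb hl.
eexists; apply: cvg_trans ht; apply: near_eq_cvg; near=> s.
rewrite /zetaodd (cvg_lim _ (key s _ _)) //; first by rewrite addrK.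
by near: s; apply: nbhs_right_ltW; lra.
Unshelve. all: by end_near. Qed.

End PowerAsymptotics.

(** * Integrals as limits of Riemann sums with bounded error *)

Section RiemannSums.
Variable R : realType.
Implicit Types (g : R -> R) (L : R).

(** Riemann sum on [[0, h]] with step [1 / q], deliberately not divided by [q]: this is how the rows
    of the lattice sums present themselves, and it equals [q] times the integral up to a bounded
    error. *)
Definition rsum g (h q : nat) : R := \sum_(0 <= m < h * q) g (m%:R / q%:R).

Lemma rsum_refine g h L q p : (0 < q)%N -> (0 < p)%N -> 0 <= L ->
  (forall t t', 0 <= t <= h%:R -> 0 <= t' <= h%:R -> `|g t - g t'| <= L * `|t - t'|) ->
  `|rsum g h (q * p) - p%:R * rsum g h q| <= p%:R * (h%:R * L).
Proof.
move=> q0 p0 L0 hg; rewrite /rsum (mulnA h q p) big_nat_mul mulr_sumr -sumrB.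
have qR : 0 < q%:R :> R by rewrite ltr0n.
have pR : 0 < p%:R :> R by rewrite ltr0n.
apply: le_trans (ler_norm_sum _ _ _) _.
have -> : p%:R * (h%:R * L) = \sum_(0 <= i < h * q) p%:R * (L / q%:R).
  rewrite sumr_const_nat subn0 -[RHS]mulr_natl natrM; field.
  by rewrite gt_eqF.
rewrite big_seq [leRHS]big_seq; apply: ler_sum => i; rewrite mem_index_iota => /andP[_ hi].
have -> : p%:R * g (i%:R / q%:R) = \sum_(i * p <= j < i.+1 * p) g (i%:R / q%:R).
  by rewrite sumr_const_nat mulSn addnK mulr_natl.
rewrite -sumrB; apply: le_trans (ler_norm_sum _ _ _) _.
have -> : p%:R * (L / q%:R) = \sum_(i * p <= j < i.+1 * p) (L / q%:R).
  by rewrite sumr_const_nat mulSn addnK mulr_natl.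
rewrite big_seq [leRHS]big_seq; apply: ler_sum => j; rewrite mem_index_iota => /andP[j1 j2].
have hiR : i.+1%:R <= h%:R * q%:R :> R by rewrite -natrM ler_nat.
have j1R : i%:R * p%:R <= j%:R :> R by rewrite -natrM ler_nat.
have j2R : j%:R <= i.+1%:R * p%:R :> R by rewrite -natrM ler_nat ltnW.
rewrite -natr1 in hiR j2R.
have i0 : 0 <= i%:R :> R by rewrite ler0n.
have qpR : 0 < q%:R * p%:R :> R by rewrite mulr_gt0.
have e : j%:R / (q * p)%:R - i%:R / q%:R = (j%:R - i%:R * p%:R) / (q%:R * p%:R) :> R.
  by rewrite natrM; field; rewrite !gt_eqF.
have h1 : 0 <= j%:R / (q * p)%:R - i%:R / q%:R :> R.
  by rewrite e divr_ge0 ?(ltW qpR) // subr_ge0.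
have h2 : j%:R / (q * p)%:R - i%:R / q%:R <= q%:R^-1 :> R.
  rewrite e ler_pdivrMr // mulrA mulVf ?gt_eqF // mul1r; lra.
have i1 : i%:R / q%:R + q%:R^-1 <= h%:R :> R.
  by rewrite -[X in _ + X]mul1r -mulrDl ler_pdivrMr.
have i2 : 0 <= i%:R / q%:R :> R by rewrite divr_ge0 ?(ltW qR).
have q1 : 0 < q%:R^-1 :> R by rewrite invr_gt0.
apply: le_trans (hg _ _ _ _) _.
- by apply/andP; split; lra.
- by apply/andP; split; lra.
- by rewrite ler_wpM2l // ger0_norm.
Qed.

(** Comparing two grids with their common refinement shows that the intervals of radius [C / q]
    about the normalised sums meet pairwise; the supremum of their left ends lies in all of them. It
    serves as the integral of [g], with an error bound uniform in [q]. *)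
Lemma rsum_limit g h L : 0 <= L ->
  (forall t t', 0 <= t <= h%:R -> 0 <= t' <= h%:R -> `|g t - g t'| <= L * `|t - t'|) ->
  exists I, forall q, (0 < q)%N -> `|rsum g h q - q%:R * I| <= h%:R * L.
Proof.
move=> L0 hg; set C := h%:R * L.
pose a (k : nat) : R := rsum g h k.+1 / k.+1%:R.
have key k l : a k - C / k.+1%:R <= a l + C / l.+1%:R.
  have := rsum_refine (ltn0Sn k) (ltn0Sn l) L0 hg.
  have := rsum_refine (ltn0Sn l) (ltn0Sn k) L0 hg.
  rewrite (mulnC l.+1) -/C /a; set A := rsum g h (_ * _).
  set x := rsum g h k.+1; set y := rsum g h l.+1.
  have : 0 < k.+1%:R :> R by []. have : 0 < l.+1%:R :> R by [].
  move: (k.+1%:R) (l.+1%:R) => K N N0 K0.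
  rewrite !ler_norml => /andP[h1 h2] /andP[h3 h4].
  rewrite -!mulrDl -mulrBl ler_pdivrMr // mulrAC ler_pdivlMr //; lra.
pose E := [set a k - C / k.+1%:R | k in [set: nat]].
have sE : has_sup E.
  split; first by exists (a 0%N - C / 1), 0%N.
  by exists (a 0%N + C / 1) => _ [k _ <-]; exact: key.
exists (sup E) => q q0; have -> : q = q.-1.+1 by rewrite prednK.
move: (q.-1) => k; have k0 : 0 < k.+1%:R :> R by [].
have h1 : a k - C / k.+1%:R <= sup E by apply: ub_le_sup; [case: sE|exists k].
have h2 : sup E <= a k + C / k.+1%:R.
  by apply: ge_sup; [case: sE|move=> _ [l _ <-]; exact: key].
move: h1 h2; rewrite /a -mulrBl -mulrDl ler_pdivrMr // ler_pdivlMr // ler_norml; lra.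
Qed.

Lemma le_of_linear_bound (x y C : R) :
  (forall q, (0 < q)%N -> q%:R * x <= C + q%:R * y) -> x <= y.
Proof.
move=> H; rewrite leNgt; apply/negP => lt; have xy : 0 < x - y by rewrite subr_gt0.
have := archi_boundP (normr_ge0 (C / (x - y))); set k := Num.bound _ => hk.
have := H k.+1 isT; have := le_lt_trans (ler_norm _) hk; rewrite ltr_pdivrMr // -natr1; lra.
Qed.

Lemma rsum_limit_unique g h I J C C' :
  (forall q, (0 < q)%N -> `|rsum g h q - q%:R * I| <= C) ->
  (forall q, (0 < q)%N -> `|rsum g h q - q%:R * J| <= C') -> I = J.
Proof.
move=> H1 H2; apply/eqP; rewrite eq_le; apply/andP; split;
  apply: (@le_of_linear_bound _ _ (C + C')) => q q0;
  by have := H1 q q0; have := H2 q q0; rewrite !ler_norml; lra.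
Qed.

(** A pointwise estimate is integrated: summed over the grid it holds up to bounded errors, which
    vanish after division by [q]. *)
Lemma rsum_limit_approx g g1 g2 h (d e I I1 I2 C C1 C2 : R) :
  (forall t, 0 <= t <= h%:R -> `|g t - g1 t + d * g2 t| <= e) ->
  (forall q, (0 < q)%N -> `|rsum g h q - q%:R * I| <= C) ->
  (forall q, (0 < q)%N -> `|rsum g1 h q - q%:R * I1| <= C1) ->
  (forall q, (0 < q)%N -> `|rsum g2 h q - q%:R * I2| <= C2) ->
  `|I - I1 + d * I2| <= h%:R * e.
Proof.
move=> hg H H1 H2.
have key q : (0 < q)%N -> `|rsum g h q - rsum g1 h q + d * rsum g2 h q| <= q%:R * (h%:R * e).
  move=> q0; rewrite /rsum mulr_sumr -sumrB -big_split /=.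
  apply: le_trans (ler_norm_sum _ _ _) _.
  have -> : q%:R * (h%:R * e) = \sum_(0 <= i < h * q) e.
    by rewrite sumr_const_nat subn0 -[RHS]mulr_natl natrM; ring.
  rewrite big_seq [leRHS]big_seq; apply: ler_sum => i; rewrite mem_index_iota => /andP[_ hi].
  apply: hg; rewrite divr_ge0 //= ler_pdivrMr ?ltr0n // -natrM ler_nat ltnW //.
have d2 q : (0 < q)%N -> `|d * (rsum g2 h q - q%:R * I2)| <= `|d| * C2.
  by move=> q0; rewrite normrM ler_wpM2l // H2.
rewrite ler_norml; apply/andP; split;
  [rewrite -lerN2 opprK; apply: (@le_of_linear_bound _ _ (C + C1 + `|d| * C2)) => q q0|
   apply: (@le_of_linear_bound _ _ (C + C1 + `|d| * C2)) => q q0];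
  by have := key q q0; have := H q q0; have := H1 q q0; have := d2 q q0;
     rewrite !ler_norml; lra.
Qed.

End RiemannSums.

(** * Estimates for powers, uniform in the exponent *)

Section Sector.
Variable R : realType.

(** With [r = a / b <= 1] one has [b ^ (- s) = a ^ (- s) * r ^ s], and [r ^ 2 <= r ^ s <= 1] makes
    the constant independent of [s]. *)
Lemma powRN_lipschitz (a b s : R) : 1 <= a -> 1 <= b -> 1 <= s <= 2 ->
  `|a `^ (- s) - b `^ (- s)| <= 2 * `|a - b|.
Proof.
wlog ab : a b / a <= b.
  move=> hw a1 b1 hs; have [ab|ba] := leP a b; first exact: hw.
  by rewrite distrC (distrC a b); apply: hw => //; exact: ltW.
move=> a1 b1 /andP[s1 s2].
have a0 : 0 < a by lra.
have b0 : 0 < b by lra.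
have r1 : 0 < a / b <= 1 by rewrite divr_gt0 //= ler_pdivrMr // mul1r.
have e : b `^ (- s) = a `^ (- s) * (a / b) `^ s.
  rewrite !powR_expR ?divr_gt0 // -expRD ln_div ?posrE //; congr expR; ring.
have p1 : (a / b) ^+ 2 <= (a / b) `^ s.
  by rewrite -powR_mulrn; [apply: ger_powR|case/andP: r1 => /ltW].
have p2 : (a / b) `^ s <= 1.
  by have /andP[r0 r2] := r1; rewrite -(powRr0 (a / b)); apply: ger_powR => //; lra.
have q1 : a `^ (- s) <= 1 by rewrite -(powRr0 a); apply: ler_powR => //; lra.
have q0 := powR_ge0 a (- s).
rewrite e -{1}[a `^ (- s)]mulr1 -mulrBr normrM (ger0_norm q0) (distrC a b).
rewrite ger0_norm; last by lra.
rewrite ger0_norm; last by lra.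
have r2 : 1 - (a / b) ^+ 2 <= 2 * (1 - a / b) by have := sqr_ge0 (1 - a / b); lra.
have r3 : 1 - a / b <= b - a.
  have -> : 1 - a / b = (b - a) / b by field; lra.
  by rewrite ler_pdivrMr //; nra.
apply: (@le_trans _ _ (1 * (1 - (a / b) `^ s))); last by lra.
by rewrite ler_wpM2r //; lra.
Qed.

Lemma ln_le_sub1 (a : R) : 0 < a -> ln a <= a - 1.
Proof.
move=> a0; have := @le_ln1Dx R (a - 1); rewrite (addrC 1) subrK; apply; lra.
Qed.

Lemma inv_ln_lipschitz (a b : R) : 1 <= a -> 1 <= b ->
  `|a^-1 * ln a - b^-1 * ln b| <= 2 * `|a - b|.
Proof.
wlog ab : a b / a <= b.
  move=> hw a1 b1; have [ab|ba] := leP a b; first exact: hw.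
  by rewrite distrC (distrC a b); apply: hw => //; exact: ltW.
move=> a1 b1; have a0 : 0 < a by lra.
have b0 : 0 < b by lra.
have la0 : 0 <= ln a by exact: ln_ge0.
have la1 := ln_le_sub1 a0.
have lab : 0 <= ln b - ln a by rewrite subr_ge0 ler_ln ?posrE.
have lab2 : ln b - ln a <= b - a.
  rewrite -ln_div ?posrE //; apply: le_trans (ln_le_sub1 _) _; first exact: divr_gt0.
  have -> : b / a - 1 = (b - a) / a by field; lra.
  by rewrite ler_pdivrMr //; nra.
have -> : a^-1 * ln a - b^-1 * ln b = (ln a * (b - a) / a - (ln b - ln a)) / b.
  by field; lra.
have t1 : 0 <= ln a * (b - a) / a by rewrite divr_ge0 ?mulr_ge0 //; lra.
have t2 : ln a * (b - a) / a <= b - a.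
  by rewrite ler_pdivrMr // mulrC ler_wpM2l //; lra.
rewrite normrM normfV (gtr0_norm b0) ler_pdivrMr // (distrC a b) (ger0_norm (x := b - a)); last by lra.
apply: (@le_trans _ _ (2 * (b - a) * 1)); last by rewrite ler_wpM2l //; lra.
by rewrite ler_norml; lra.
Qed.

(** First-order Taylor expansion of [a ^ (- s)] at [s = 1]; the remainder uses [0 <= ln a <= M]. *)
Lemma powRN_expansion (a s M : R) : 1 <= a <= M -> 1 <= s ->
  `|a `^ (- s) - a^-1 + (s - 1) * (a^-1 * ln a)| <= (s - 1) ^+ 2 * M ^+ 2.
Proof.
move=> /andP[a1 aM] s1; have a0 : 0 < a by lra.
pose z := (s - 1) * ln a.
have la0 : 0 <= ln a by exact: ln_ge0.
have laM : ln a <= M by have := ln_le_sub1 a0; lra.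
have z0 : 0 <= z by rewrite mulr_ge0 //; lra.
have -> : a `^ (- s) = a^-1 * expR (- z).
  rewrite powR_expR // -{2}(lnK (x := a)) ?posrE // -expRN -expRD; congr expR; rewrite /z; ring.
have -> : a^-1 * expR (- z) - a^-1 + (s - 1) * (a^-1 * ln a) = a^-1 * (expR (- z) - 1 + z).
  by rewrite /z; ring.
have lo := expR_ge1Dx (- z).
have hi : expR (- z) <= 1 - z + z ^+ 2.
  have : expR (- z) <= (1 + z)^-1.
    by rewrite expRN lef_pV2 ?posrE ?expR_gt0 ?expR_ge1Dx //; lra.
  move/le_trans; apply; rewrite -[leLHS]mul1r ler_pdivrMr; last by lra.
  by have := exprn_ge0 3 z0; lra.
have i1 : a^-1 <= 1 by rewrite invf_le1.
have i0 : 0 <= a^-1 by rewrite invr_ge0 ltW.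
have hz : z ^+ 2 <= (s - 1) ^+ 2 * M ^+ 2.
  by rewrite -exprMn ler_pXn2r ?nnegrE ?mulr_ge0 ?ler_wpM2l //; lra.
rewrite normrM (ger0_norm i0) ger0_norm; last by lra.
apply: (@le_trans _ _ (1 * (expR (- z) - 1 + z))); first by rewrite ler_wpM2r //; lra.
by lra.
Qed.

Variables (phi : R -> R) (h : nat) (La M : R).
Hypothesis La0 : 0 <= La.
Hypothesis phi_bnd : forall t, 0 <= t <= h%:R -> 1 <= phi t <= M.
Hypothesis phi_lip : forall t t', 0 <= t <= h%:R -> 0 <= t' <= h%:R ->
  `|phi t - phi t'| <= La * `|t - t'|.

Lemma rsum_powRN s : 1 <= s <= 2 -> exists I, forall q, (0 < q)%N ->
  `|rsum (fun t => phi t `^ (- s)) h q - q%:R * I| <= h%:R * (2 * La).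
Proof.
move=> hs; apply: rsum_limit; first by rewrite mulr_ge0.
move=> t t' ht ht'; have /andP[h1 _] := phi_bnd ht; have /andP[h2 _] := phi_bnd ht'.
apply: le_trans (powRN_lipschitz h1 h2 hs) _.
by rewrite -mulrA ler_wpM2l // phi_lip.
Qed.

Lemma rsum_inv_ln : exists I, forall q, (0 < q)%N ->
  `|rsum (fun t => (phi t)^-1 * ln (phi t)) h q - q%:R * I| <= h%:R * (2 * La).
Proof.
apply: rsum_limit; first by rewrite mulr_ge0.
move=> t t' ht ht'; have /andP[h1 _] := phi_bnd ht; have /andP[h2 _] := phi_bnd ht'.
apply: le_trans (inv_ln_lipschitz h1 h2) _.
by rewrite -mulrA ler_wpM2l // phi_lip.
Qed.

End Sector.

(** * The lattice sum over a sector near [s = 1] *)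

Section SectorAsymptotics.
Variable R : realType.
Variables (phi : R -> R) (h : nat) (La M : R).
Hypothesis La0 : 0 <= La.
Hypothesis phi_bnd : forall t, 0 <= t <= h%:R -> 1 <= phi t <= M.
Hypothesis phi_lip : forall t t', 0 <= t <= h%:R -> 0 <= t' <= h%:R ->
  `|phi t - phi t'| <= La * `|t - t'|.

Let S (q : nat) (s : R) := rsum (fun t => phi t `^ (- s)) h q.

Definition sector_term (s : R) (k : nat) : R :=
  \sum_(0 <= m < h * k.+1) (k.+1%:R ^+ 2 * phi (m%:R / k.+1%:R)) `^ (- s).

Lemma sector_argument (k m : nat) : (m < h * k.+1)%N -> 0 <= (m%:R / k.+1%:R : R) <= h%:R.
Proof.
by move=> hm; rewrite divr_ge0 //= ler_pdivrMr // -natrM ler_nat ltnW.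
Qed.

Lemma sector_termE s k :
  sector_term s k = k.+1%:R `^ (1 - 2 * s) / k.+1%:R * S k.+1 s.
Proof.
rewrite /sector_term /S /rsum mulr_sumr big_seq [RHS]big_seq.
apply: eq_bigr => m; rewrite mem_index_iota => /andP[_ hm].
have /andP[p1 _] := phi_bnd (sector_argument hm).
have k0 : 0 < k.+1%:R :> R by [].
rewrite powRM ?sqr_ge0 //; last by lra.
congr (_ * _); rewrite -(powR_mulrn 2 (ltW k0)) -powRrM -[X in _ / X](powRr1 (ltW k0)) -powRB.
  by congr (_ `^ _); ring.
by rewrite (lt0r_neq0 k0) implybT.
Qed.

Lemma cvg_rsum_powRN q s0 : (0 < q)%N ->
  S q s @[s --> s0^'+] --> S q s0.
Proof.
move=> q0; rewrite /S /rsum.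
have := @cvg_series_fun R s0^'+ _ (fun s k => if (k < h * q)%N then phi (k%:R / q%:R) `^ (- s) else 0)
  (fun k => if (k < h * q)%N then phi (k%:R / q%:R) `^ (- s0) else 0) (h * q)%N.
have e s : series (fun k => if (k < h * q)%N then phi (k%:R / q%:R) `^ (- s) else 0) (h * q)%N =
    \sum_(0 <= m < h * q) phi (m%:R / q%:R) `^ (- s).
  rewrite /series /= big_seq [RHS]big_seq; apply: eq_bigr => m.
  by rewrite mem_index_iota => /andP[_ ->].
rewrite e; under eq_fun do rewrite e; apply => k.
case: ifP => hk; last exact: cvg_cst.
have : 1 <= phi (k%:R / q%:R) <= M.
  by apply: phi_bnd; rewrite divr_ge0 //= ler_pdivrMr ?ltr0n // -natrM ler_nat ltnW.
move=> /andP[p1 _]; apply: powR_cvg; first by lra.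
by apply: cvgN; apply: cvg_at_right_filter; exact: cvg_id.
Qed.

(** The main part of the sum is [Ph s * zetaodd s]; the bounded row errors give a series dominated
    by [C / q ^ 2], continuous up to [s = 1]. A finite part exists because [Ph] and [c ^ (s / 2)],
    which multiply the pole, have right derivatives at 1. *)
Lemma sector_asymptotics (c I1 C1 : R) : 0 < c ->
  (forall q, (0 < q)%N -> `|rsum (fun t => (phi t)^-1) h q - q%:R * I1| <= C1) ->
  (forall s, 1 < s <= 2 -> cvgn (series (sector_term s))) /\
  exists r : R, c `^ (s / 2) * limn (series (sector_term s))
    - (c `^ 2^-1 * I1 / 2) / (s - 1) @[s --> (1 : R)^'+] --> r.
Proof.
move=> c0 HI1; pose C := h%:R * (2 * La).
have C0 : 0 <= C by rewrite !mulr_ge0.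
(* [Ph s] stands for the integral of [phi ^ (- s)] over [[0, h]]; outside [[1, 2]] its value is
   arbitrary. *)
have /choice [Ph HPh] : forall s : R, exists I, 1 <= s <= 2 ->
    forall q, (0 < q)%N -> `|S q s - q%:R * I| <= C.
  move=> s; have [hs|hs] := boolP (1 <= s <= 2); last by exists 0.
  by have [I hI] := rsum_powRN La0 phi_bnd phi_lip hs; exists I => _.
have [I2 HI2] := rsum_inv_ln La0 phi_bnd phi_lip.
have S1 q : (0 < q)%N -> S q 1 = rsum (fun t => (phi t)^-1) h q.
  move=> q0; rewrite /S /rsum big_seq [RHS]big_seq; apply: eq_bigr => m.
  rewrite mem_index_iota => /andP[_ hm]; rewrite powR_inv1 //.
  have : 1 <= phi (m%:R / q%:R) <= M; last by lra.
  by apply: phi_bnd; rewrite divr_ge0 //= ler_pdivrMr ?ltr0n // -natrM ler_nat ltnW.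
have H11 : 1 <= (1 : R) <= 2 by lra.
have Ph1 : Ph 1 = I1.
  apply: (rsum_limit_unique (HPh 1 H11)) => q q0.
  by rewrite -/(S q 1) S1 //; exact: HI1.
have expand s : 1 <= s <= 2 ->
    `|Ph s - I1 + (s - 1) * I2| <= h%:R * ((s - 1) ^+ 2 * M ^+ 2).
  move=> hs; apply: (@rsum_limit_approx R (fun t => phi t `^ (- s)) (fun t => (phi t)^-1)
    (fun t => (phi t)^-1 * ln (phi t)) h (s - 1)); [|exact: HPh|exact: HI1|exact: HI2].
  by move=> t ht; apply: powRN_expansion; [exact: phi_bnd|lra].
have quot : (Ph s - I1) / (s - 1) @[s --> (1 : R)^'+] --> - I2.
  apply/cvgrPdist_le => e e0; pose B := h%:R * M ^+ 2 + 1.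
  have B0 : 0 < B by rewrite /B ltr_wpDl // mulr_ge0 ?sqr_ge0.
  near=> s.
  have s1 : 0 < s - 1 by rewrite subr_gt0; near: s; exact: nbhs_right_gt.
  have s2 : s <= 2 by near: s; apply: nbhs_right_ltW; lra.
  have s3 : s - 1 < e / B.
    by rewrite ltrBlDl; near: s; apply: nbhs_right_lt; rewrite ltrDl divr_gt0.
  have -> : - I2 - (Ph s - I1) / (s - 1) = - (Ph s - I1 + (s - 1) * I2) / (s - 1) by field; lra.
  rewrite normrM normrN normfV (gtr0_norm s1) ler_pdivrMr //.
  apply: le_trans (expand s _) _; first by lra.
  have : (s - 1) * B < e by rewrite -ltr_pdivlMr.
  rewrite /B => h1.
  have : (s - 1) * ((s - 1) * (h%:R * M ^+ 2 + 1)) <= (s - 1) * e by rewrite ler_pM2l // ltW.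
  by have := mulr_gt0 s1 s1; lra.
have Phc : Ph s @[s --> (1 : R)^'+] --> I1.
  have : (Ph s - I1) / (s - 1) * (s - 1) + I1 @[s --> (1 : R)^'+] --> - I2 * (1 - 1) + I1.
    apply: cvgD; last exact: cvg_cst.
    by apply: cvgM => //; apply: cvgB; [exact: cvg_at1|exact: cvg_cst].
  rewrite subrr mulr0 add0r; apply: cvg_trans; apply: near_eq_cvg; near=> s.
  have s1 : s - 1 != 0 by rewrite subr_eq0 gt_eqF //; near: s; exact: nbhs_right_gt.
  by rewrite mulfVK // subrK.
pose T s (k : nat) : R := k.+1%:R `^ (1 - 2 * s) / k.+1%:R * (S k.+1 s - k.+1%:R * Ph s).
have cM : cvgn (series (fun k => C * ((k.+1%:R : R) ^+ 2)^-1)).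
  by apply: series_mull_cvg; exact: inv_sqr_series_cvg.
have Tb s : 1 <= s <= 2 -> forall k, `|T s k| <= C * ((k.+1%:R : R) ^+ 2)^-1.
  move=> hs k; have k0 : 0 < k.+1%:R :> R by [].
  rewrite /T normrM mulrC; apply: ler_pM => //; first exact: HPh.
  rewrite ger0_norm ?divr_ge0 ?powR_ge0 //.
  have -> : (k.+1%:R ^+ 2)^-1 = k.+1%:R `^ (-1) / k.+1%:R :> R.
    by rewrite powR_inv1 // -invfM expr2.
  by rewrite ler_pM2r ?invr_gt0 //; apply: ler_powR; [rewrite ler1n|lra].
have hTb : \forall s \near (1 : R)^'+, forall k, `|T s k| <= C * ((k.+1%:R : R) ^+ 2)^-1.
  near=> s; apply: Tb; apply/andP; split.
    by near: s; exact: nbhs_right_ge.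
  by near: s; apply: nbhs_right_ltW; lra.
pose v (k : nat) : R := k.+1%:R `^ (1 - 2 * 1) / k.+1%:R * (S k.+1 1 - k.+1%:R * I1).
have hTl k : T s k @[s --> (1 : R)^'+] --> v k.
  apply: cvgM.
    apply: cvgM; last exact: cvg_cst.
    apply: powR_cvg => //; apply: cvgB; first exact: cvg_cst.
    by apply: cvgM; [exact: cvg_cst|exact: cvg_at1].
  apply: cvgB; first exact: cvg_rsum_powRN.
  by apply: cvgM => //; exact: cvg_cst.
have [_ hT] := tannery cM hTb hTl.
have [zc [g hg]] := zetaodd_pole R.
have dec s : 1 < s <= 2 -> series (sector_term s) @ \oo --> Ph s * zetaodd s + limn (series (T s)).
  move=> /andP[s1 s2].
  have [cT _] := dominated_series cM (Tb s ltac:(lra)).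
  have -> : series (sector_term s) =
      (fun n => Ph s * series (fun k => k.+1%:R `^ (1 - 2 * s)) n + series (T s) n).
    apply/funext => n; rewrite /series /= mulr_sumr -big_split /=; apply: eq_bigr => k _.
    rewrite sector_termE /T; have k0 : k.+1%:R != 0 :> R by rewrite pnatr_eq0.
    by field.
  by apply: cvgD => //; apply: cvgM; [exact: cvg_cst|exact: zc].
split; first by move=> s hs; apply/cvg_ex; eexists; exact: dec.
have cc : c `^ (s / 2) @[s --> (1 : R)^'+] --> c `^ (1 / 2).
  by apply: powR_cvg => //; apply: cvgM; [exact: cvg_at1|exact: cvg_cst].
have cq := @powR_quotient_cvg R 2^-1 c c0.
exists (c `^ (1 / 2) * limn (series v) + I1 * c `^ (1 / 2) * g
   + (c `^ (1 / 2) * (- I2) / 2 + I1 * c `^ 2^-1 * (2^-1 * ln c) / 2)).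
(* The last two summands are the product rule: difference quotients of [Ph] and of [c ^ (s / 2)]
   replace the pole multiplied by a varying coefficient. *)
have main : c `^ (s / 2) * limn (series (T s))
   + Ph s * c `^ (s / 2) * (zetaodd s - (2 * (s - 1))^-1)
   + (c `^ (s / 2) * ((Ph s - I1) / (s - 1)) / 2
      + I1 * c `^ 2^-1 * ((c `^ (2^-1 * (s - 1)) - 1) / (s - 1)) / 2)
   @[s --> (1 : R)^'+] --> c `^ (1 / 2) * limn (series v) + I1 * c `^ (1 / 2) * g
   + (c `^ (1 / 2) * (- I2) / 2 + I1 * c `^ 2^-1 * (2^-1 * ln c) / 2).
  apply: cvgD; first apply: cvgD.
  - exact: cvgM cc hT.
  - by apply: cvgM hg; exact: cvgM Phc cc.
  - apply: cvgD; apply: cvgM; [exact: cvgM cc quot|exact: cvg_cst| |exact: cvg_cst].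
    by apply: cvgM cq; exact: cvg_cst.
apply: cvg_trans main; apply: near_eq_cvg; near=> s.
have s1 : 1 < s by near: s; exact: nbhs_right_gt.
have s2 : s <= 2 by near: s; apply: nbhs_right_ltW; lra.
rewrite (cvg_lim _ (dec s _)) //; last by rewrite s1.
have -> : c `^ (s / 2) = c `^ 2^-1 * c `^ (2^-1 * (s - 1)).
  by rewrite -powRD; [congr (_ `^ _); field|rewrite (lt0r_neq0 c0) implybT].
by field; lra.
Unshelve. all: by end_near. Qed.

End SectorAsymptotics.

(** * The integral of the reciprocal of a quadratic polynomial *)

Section QuadraticSector.
Variable R : realType.

Lemma ln_step (d a b : R) : 0 < d -> d <= a -> d <= b ->
  `|ln b - ln a - (b - a) / a| <= (b - a) ^+ 2 / d ^+ 2.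
Proof.
move=> d0 da db; have a0 : 0 < a by lra.
have b0 : 0 < b by lra.
have h1 : ln b - ln a <= (b - a) / a.
  rewrite -ln_div ?posrE //; apply: le_trans (ln_le_sub1 _) _; first exact: divr_gt0.
  by rewrite le_eqVlt; apply/orP; left; apply/eqP; field; lra.
have h2 : ln a - ln b <= (a - b) / b.
  rewrite -ln_div ?posrE //; apply: le_trans (ln_le_sub1 _) _; first exact: divr_gt0.
  by rewrite le_eqVlt; apply/orP; left; apply/eqP; field; lra.
have e : (b - a) / a + (a - b) / b = (b - a) ^+ 2 / (a * b) by field; lra.
have h3 : (b - a) ^+ 2 / (a * b) <= (b - a) ^+ 2 / d ^+ 2.
  rewrite ler_wpM2l ?sqr_ge0 // lef_pV2 ?posrE ?exprn_gt0 ?mulr_gt0 //.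
  by rewrite expr2 ler_pM // ltW.
by rewrite ler_norml; lra.
Qed.

(** [(ln (1 + t x) - ln (1 + t x')) / (x - x')] is an antiderivative of the integrand. Its
    increments telescope along the grid, and [q] times an increment differs from the integrand by
    [O(1 / q)], for [h * q] grid points. *)
Lemma rsum_inv_quadratic (x x' d : R) (h : nat) : x' < x -> 0 < d ->
  (forall t, 0 <= t <= h%:R -> d <= 1 + t * x /\ d <= 1 + t * x') ->
  exists C, forall q, (0 < q)%N ->
    `|rsum (fun t => ((1 + t * x) * (1 + t * x'))^-1) h q
      - q%:R * ((ln (1 + h%:R * x) - ln (1 + h%:R * x')) / (x - x'))| <= C.
Proof.
move=> lt d0 hd; have xx : 0 < x - x' by lra.
(* [q / (x - x')] times the two second-order errors of [ln_step] equals [E / q]. *)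
pose E := (x ^+ 2 + x' ^+ 2) / d ^+ 2 / (x - x').
exists (h%:R * E) => q q0; have qR : 0 < q%:R :> R by rewrite ltr0n.
pose G (m : nat) : R := (ln (1 + m%:R / q%:R * x) - ln (1 + m%:R / q%:R * x')) / (x - x').
have -> : (ln (1 + h%:R * x) - ln (1 + h%:R * x')) / (x - x') = \sum_(0 <= m < h * q) (G m.+1 - G m).
  rewrite telescope_sumr // /G natrM mulfK ?gt_eqF // !mul0r addr0 subrr mul0r subr0.
  by [].
rewrite mulr_sumr /rsum -sumrB; apply: le_trans (ler_norm_sum _ _ _) _.
have -> : h%:R * E = \sum_(0 <= m < h * q) (E / q%:R).
  by rewrite sumr_const_nat subn0 -[RHS]mulr_natl natrM; field; rewrite gt_eqF.
rewrite big_seq [leRHS]big_seq; apply: ler_sum => m; rewrite mem_index_iota => /andP[_ hm].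
set t : R := m%:R / q%:R.
have e1 : m.+1%:R / q%:R = t + q%:R^-1 :> R by rewrite -natr1 mulrDl mul1r.
have t0 : 0 <= t by rewrite divr_ge0 // ltW.
have t1 : t + q%:R^-1 <= h%:R by rewrite -e1 ler_pdivrMr // -natrM ler_nat.
have qi : 0 < q%:R^-1 :> R by rewrite invr_gt0.
have [a1 a2] := hd t ltac:(lra); have [b1 b2] := hd (t + q%:R^-1) ltac:(lra).
have := ln_step d0 a1 b1; have := ln_step d0 a2 b2.
have -> : 1 + (t + q%:R^-1) * x' - (1 + t * x') = x' / q%:R by ring.
have -> : 1 + (t + q%:R^-1) * x - (1 + t * x) = x / q%:R by ring.
rewrite /G e1 -/t; set l1 := ln _; set l2 := ln _; set l3 := ln _; set l4 := ln _ => H1 H2.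
have a10 : 0 < 1 + t * x by lra.
have a20 : 0 < 1 + t * x' by lra.
have -> : ((1 + t * x) * (1 + t * x'))^-1 -
    q%:R * ((l3 - l1) / (x - x') - (l4 - l2) / (x - x')) =
   - (q%:R / (x - x')) * ((l3 - l4 - x / q%:R / (1 + t * x)) - (l1 - l2 - x' / q%:R / (1 + t * x'))).
  by field; rewrite !gt_eqF.
rewrite normrM normrN (ger0_norm (x := q%:R / _)); last by rewrite divr_ge0 ?ltW.
apply: (@le_trans _ _ (q%:R / (x - x') * ((x / q%:R) ^+ 2 / d ^+ 2 + (x' / q%:R) ^+ 2 / d ^+ 2))).
  rewrite ler_pM2l ?divr_gt0 //; apply: le_trans (ler_normB _ _) _.
  exact: lerD.
rewrite /E le_eqVlt; apply/orP; left; apply/eqP; field.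
by rewrite !gt_eqF.
Qed.

End QuadraticSector.

(** * The value of zeta at 2 *)

Section Basel.
Variable R : realType.

Lemma sin_arc_bounds (t : R) : 0 < t < pi / 2 -> t * cos t <= sin t <= t.
Proof.
move=> /andP[t0 t1].
have [c hc e] := @MVT R sin cos 0 t t0 (fun x _ => is_derive_sin x)
  (continuous_subspaceT (@continuous_sin R)).
move: hc; rewrite in_itv /= => /andP[c0 ct].
rewrite sin0 !subr0 in e; rewrite e.
have hpi := @pi_gt0 R.
have lt : cos t < cos c by rewrite ltr_cos // ?in_itv /=; lra.
by have := cos_le1 c; nra.
Qed.

Lemma inv_sin_sqr_bounds (t : R) : 0 < t < pi / 2 ->
  (sin t ^+ 2)^-1 - 1 <= (t ^+ 2)^-1 <= (sin t ^+ 2)^-1.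
Proof.
move=> ht; have /andP[lo hi] := sin_arc_bounds ht; have /andP[t0 t1] := ht.
have s0 : 0 < sin t by exact: sin_gt0_pihalf.
have c0 : 0 < cos t by apply: cos_gt0_pihalf; have := @pi_gt0 R; lra.
have s2 : 0 < sin t ^+ 2 by rewrite exprn_gt0.
have t2 : 0 < t ^+ 2 by rewrite exprn_gt0.
apply/andP; split; last by rewrite lef_pV2 ?posrE // ler_pXn2r ?nnegrE // ltW.
have -> : (sin t ^+ 2)^-1 - 1 = cos t ^+ 2 / sin t ^+ 2.
  by rewrite cos2sin2; field; lra.
rewrite ler_pdivrMr // [leRHS]mulrC ler_pdivlMr // -exprMn.
by rewrite ler_pXn2r // ?nnegrE ?mulr_ge0 ?(ltW s0) ?(ltW c0) ?(ltW t0) //; lra.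
Qed.

Let theta (N k : nat) : R := (2 * k%:R + 1) * (pi / 2 ^+ N.+2).

(* 1/sin^2 t + 1/cos^2 t = 4/sin^2 (2 t) pairs the angles of level N+1 into those of
   level N. *)
Lemma csc_sqr_sum N :
  \sum_(0 <= k < 2 ^ N) (sin (theta N k) ^+ 2)^-1 = 2 * 4 ^+ N.
Proof.
elim: N => [|N IH].
  rewrite expn0 big_nat1 /theta mulr0 add0r mul1r expr0 mulr1.
  have -> : pi / 2 ^+ 2 = pi / 4 :> R by congr (_ / _); lra.
  have e : cos (pi / 4) = sin (pi / 4) :> R.
    by rewrite -cosBpihalf -cosN; congr cos; field.
  have := cos2Dsin2 (pi / 4 : R); rewrite e => h.
  have -> : sin (pi / 4) ^+ 2 = 2^-1 :> R by lra.
  by rewrite invrK.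
have -> : (2 ^ N.+1 = 2 ^ N + 2 ^ N)%N by rewrite expnS mul2n addnn.
rewrite (big_cat_nat (n := (2 ^ N)%N)) ?leq_addr //=.
(* Reversing the upper half pairs [k] with [2 ^ N.+1 - 1 - k], whose angle is the complement of that
   of [k] to [pi / 2]. *)
rewrite -{2}[(2 ^ N)%N]add0n big_addn addnK [X in _ + X]big_nat_rev /= -big_split /=.
rewrite exprS [RHS](_ : _ = 4 * (2 * 4 ^+ N)); last by ring.
rewrite -IH mulr_sumr big_seq [RHS]big_seq; apply: eq_bigr => k.
rewrite mem_index_iota => /andP[_ hk].
have hpi := @pi_gt0 R.
have P0 : 0 < 2 ^+ N :> R by rewrite exprn_gt0.
have kR : k%:R + 1 <= 2 ^+ N :> R by rewrite natr1 -natrX ler_nat.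
have e1 : theta N k = theta N.+1 k *+ 2.
  by rewrite /theta (exprS _ N.+2) mulr2n; field; rewrite gt_eqF // exprn_gt0.
have e2 : theta N.+1 (0 + 2 ^ N - k.+1 + 2 ^ N) = pi / 2 - theta N.+1 k.
  rewrite /theta add0n natrD natrB // natrX -natr1 !exprS.
  by field; rewrite gt_eqF.
rewrite e2.
have -> : sin (pi / 2 - theta N.+1 k) = cos (theta N.+1 k).
  by rewrite -cosBpihalf -cosN; congr cos; field.
rewrite e1 sin_mulr2n.
have t0 : 0 < theta N.+1 k.
  by rewrite /theta mulr_gt0 ?divr_gt0 ?exprn_gt0 //; have := ler0n R k; lra.
have t1 : theta N.+1 k < pi / 2.
  rewrite /theta mulrA ltr_pdivrMr ?exprn_gt0 // !exprS.
  have k0 := ler0n R k.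
  have h1 : 0 < pi * (2 ^+ N - k%:R) :> R by rewrite mulr_gt0 //; lra.
  have h2 : 0 <= pi * (2 ^+ N - 1) :> R by rewrite mulr_ge0 //; lra.
  by lra.
have s0 : 0 < sin (theta N.+1 k) by apply: sin_gt0_pihalf; rewrite t0.
have c0 : 0 < cos (theta N.+1 k) by apply: cos_gt0_pihalf; lra.
have h := cos2Dsin2 (theta N.+1 k).
move: s0 c0 h; move: (sin _) (cos _) => s c s0 c0 h.
rewrite mulr2n.
transitivity ((c ^+ 2 + s ^+ 2) / (c * s) ^+ 2); first by field; lra.
have -> : c * s + c * s = 2 * (c * s) by ring.
by rewrite h; have := mulr_gt0 c0 s0; move: (c * s) => z z0; field; lra.
Qed.

(** Cauchy's argument: [1 / t ^ 2] lies between [1 / sin ^ 2 t - 1] and [1 / sin ^ 2 t], whose sums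
    over the angles are known. The [2 ^ N] units lost below shrink to [pi ^ 2 / (16 * 2 ^ N)] after
    scaling. *)
Lemma odd_sqr_partial N :
  (pi ^+ 2 / 8 - pi ^+ 2 / 16 * (2 ^+ N)^-1 : R) <= series (fun k => ((2 * k%:R + 1) ^+ 2)^-1) (2 ^ N)%N
    <= (pi ^+ 2 / 8 : R).
Proof.
have hpi := @pi_gt0 R; set P : R := 2 ^+ N.
have P0 : 0 < P by rewrite /P exprn_gt0.
have P4 : 4 ^+ N = P ^+ 2 by rewrite /P -exprM mulnC exprM; congr (_ ^+ N); lra.
set o := series _ _.
have eo : \sum_(0 <= k < 2 ^ N) ((theta N k) ^+ 2)^-1 = 16 * P ^+ 2 / pi ^+ 2 * o.
  rewrite /o /series /= mulr_sumr; apply: eq_bigr => k _; rewrite /theta !exprS -/P.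
  have : 0 < 2 * k%:R + 1 :> R by have := ler0n R k; lra.
  by move: (2 * k%:R + 1) => z z0; field; lra.
have rng k : (k < 2 ^ N)%N -> 0 < theta N k < pi / 2.
  move=> hk; have kR : k%:R + 1 <= P by rewrite /P natr1 -natrX ler_nat.
  have k0 := ler0n R k; apply/andP; split.
    by rewrite /theta mulr_gt0 ?divr_gt0 ?exprn_gt0 //; lra.
  rewrite /theta mulrA ltr_pdivrMr ?exprn_gt0 // !exprS -/P.
  have h1 : 0 <= pi * (P - k%:R - 1) by rewrite mulr_ge0 //; lra.
  by lra.
have S := csc_sqr_sum N; rewrite P4 in S.
have up : \sum_(0 <= k < 2 ^ N) ((theta N k) ^+ 2)^-1 <= 2 * P ^+ 2.
  rewrite -S big_seq [leRHS]big_seq; apply: ler_sum => k; rewrite mem_index_iota => /andP[_ hk].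
  by have /andP[] := inv_sin_sqr_bounds (rng k hk).
have lo : 2 * P ^+ 2 - P <= \sum_(0 <= k < 2 ^ N) ((theta N k) ^+ 2)^-1.
  have e : P = \sum_(0 <= k < 2 ^ N) (1 : R) by rewrite /P sumr_const_nat subn0 natrX.
  rewrite -S [X in _ - X <= _]e -sumrB big_seq [leRHS]big_seq.
  apply: ler_sum => k; rewrite mem_index_iota => /andP[_ hk].
  by have /andP[] := inv_sin_sqr_bounds (rng k hk).
have pi2 : 0 < pi ^+ 2 :> R by rewrite exprn_gt0.
have eo2 : o = (\sum_(0 <= k < 2 ^ N) ((theta N k) ^+ 2)^-1) * (pi ^+ 2 / (16 * P ^+ 2)).
  by rewrite eo; field; lra.
have c0 : 0 < pi ^+ 2 / (16 * P ^+ 2) by rewrite divr_gt0 // mulr_gt0 // exprn_gt0.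
rewrite eo2; apply/andP; split.
  have -> : pi ^+ 2 / 8 - pi ^+ 2 / 16 * P^-1 = (2 * P ^+ 2 - P) * (pi ^+ 2 / (16 * P ^+ 2)) by field; lra.
  by rewrite ler_pM2r.
have -> : pi ^+ 2 / 8 = (2 * P ^+ 2) * (pi ^+ 2 / (16 * P ^+ 2)) by field; lra.
by rewrite ler_pM2r.
Qed.

Lemma cvg_subseq_ge (u : R ^nat) (l : R) (f : nat -> nat) :
  (forall n, (n <= f n)%N) -> u @ \oo --> l -> (u \o f) @ \oo --> l.
Proof.
move=> hf hu; apply: cvg_comp hu => A [N _ hN].
by exists N => // n /= Nn; apply: hN; exact: leq_trans (hf n).
Qed.

Lemma odd_sqr_series : series (fun k => ((2 * k%:R + 1) ^+ 2)^-1) @ \oo --> (pi ^+ 2 / 8 : R).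
Proof.
set o := fun k => _.
have co : cvgn (series o).
  apply: (@series_le_cvg _ _ (fun k => (k.+1%:R ^+ 2)^-1 : R)).
  - by move=> k; rewrite invr_ge0 sqr_ge0.
  - by move=> k; rewrite invr_ge0 sqr_ge0.
  - move=> k; have k0 := ler0n R k; have p : 0 < 2 * k%:R + 1 :> R by lra.
    have e : k.+1%:R = k%:R + 1 :> R by rewrite natr1.
    rewrite /o lef_pV2 ?posrE ?exprn_gt0 // ler_pXn2r ?nnegrE ?(ltW p) // e; lra.
  - exact: inv_sqr_series_cvg.
suff <- : limn (series o) = pi ^+ 2 / 8 by [].
have h1 : (series o \o expn 2) @ \oo --> limn (series o).
  by apply: cvg_subseq_ge => // n; exact: ltnW (ltn_expl n _).
apply: (cvg_unique _ h1) => //=.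
apply: (@squeeze_cvgr _ _ _ _ (fun N => pi ^+ 2 / 8 - pi ^+ 2 / 16 * (2 ^+ N)^-1) (fun=> pi ^+ 2 / 8)).
- by near=> N; exact: odd_sqr_partial.
- rewrite -[X in _ --> X]subr0 -[X in _ --> _ - X](mulr0 (pi ^+ 2 / 16)).
  apply: cvgB; first exact: cvg_cst.
  apply: cvgM; first exact: cvg_cst.
  have := @cvg_geometric R 1 2^-1; rewrite ger0_norm ?invr_ge0 // => /(_ _).
  have -> : geometric 1 2^-1 = (fun N => (2 ^+ N)^-1 : R).
    by apply/funext => N; rewrite /geometric /= mul1r exprVn.
  by apply; rewrite invf_lt1 //; lra.
- exact: cvg_cst.
Unshelve. all: by end_near. Qed.

Lemma sqr_series_even n : series (fun k => (k.+1%:R ^+ 2)^-1 : R) (2 * n)%N =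
  series (fun k => ((2 * k%:R + 1) ^+ 2)^-1) n + 4^-1 * series (fun k => (k.+1%:R ^+ 2)^-1) n.
Proof.
elim: n => [|n IH]; first by rewrite muln0 /series /= !big_geq // mulr0 addr0.
rewrite mulnS add2n !seriesSr IH.
have -> : (2 * n).+1%:R = 2 * n%:R + 1 :> R by rewrite -natr1 natrM.
have -> : (2 * n).+2%:R = 2 * (n%:R + 1) :> R by rewrite -natr1 -natr1 natrM; lra.
have -> : n.+1%:R = n%:R + 1 :> R by rewrite natr1.
have := ler0n R n; move: (n%:R : R) => y y0.
by field; lra.
Qed.

Lemma alt_sqr_series_even n : series (fun k => (-1) ^+ k * (k.+1%:R ^+ 2)^-1 : R) (2 * n)%N =
  series (fun k => ((2 * k%:R + 1) ^+ 2)^-1) n - 4^-1 * series (fun k => (k.+1%:R ^+ 2)^-1) n.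
Proof.
elim: n => [|n IH]; first by rewrite muln0 /series /= !big_geq // mulr0 subr0.
have s1 : (-1) ^+ (2 * n) = 1 :> R by rewrite exprM sqrrN !expr1n.
rewrite mulnS add2n !seriesSr IH s1 (_ : (-1) ^+ (2 * n).+1 = -1); last by rewrite exprS s1 mulr1.
have -> : (2 * n).+1%:R = 2 * n%:R + 1 :> R by rewrite -natr1 natrM.
have -> : (2 * n).+2%:R = 2 * (n%:R + 1) :> R by rewrite -natr1 -natr1 natrM; lra.
have -> : n.+1%:R = n%:R + 1 :> R by rewrite natr1.
have := ler0n R n; move: (n%:R : R) => y y0.
by field; lra.
Qed.

(** The even terms make up a quarter of the whole, so the limit [L] satisfies
    [L = pi ^ 2 / 8 + L / 4]. *)
Lemma basel : series (fun k => (k.+1%:R ^+ 2)^-1) @ \oo --> (pi ^+ 2 / 6 : R).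
Proof.
set z := fun k => _.
have cz : cvgn (series z) by exact: inv_sqr_series_cvg.
suff <- : limn (series z) = pi ^+ 2 / 6 by [].
have h1 : (series z \o (fun n => 2 * n)%N) @ \oo --> limn (series z).
  by apply: cvg_subseq_ge => // n; lia.
have h2 : (series z \o (fun n => 2 * n)%N) @ \oo --> pi ^+ 2 / 8 + 4^-1 * limn (series z).
  have -> : series z \o (fun n => 2 * n)%N = (fun n => series (fun k => ((2 * k%:R + 1) ^+ 2)^-1) n + 4^-1 * series z n).
    by apply/funext => n /=; exact: sqr_series_even.
  apply: cvgD; first exact: odd_sqr_series.
  by apply: cvgM => //; exact: cvg_cst.
have e : limn (series z) = pi ^+ 2 / 8 + 4^-1 * limn (series z).
  exact: (cvg_unique _ h1 h2).
by move: e; move: (limn _) => L; lra.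
Qed.

Lemma alternating_basel :
  series (fun k => (-1) ^+ k * (k.+1%:R ^+ 2)^-1) @ \oo --> (pi ^+ 2 / 12 : R).
Proof.
set z := fun k => _.
have [|cz _] := @dominated_series R z _ (@inv_sqr_series_cvg R).
  move=> k; rewrite /z normrM normrX normrN1 expr1n mul1r ger0_norm //.
suff <- : limn (series z) = pi ^+ 2 / 12 by [].
have h1 : (series z \o (fun n => 2 * n)%N) @ \oo --> limn (series z).
  by apply: cvg_subseq_ge => // n; lia.
have h2 : (series z \o (fun n => 2 * n)%N) @ \oo --> pi ^+ 2 / 8 - 4^-1 * (pi ^+ 2 / 6).
  have -> : series z \o (fun n => 2 * n)%N = (fun n => series (fun k => ((2 * k%:R + 1) ^+ 2)^-1) n - 4^-1 * series (fun k => (k.+1%:R ^+ 2)^-1) n).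
    by apply/funext => n /=; exact: alt_sqr_series_even.
  apply: cvgB; first exact: odd_sqr_series.
  by apply: cvgM; [exact: cvg_cst|exact: basel].
have e : limn (series z) = pi ^+ 2 / 8 - 4^-1 * (pi ^+ 2 / 6).
  exact: (cvg_unique _ h1 h2).
by rewrite e; lra.
Qed.

Lemma riemann_zeta2 : riemann_zeta (2 : R) = pi ^+ 2 / 6.
Proof.
rewrite /riemann_zeta (_ : riemannR 2 = (fun k => (k.+1%:R ^+ 2)^-1)).
  by apply/cvg_lim => //; exact: basel.
by apply/funext => k; rewrite /riemannR -powR_mulrn.
Qed.

End Basel.

(** * Integrals over the unit interval and the series for [J] *)

Section IntegralOnUnit.
Variable R : realType.
Implicit Types (f g : R -> R).

(* [t `^ a] takes the junk value 1 for t < 0, so only right continuity holds at 0. *)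
Definition regular f :=
  (forall t, 0 < t -> {for t, continuous f}) /\ f t @[t --> (0 : R)^'+] --> f 0.

Lemma regular_cst (c : R) : regular (fun=> c).
Proof. by split=> [t _|]; exact: cvg_cst. Qed.

Lemma regular_id : regular id.
Proof. by split=> [t _|]; [exact: cvg_id|apply: cvg_at_right_filter; exact: cvg_id]. Qed.

Lemma regularD f g : regular f -> regular g -> regular (fun t => f t + g t).
Proof.
by move=> [f1 f2] [g1 g2]; split=> [t t0|]; [apply: cvgD; [exact: f1|exact: g1]|exact: cvgD].
Qed.

Lemma regularM f g : regular f -> regular g -> regular (fun t => f t * g t).
Proof.
by move=> [f1 f2] [g1 g2]; split=> [t t0|]; [apply: cvgM; [exact: f1|exact: g1]|exact: cvgM].
Qed.

Lemma regular_comp f g : regular f -> (forall t, 0 <= t -> {for f t, continuous g}) ->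
  regular (fun t => g (f t)).
Proof.
move=> [f1 f2] hg; split=> [t t0|].
  exact: (continuous_comp (f1 t t0) (hg t (ltW t0))).
by apply: continuous_cvg => //; exact: hg.
Qed.

Lemma regularV f : (forall t, 0 <= t -> f t != 0) -> regular f -> regular (fun t => (f t)^-1).
Proof.
move=> f0 hf; apply: (regular_comp (g := GRing.inv)) => // t t0.
by apply: inv_continuous; exact: f0.
Qed.

Lemma continuous_powR (a t : R) : 0 < t -> {for t, continuous (fun t => t `^ a)}.
Proof.
move=> t0; apply: differentiable_continuous; apply/derivable1_diffP.
by apply: derivable_powR; rewrite in_itv /= t0.
Qed.

Lemma regular_powR (a : R) : 0 <= a -> regular (fun t => t `^ a).
Proof.
rewrite le_eqVlt => /orP[/eqP <-|a0].
  rewrite (_ : (fun t => _) = (fun=> 1)); first exact: regular_cst.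
  by apply/funext => t; rewrite powRr0.
split=> [t t0|]; first exact: continuous_powR.
by rewrite powR0 ?gt_eqF //; exact: powR_cvg0.
Qed.

Lemma regular_ln f : (forall t, 0 <= t -> 0 < f t) -> regular f -> regular (fun t => ln (f t)).
Proof.
by move=> f0 hf; apply: regular_comp => // t t0; apply: continuous_ln; exact: f0.
Qed.

Lemma regular_sum n (F : nat -> R -> R) : (forall k, regular (F k)) ->
  regular (fun t => \sum_(0 <= k < n) F k t).
Proof.
move=> hF; elim: n => [|n IH].
  rewrite (_ : (fun t => _) = (fun=> 0)); first exact: regular_cst.
  by apply/funext => t; rewrite big_geq.
rewrite (_ : (fun t => _) = (fun t => \sum_(0 <= k < n) F k t + F n t)); first exact: regularD.
by apply/funext => t; rewrite big_nat_recr.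
Qed.

Lemma regular_within f : regular f -> {within `[0, 1], continuous f}.
Proof.
move=> [f1 f2]; apply/continuous_within_itvP => //; split=> //.
  by move=> t; rewrite in_itv /= => /andP[t0 _]; exact: f1.
by apply: cvg_at_left_filter; exact: f1.
Qed.

Lemma regular_integrable f : regular f ->
  (@lebesgue_measure R).-integrable `[0, 1] (EFin \o f).
Proof.
by move=> hf; apply: continuous_compact_integrable;
  [exact: segment_compact|exact: regular_within].
Qed.

Definition Int f : R := \int[lebesgue_measure]_(t in `[0, 1]) f t.

Lemma IntD f g : regular f -> regular g -> Int (fun t => f t + g t) = Int f + Int g.
Proof. by move=> hf hg; apply: RintegralD => //; exact: regular_integrable. Qed.

Lemma IntZ c f : regular f -> Int (fun t => c * f t) = c * Int f.
Proof. by move=> hf; apply: RintegralZl => //; exact: regular_integrable. Qed.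

Lemma Int_sum n (F : nat -> R -> R) : (forall k, regular (F k)) ->
  Int (fun t => \sum_(0 <= k < n) F k t) = \sum_(0 <= k < n) Int (F k).
Proof.
move=> hF; elim: n => [|n IH].
  rewrite big_geq // (_ : (fun t => _) = (fun=> 0)).
    by rewrite /Int Rintegral_cst // mul0r.
  by apply/funext => t; rewrite big_geq.
rewrite big_nat_recr //= -IH -IntD //; last exact: regular_sum.
by congr Int; apply/funext => t; rewrite big_nat_recr.
Qed.

Lemma eq_Int f g : (forall t, 0 <= t <= 1 -> f t = g t) -> Int f = Int g.
Proof.
by move=> e; apply: eq_Rintegral => t; rewrite inE /= in_itv /= => /e.
Qed.

Lemma Int_dist f g b : regular f -> regular g -> regular b ->
  (forall t, 0 <= t <= 1 -> `|f t - g t| <= b t) -> `|Int f - Int g| <= Int b.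
Proof.
move=> hf hg hb h; rewrite ler_norml; apply/andP; split.
  rewrite lerBrDl addrC -lerBrDl opprK addrC -IntD //.
  apply: le_Rintegral => //; [exact: regular_integrable| |].
    by apply: regular_integrable; exact: regularD.
  move=> t; rewrite /= in_itv /= => ht; have := h t ht; rewrite ler_norml; lra.
rewrite lerBlDr -IntD //; apply: le_Rintegral => //; [exact: regular_integrable| |].
  by apply: regular_integrable; exact: regularD.
move=> t; rewrite /= in_itv /= => ht; have := h t ht; rewrite ler_norml; lra.
Qed.

Lemma Int_FTC (f F : R -> R) : regular f -> regular F ->
  (forall t : R, 0 < t -> is_derive t 1 F (f t)) -> Int f = F 1 - F 0.
Proof.
move=> hf [F1 F2] dF; rewrite /Int /Rintegral (@continuous_FTC2 R f F 0 1) //.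
- exact: regular_within.
- split=> //.
    by move=> t; rewrite in_itv /= => /andP[t0 _]; case: (dF t t0).
  by apply: cvg_at_left_filter; exact: F1.
- by move=> t; rewrite in_itv /= => /andP[t0 _]; rewrite derive1E; case: (dF t t0).
Qed.

Lemma Int_powR (a : R) : 0 <= a -> Int (fun t => t `^ a) = (a + 1)^-1.
Proof.
move=> a0; have a1 : 0 < a + 1 by lra.
transitivity ((a + 1)^-1 * 1 `^ (a + 1) - (a + 1)^-1 * 0 `^ (a + 1)); last first.
  by rewrite powR1 powR0 ?gt_eqF // mulr1 mulr0 subr0.
apply: (@Int_FTC _ (fun t => (a + 1)^-1 * t `^ (a + 1))).
- exact: regular_powR.
- by apply: regularM; [exact: regular_cst|apply: regular_powR; exact: ltW].
- move=> t t0; have d := @is_derive1_powR R (a + 1) t t0.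
  have e : (a + 1)^-1 *: ((a + 1) * t `^ (a + 1 - 1)) = t `^ a.
    by rewrite addrK /GRing.scale /= mulrA mulVf ?mul1r // gt_eqF.
  by rewrite -e; exact: is_deriveZ.
Qed.

Lemma Int_cst (c : R) : Int (fun=> c) = c.
Proof.
transitivity (Int (fun t => c * t `^ 0)).
  by apply: eq_Int => t _; rewrite powRr0 mulr1.
by rewrite IntZ ?Int_powR ?add0r ?invr1 ?mulr1 //; exact: regular_powR.
Qed.

Lemma geometric_remainder (z : R) K : 0 <= z ->
  `|(1 + z)^-1 - \sum_(0 <= k < K) (-1) ^+ k * z ^+ k| <= z ^+ K.
Proof.
move=> z0; have z1 : 0 < 1 + z by lra.
have -> : (1 + z)^-1 - \sum_(0 <= k < K) (-1) ^+ k * z ^+ k = (-1) ^+ K * z ^+ K / (1 + z).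
  elim: K => [|K IH]; first by rewrite big_geq // !expr0 subr0 !mul1r.
  by rewrite big_nat_recr //= opprD addrA IH !exprS; field; lra.
rewrite normrM normfV (gtr0_norm z1) normrM !normrX normrN1 expr1n mul1r (ger0_norm z0).
by rewrite ler_pdivrMr // ler_peMr ?exprn_ge0 //; lra.
Qed.

(** [1 / (1 + t)] is expanded geometrically; cutting after [K] terms costs at most the integral of
    [t ^ (z + K)], that is [1 / (z + 1 + K)]. *)
Lemma Int_powR_div (z : R) : 0 < z -> Int (fun t => t `^ z / (1 + t)) = bet (z + 1).
Proof.
move=> z0; have z1 : 0 < z + 1 by lra.
have r1 : regular (fun t => t `^ z / (1 + t)).
  apply: regularM; first by apply: regular_powR; exact: ltW.
  apply: regularV; first by move=> t t0; rewrite gt_eqF //; lra.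
  by apply: regularD; [exact: regular_cst|exact: regular_id].
have zk (k : nat) : 0 <= z + k%:R by have := ler0n R k; lra.
have bnd K : `|Int (fun t => t `^ z / (1 + t)) - series (fun k => (-1) ^+ k * (z + 1 + k%:R)^-1) K|
    <= (z + 1 + K%:R)^-1.
  have -> : series (fun k => (-1) ^+ k * (z + 1 + k%:R)^-1) K =
      Int (fun t => \sum_(0 <= k < K) (-1) ^+ k * t `^ (z + k%:R)).
    rewrite Int_sum /series /=; last first.
      by move=> k; apply: regularM; [exact: regular_cst|exact: regular_powR].
    apply: eq_bigr => k _; rewrite IntZ; last exact: regular_powR.
    by rewrite Int_powR // addrAC.
  rewrite (_ : z + 1 + K%:R = z + K%:R + 1); last by ring.
  rewrite -Int_powR //; apply: Int_dist => //; [|exact: regular_powR|].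
    by apply: regular_sum => k; apply: regularM; [exact: regular_cst|exact: regular_powR].
  move=> t /andP[t0 t1].
  have pk (k : nat) : t `^ (z + k%:R) = t `^ z * t ^+ k.
    rewrite powRD ?powR_mulrn //; apply/implyP => /eqP e; exfalso.
    by have := ler0n R k; lra.
  have -> : \sum_(0 <= k < K) (-1) ^+ k * t `^ (z + k%:R) =
      t `^ z * \sum_(0 <= k < K) (-1) ^+ k * t ^+ k.
    by rewrite mulr_sumr; apply: eq_bigr => k _; rewrite pk; ring.
  rewrite -mulrBr normrM (ger0_norm (powR_ge0 _ _)) pk ler_wpM2l ?powR_ge0 //.
  exact: geometric_remainder.
have [hb _] := bet_series z1.
suff : series (fun k => (-1) ^+ k * (z + 1 + k%:R)^-1) @ \oo --> Int (fun t => t `^ z / (1 + t)).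
  by move=> h; exact: (cvg_unique _ h hb).
apply/cvgrPdist_le => e e0.
have /cvgrPdist_le /(_ e e0) := cvg_inv_shift z1.
apply: filterS => K; rewrite sub0r normrN => h.
by apply: le_trans (bnd K) _; exact: le_trans (ler_norm _) h.
Qed.

(** The bound holds uniformly up to [v = 1], which both the integration over the closed interval and
    the series for [ln 2] require. Writing [ln (1 + v)] as the integral of [v / (1 + v t)] keeps the
    interval fixed. *)
Lemma ln1D_series (v : R) N : 0 <= v <= 1 ->
  `|ln (1 + v) - \sum_(0 <= k < N) (-1) ^+ k * (v ^+ k.+1 / k.+1%:R)| <= N.+1%:R^-1.
Proof.
move=> /andP[v0 v1].
have p t : 0 <= t -> 0 < 1 + v * t by move=> t0; have := mulr_ge0 v0 t0; lra.
have r0 : regular (fun t => 1 + v * t).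
  apply: regularD; first exact: regular_cst.
  by apply: regularM; [exact: regular_cst|exact: regular_id].
have r1 : regular (fun t => v / (1 + v * t)).
  apply: regularM; first exact: regular_cst.
  by apply: regularV => // t t0; rewrite gt_eqF // p.
have -> : ln (1 + v) = Int (fun t => v / (1 + v * t)).
  transitivity (ln (1 + v * 1) - ln (1 + v * 0)).
    by rewrite mulr1 mulr0 addr0 ln1 subr0.
  apply/esym; apply: (@Int_FTC _ (fun t => ln (1 + v * t))) => //.
  - exact: regular_ln.
  - move=> t t0.
    have d1 : is_derive t 1 (fun t => 1 + v * t) v.
      have e : 0 + v *: (1 : R) = v by rewrite add0r /GRing.scale /= mulr1.
      by rewrite -[X in is_derive _ _ _ X]e; apply: is_deriveD; exact: is_deriveZ.
    have := @is_derive1_comp R (@ln R) (fun t => 1 + v * t) t _ _ (is_derive1_ln (p t (ltW t0))) d1.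
    by rewrite [_^-1 * v]mulrC.
have -> : \sum_(0 <= k < N) (-1) ^+ k * (v ^+ k.+1 / k.+1%:R) =
    Int (fun t => \sum_(0 <= k < N) ((-1) ^+ k * v ^+ k.+1) * t `^ k%:R).
  rewrite Int_sum; last by move=> k; apply: regularM; [exact: regular_cst|exact: regular_powR].
  apply: eq_bigr => k _; rewrite IntZ; last exact: regular_powR.
  by rewrite Int_powR // natr1 mulrA.
rewrite -natr1 -Int_powR //; apply: Int_dist => //; [|exact: regular_powR|].
  by apply: regular_sum => k; apply: regularM; [exact: regular_cst|exact: regular_powR].
move=> t /andP[t0 t1]; rewrite powR_mulrn //.
have -> : \sum_(0 <= k < N) ((-1) ^+ k * v ^+ k.+1) * t `^ k%:R =
    v * \sum_(0 <= k < N) (-1) ^+ k * (v * t) ^+ k.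
  rewrite mulr_sumr; apply: eq_bigr => k _; rewrite powR_mulrn // exprMn exprS; ring.
rewrite -mulrBr normrM (ger0_norm v0).
have vt : 0 <= v * t by rewrite mulr_ge0.
apply: (@le_trans _ _ (1 * (v * t) ^+ N)).
  by apply: ler_pM => //; exact: geometric_remainder.
by rewrite mul1r; apply: lerXn2r; rewrite ?nnegrE // ler_piMl.
Qed.

Lemma Jfun_series (x : R) : 0 < x ->
  series (fun k => (-1) ^+ k / k.+1%:R * bet (k.+1%:R * x + 1)) @ \oo --> Jfun x.
Proof.
move=> x0.
have d0 (t : R) : 0 <= t -> 0 < 1 + t by lra.
have rd : regular (fun t => (1 + t)^-1).
  apply: regularV; first by move=> t t0; rewrite gt_eqF // d0.
  by apply: regularD; [exact: regular_cst|exact: regular_id].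
have rl : regular (fun t => ln (1 + t `^ x)).
  apply: regular_ln; first by move=> t _; have := powR_ge0 t x; lra.
  by apply: regularD; [exact: regular_cst|apply: regular_powR; exact: ltW].
have kx (k : nat) : 0 < k.+1%:R * x by rewrite mulr_gt0.
have rk (k : nat) : regular (fun t => t `^ (k.+1%:R * x) / (1 + t)).
  by apply: regularM => //; apply: regular_powR; exact: ltW.
have rkc (k : nat) : regular (fun t => (-1) ^+ k / k.+1%:R * (t `^ (k.+1%:R * x) / (1 + t))).
  by apply: regularM => //; exact: regular_cst.
have bnd N : `|Jfun x - series (fun k => (-1) ^+ k / k.+1%:R * bet (k.+1%:R * x + 1)) N| <= N.+1%:R^-1.
  have -> : series (fun k => (-1) ^+ k / k.+1%:R * bet (k.+1%:R * x + 1)) N =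
     Int (fun t => \sum_(0 <= k < N) (-1) ^+ k / k.+1%:R * (t `^ (k.+1%:R * x) / (1 + t))).
    rewrite Int_sum // /series /=; apply: eq_bigr => k _.
    by rewrite IntZ // Int_powR_div.
  have -> : (N.+1%:R^-1 : R) = Int (fun=> N.+1%:R^-1).
    by rewrite Int_cst.
  apply: Int_dist; [exact: regularM|exact: regular_sum|exact: regular_cst|].
  move=> t /andP[t0 t1].
  have v0 := powR_ge0 t x.
  have v1 : t `^ x <= 1.
    have -> : 1 = 1 `^ x :> R by rewrite powR1.
    by apply: (ge0_ler_powR (ltW x0)); rewrite ?nnegrE.
  have -> : \sum_(0 <= k < N) (-1) ^+ k / k.+1%:R * (t `^ (k.+1%:R * x) / (1 + t)) =
     (\sum_(0 <= k < N) (-1) ^+ k * ((t `^ x) ^+ k.+1 / k.+1%:R)) / (1 + t).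
    rewrite mulr_suml; apply: eq_bigr => k _.
    by rewrite mulrC [k.+1%:R * x]mulrC powRrM powR_mulrn //; ring.
  rewrite -mulrBl normrM normfV (gtr0_norm (d0 t t0)) ler_pdivrMr ?d0 //.
  apply: le_trans (ln1D_series N _) _; first by rewrite v0.
  by rewrite ler_peMr ?invr_ge0 //; lra.
apply/cvgrPdist_le => e e0.
have /cvgrPdist_le /(_ e e0) := @cvg_harmonic R.
apply: filterS => N; rewrite sub0r normrN => h.
by apply: le_trans (bnd N) _; exact: le_trans (ler_norm _) h.
Qed.

Lemma ln2_series : series (fun k => (-1) ^+ k / k.+1%:R) @ \oo --> (ln 2 : R).
Proof.
apply/cvgrPdist_le => e e0.
have /cvgrPdist_le /(_ e e0) := @cvg_harmonic R.
apply: filterS => N; rewrite sub0r normrN => h.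
apply: le_trans (le_trans (ler_norm _) h); have := @ln1D_series 1 N; rewrite ler01 lexx => /(_ isT).
rewrite /series /= (_ : 1 + 1 = 2) //; congr (`|_ - _| <= _); apply: eq_bigr => k _.
by rewrite expr1n mul1r.
Qed.

End IntegralOnUnit.

(** * The reflection formula and the alternating sum [W] *)

Section Reflection.
Variable R : realType.

(* The double series for [Jfun] converges only conditionally; summed over squares it
   becomes symmetric under y -> 1/y. *)
Let T (y : R) (N : nat) : R := \sum_(0 <= m < N) \sum_(0 <= k < N)
  (-1) ^+ m / m.+1%:R * ((-1) ^+ k / (m.+1%:R * y + 1 + k%:R)).

(** Cutting the inner series of row [m] after [N] terms costs at most [1 / ((m + 1) (N + 1))]. The
    total is at most an arithmetic mean of the harmonic sequence, which tends to 0 by Cesaro. *)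
Lemma Jfun_square_sums (y : R) : 0 < y -> T y @ \oo --> Jfun y.
Proof.
move=> y0.
pose v := fun k => (-1) ^+ k / k.+1%:R * bet (k.+1%:R * y + 1).
have hv : series v @ \oo --> Jfun y by exact: Jfun_series.
have hm : @arithmetic_mean R harmonic @ \oo --> 0 by apply: cesaro; exact: cvg_harmonic.
have bnd N : `|series v N - T y N| <= arithmetic_mean (@harmonic R) N.
  rewrite /T /series /= -sumrB; apply: le_trans (ler_norm_sum _ _ _) _.
  apply: (@le_trans _ _ (\sum_(0 <= m < N) (N.+1%:R)^-1 * (m.+1%:R)^-1)); last first.
    rewrite /arithmetic_mean /= -mulr_sumr ler_wpM2l ?invr_ge0 // seriesSr lerDl.
    exact: harmonic_ge0.
  apply: ler_sum => m _; rewrite -mulr_sumr -mulrBr normrM normrM normrX normrN1 expr1n mul1r.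
  rewrite ger0_norm ?invr_ge0 // mulrC ler_wpM2r ?invr_ge0 //.
  have z0 : 0 < m.+1%:R * y + 1 by rewrite ltr_wpDl // mulr_ge0 // ltW.
  have [_ /(_ N)] := bet_series z0; rewrite /series /= => /le_trans; apply.
  have m0 : 0 <= m.+1%:R * y by rewrite mulr_ge0 // ltW.
  have e : N.+1%:R = N%:R + 1 :> R by rewrite natr1.
  by have N0 := ler0n R N; rewrite lef_pV2 ?posrE ?e //; lra.
suff h3 : series v N - (series v N - T y N) @[N --> \oo] --> Jfun y - 0.
  rewrite subr0 in h3; apply: cvg_trans h3; apply: near_eq_cvg; near=> N.
  by rewrite opprB addrC subrK.
apply: cvgB => //; apply/cvgrPdist_le => e e0.
have /cvgrPdist_le /(_ e e0) := hm; apply: filterS => N; rewrite !sub0r !normrN => h.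
by apply: le_trans (bnd N) _; exact: le_trans (ler_norm _) h.
Unshelve. all: by end_near. Qed.

(** With [a = m + 1], [b = k + 1]: [1 / (a (a y + b)) + 1 / (b (b / y + a)) = 1 / (a b)]. The square
    sums therefore add up to the square of a partial sum for [ln 2]. *)
Lemma Jfun_reflection (y : R) : 0 < y -> Jfun y + Jfun y^-1 = ln 2 ^+ 2.
Proof.
move=> y0; have yi : 0 < y^-1 by rewrite invr_gt0.
have h1 : T y N + T y^-1 N @[N --> \oo] --> Jfun y + Jfun y^-1.
  by apply: cvgD; exact: Jfun_square_sums.
have h2 : (fun N => series (fun k => (-1) ^+ k / k.+1%:R) N * series (fun k => (-1) ^+ k / k.+1%:R) N)
    @ \oo --> (ln 2 * ln 2 : R) by apply: cvgM; exact: ln2_series.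
rewrite expr2; apply: (cvg_unique _ h1) => //=.
apply: cvg_trans h2; apply: near_eq_cvg; near=> N.
rewrite /T /series /= [X in _ = _ + X]exchange_big /= -big_split /= mulr_suml.
apply: eq_bigr => m _; rewrite mulr_sumr -big_split /=; apply: eq_bigr => k _.
have m1 : m.+1%:R = m%:R + 1 :> R by rewrite natr1.
have k1 : k.+1%:R = k%:R + 1 :> R by rewrite natr1.
rewrite m1 k1; have := ler0n R m; have := ler0n R k; move: (m%:R : R) (k%:R : R) => M K K0 M0.
have p1 : 0 <= M * y by rewrite mulr_ge0 // ltW.
have p2 : 0 <= K * y by rewrite mulr_ge0 // ltW.
by field; do ?[apply/andP; split]; rewrite gt_eqF //; nra.
Unshelve. all: by end_near. Qed.

Definition Wsum (y : R) : R := limn (series (fun k => (-1) ^+ k / k.+1%:R * bet (k.+1%:R * y))).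

(** From [bet z = 1 / z - bet (z + 1)] and the alternating sum of [1 / k ^ 2]. *)
Lemma Wsum_cvg (y : R) : 0 < y ->
  series (fun k => (-1) ^+ k / k.+1%:R * bet (k.+1%:R * y)) @ \oo --> Wsum y /\
  Wsum y = pi ^+ 2 / 12 / y - Jfun y.
Proof.
move=> y0.
have h : series (fun k => (-1) ^+ k / k.+1%:R * bet (k.+1%:R * y)) @ \oo --> pi ^+ 2 / 12 / y - Jfun y.
  have -> : series (fun k => (-1) ^+ k / k.+1%:R * bet (k.+1%:R * y)) =
     (fun N => series (fun k => (-1) ^+ k * (k.+1%:R ^+ 2)^-1) N / y
        - series (fun k => (-1) ^+ k / k.+1%:R * bet (k.+1%:R * y + 1)) N).
    apply/funext => N; rewrite /series /= mulr_suml -sumrB; apply: eq_bigr => k _.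
    rewrite (@bet_shift R (k.+1%:R * y) 1); last by rewrite mulr_gt0.
    rewrite big_nat1 expr0 expr1 mulN1r addr0.
    by field; rewrite ?pnatr_eq0 ?gt_eqF.
  apply: cvgB; last exact: Jfun_series.
  by apply: cvgM; [exact: alternating_basel|exact: cvg_cst].
have e : Wsum y = pi ^+ 2 / 12 / y - Jfun y by apply/cvg_lim.
by rewrite e.
Qed.

Lemma Wsum_diff (x : R) : 0 < x ->
  Wsum x - Wsum x^-1 = ln 2 ^+ 2 - 2 * Jfun x - pi ^+ 2 / 12 * (x - x^-1).
Proof.
move=> x0; have [_ ->] := Wsum_cvg x0.
have xi : 0 < x^-1 by rewrite invr_gt0.
have [_ ->] := Wsum_cvg xi; rewrite -(Jfun_reflection x0) invrK.
by move: (Jfun x) (Jfun x^-1) => j j'; ring.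
Qed.

End Reflection.

(** * Lattice sums over sectors *)

Section LatticeSums.
Variable R : realType.

Lemma finite_series_cvg (u : R ^nat) N : (forall m, (N <= m)%N -> u m = 0) ->
  series u @ \oo --> \sum_(0 <= m < N) u m.
Proof.
move=> hu.
have hc : (fun=> \sum_(0 <= m < N) u m) @ \oo --> \sum_(0 <= m < N) u m by exact: cvg_cst.
apply: cvg_trans hc; apply: near_eq_cvg.
exists N => // n /= Nn; rewrite /series /= [RHS](big_cat_nat (n := N)) //=.
rewrite [X in _ = _ + X]big1_seq ?addr0 // => m /andP[_].
by rewrite mem_index_iota => /andP[Nm _]; exact: hu.
Qed.

(** Pairing consecutive terms leaves [M] differences. *)
Lemma alt_even_bound (b : R ^nat) (M : nat) (d : R) :
  (forall m, (m.+1 < 2 * M)%N -> `|b m - b m.+1| <= d) ->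
  `|\sum_(0 <= m < 2 * M) (-1) ^+ m * b m| <= M%:R * d.
Proof.
elim: M => [|M IH] hb; first by rewrite muln0 big_geq // normr0 mul0r.
have s1 : (-1) ^+ (2 * M) = 1 :> R by rewrite exprM sqrrN !expr1n.
rewrite mulnS add2n !big_nat_recr //= exprS s1.
have h1 := IH (fun m hm => hb m ltac:(lia)); have h2 := hb (2 * M)%N ltac:(lia).
have e : M.+1%:R = M%:R + 1 :> R by rewrite natr1.
by move: h1 h2; rewrite e !ler_norml; lra.
Qed.

Lemma esum_sector (phi : R -> R) (h : nat) s : cvgn (series (sector_term phi h s)) ->
  \esum_(p in [set p : nat * nat | (p.2 < h * p.1.+1)%N])
    ((p.1.+1%:R ^+ 2 * phi (p.2%:R / p.1.+1%:R)) `^ (- s))%:E =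
  (limn (series (sector_term phi h s)))%:E.
Proof.
move=> cS; pose H q m : R := if (m < h * q.+1)%N
  then (q.+1%:R ^+ 2 * phi (m%:R / q.+1%:R)) `^ (- s) else 0.
rewrite -(@esum_rows R H) //.
- rewrite esum_mkcond; apply: eq_esum => p _; rewrite /H.
  by case: ifPn; [rewrite inE /= => ->|rewrite notin_setE /= => /negP/negbTE ->].
- by move=> q m; rewrite /H; case: ifP => // _; exact: powR_ge0.
- move=> q.
  have := @finite_series_cvg (H q) (h * q.+1)%N.
  have -> : \sum_(0 <= m < h * q.+1) H q m = sector_term phi h s q.
    rewrite /sector_term big_seq [RHS]big_seq; apply: eq_bigr => m.
    by rewrite mem_index_iota /H => /andP[_ ->].
  by apply=> m hm; rewrite /H ltnNge hm.
Qed.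

Lemma natpow2_le s (k : nat) : 1 <= s -> (k.+1%:R ^+ 2) `^ (- s) <= (k.+1%:R ^+ 2)^-1 :> R.
Proof.
move=> s1; rewrite -[leRHS]powR_inv1 ?sqr_ge0 //; apply: ler_powR; last by lra.
by rewrite -natrX ler1n.
Qed.

(** * The case [n ^ 2 + 1]: rows of finite length *)

Section PlusCase.
Variables (n : nat) (x : R).
Hypothesis n0 : (0 < n)%N.
Hypothesis x1 : 1 < x.
Hypothesis hx : x - x^-1 = 2 * n%:R.

Let f (k m : nat) : R := k.+1%:R ^+ 2 + 2 * n%:R * m%:R * k.+1%:R - m%:R ^+ 2.
Let phi (t : R) : R := 1 + 2 * n%:R * t - t ^+ 2.
Let h : nat := (2 * n)%N.

Let hR : h%:R = 2 * n%:R :> R. Proof. by rewrite /h natrM. Qed.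
Let nR : 1 <= n%:R :> R. Proof. by rewrite ler1n. Qed.
Let x0 : 0 < x. Proof. by have := x1; lra. Qed.
Let xi : 0 < x^-1. Proof. by rewrite invr_gt0. Qed.
Let xix : x * x^-1 = 1. Proof. by rewrite divff // gt_eqF. Qed.

Let fE k m : f k m = k.+1%:R ^+ 2 * phi (m%:R / k.+1%:R).
Proof. by rewrite /f /phi; have : k.+1%:R != 0 :> R by []; move=> ?; field. Qed.

Let phi_bnd t : 0 <= t <= h%:R -> 1 <= phi t <= 1 + (2 * n%:R) ^+ 2.
Proof.
rewrite hR => /andP[t0 t1]; rewrite /phi.
have : 0 <= t * (2 * n%:R - t) by rewrite mulr_ge0 //; lra.
have : t * (2 * n%:R) <= 2 * n%:R * (2 * n%:R) by rewrite ler_wpM2r //; have := nR; lra.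
by have := sqr_ge0 t; lra.
Qed.

Let phi_lip t t' : 0 <= t <= h%:R -> 0 <= t' <= h%:R ->
  `|phi t - phi t'| <= (2 * n%:R) * `|t - t'|.
Proof.
rewrite hR => /andP[a1 a2] /andP[b1 b2].
have -> : phi t - phi t' = (2 * n%:R - (t + t')) * (t - t') by rewrite /phi; ring.
by rewrite normrM ler_wpM2r // ler_norml; lra.
Qed.

Let La0 : 0 <= 2 * n%:R :> R. Proof. by have := nR; lra. Qed.

(** The row has [2 n (k + 1)] terms, an even number, hence [n (k + 1)] pairs, each of size
    [O(1 / (k + 1))] before the factor [(k + 1) ^ (- 2 s)]. Without signs the row would only be of
    order [1 / (k + 1)] at [s = 1], which is not summable. *)
Lemma plus_alternating_bound s k : 1 <= s <= 2 ->
  `|\sum_(0 <= m < h * k.+1) (-1) ^+ m * f k m `^ (- s)| <=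
  (4 * n%:R ^+ 2) * (k.+1%:R ^+ 2)^-1.
Proof.
move=> hs; have k0 : 0 < k.+1%:R :> R by [].
have pw m : (m < h * k.+1)%N -> f k m `^ (- s) =
    (k.+1%:R ^+ 2) `^ (- s) * phi (m%:R / k.+1%:R) `^ (- s).
  move=> hm; rewrite fE powRM ?sqr_ge0 //.
  by have /andP[] := phi_bnd (sector_argument _ hm); lra.
have -> : \sum_(0 <= m < h * k.+1) (-1) ^+ m * f k m `^ (- s) =
   (k.+1%:R ^+ 2) `^ (- s) * \sum_(0 <= m < 2 * (n * k.+1)) (-1) ^+ m * phi (m%:R / k.+1%:R) `^ (- s).
  rewrite mulnA -/h mulr_sumr big_seq [RHS]big_seq; apply: eq_bigr => m.
  by rewrite mem_index_iota => /andP[_ hm]; rewrite pw //; ring.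
rewrite normrM (ger0_norm (powR_ge0 _ _)) mulrC; apply: ler_pM => //; last first.
  by apply: natpow2_le; lra.
have := @alt_even_bound (fun m => phi (m%:R / k.+1%:R) `^ (- s)) (n * k.+1)
  (2 * (2 * n%:R / k.+1%:R)).
have -> : (n * k.+1)%:R * (2 * (2 * n%:R / k.+1%:R)) = 4 * n%:R ^+ 2 :> R.
  by rewrite natrM; field; rewrite gt_eqF.
apply=> m; rewrite mulnA -/h => hm.
have r1 := @sector_argument R h k m (ltnW hm); have r2 := @sector_argument R h k m.+1 hm.
have /andP[p1 _] := phi_bnd r1; have /andP[p2 _] := phi_bnd r2.
apply: le_trans (powRN_lipschitz p1 p2 hs) _; rewrite ler_wpM2l //.
apply: le_trans (phi_lip r1 r2) _.
have -> : m.+1%:R = m%:R + 1 :> R by rewrite natr1.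
rewrite -mulrBl opprD addrA subrr add0r normrM normrN1 mul1r gtr0_norm ?invr_gt0 //.
Qed.

Let I1 : R := (ln (1 + h%:R * x) - ln (1 + h%:R * - x^-1)) / (x - - x^-1).

(** [1 + 2 n x = x ^ 2] and [1 - 2 n / x = x ^ (- 2)]; the residue is thus the logarithm of the unit
    [x ^ 2]. *)
Let I1_value : ((x + x^-1) ^+ 2) `^ 2^-1 * I1 / 2 = ln (x ^+ 2).
Proof.
have s0 : 0 < x + x^-1 by rewrite addr_gt0.
rewrite powR12_sqrt ?sqr_ge0 // sqrtr_sqr gtr0_norm // /I1 hR -hx.
have -> : 1 + (x - x^-1) * x = x ^+ 2 by rewrite mulrBl mulVf ?gt_eqF //; ring.
have -> : 1 + (x - x^-1) * - x^-1 = (x ^+ 2)^-1 by field; rewrite gt_eqF.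
rewrite opprK lnV ?posrE ?exprn_gt0 //; field.
by apply/andP; split; rewrite gt_eqF //; nra.
Qed.

Let I1_bound : exists C1, forall q, (0 < q)%N ->
  `|rsum (fun t => (phi t)^-1) h q - q%:R * I1| <= C1.
Proof.
have [||t|C hC] := @rsum_inv_quadratic R x (- x^-1) (x ^+ 2)^-1 h.
- by apply: (@lt_trans _ _ 0) => //; rewrite oppr_lt0.
- by rewrite invr_gt0 exprn_gt0.
- rewrite hR -hx => /andP[t0 t1]; have e : (x ^+ 2)^-1 = x^-1 * x^-1 by rewrite expr2 invfM.
  have xi1 : x^-1 <= 1 by rewrite invf_le1 // ltW.
  have q1 : x^-1 * x^-1 <= 1 by have := xi; nra.
  have q2 : t * x^-1 <= (x - x^-1) * x^-1 by rewrite ler_pM2r.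
  rewrite e mulrN; have := mulr_ge0 t0 (ltW x0); have := xix; move: q1 q2; rewrite mulrBl.
  by move: (x^-1 * x^-1) (t * x^-1) (x * x^-1) (t * x) => *; split; lra.
exists C => q q0; have := hC q q0; congr (`|_ - _| <= _); apply: eq_bigr => m _; congr (_^-1).
rewrite /phi -hx; move: (m%:R / q%:R) => t.
by have := xix => e; transitivity (1 + (x - x^-1) * t - t ^+ 2 * (x * x^-1)); [ring|rewrite e; ring].
Qed.

(** [f = (q / x + m) (q x - m)] splits into partial fractions. As [q / x + 2 n q = q x], the finite
    sum of the first kind is exactly a difference of two values of [bet]. *)
Lemma plus_inner_value k : (x + x^-1) * \sum_(0 <= m < h * k.+1) (-1) ^+ m * f k m `^ (-1) =
  (k.+1%:R)^-1 * (2 * (bet (k.+1%:R * x^-1) - bet (k.+1%:R * x)) - (x - x^-1) / k.+1%:R).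
Proof.
set q : R := k.+1%:R; have q0 : 0 < q by rewrite /q.
have qx0 : 0 < q * x^-1 by rewrite mulr_gt0.
pose N := (h * k.+1)%N.
have NR : N%:R = q * (x - x^-1) by rewrite /N natrM hR hx mulrC.
have sN : (-1) ^+ N = 1 :> R by rewrite /N /h -mulnA exprM sqrrN !expr1n.
have b := @bet_shift R (q * x^-1) N qx0; rewrite sN mul1r NR in b.
rewrite (_ : q * x^-1 + q * (x - x^-1) = q * x) in b; last by ring.
have s1 : \sum_(0 <= m < N) (-1) ^+ m / (q * x^-1 + m%:R) = bet (q * x^-1) - bet (q * x).
  by rewrite b; ring.
(* Reversing the order turns [q x - m] into [q / x + m + 1]; the shift by one leaves the boundary
   terms [x / q] and [1 / (q x)]. *)
have s2 : \sum_(0 <= m < N) (-1) ^+ m / (q * x - m%:R) =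
    bet (q * x^-1) - bet (q * x) - (x - x^-1) / q.
  rewrite big_nat_rev /= add0n.
  have -> : \sum_(0 <= m < N) (-1) ^+ (N - m.+1) / (q * x - (N - m.+1)%:R) =
      \sum_(0 <= m < N) - ((-1) ^+ m / (q * x^-1 + m.+1%:R)).
    rewrite big_seq [RHS]big_seq; apply: eq_bigr => m; rewrite mem_index_iota => /andP[_ hm].
    have -> : (-1) ^+ (N - m.+1) = - (-1) ^+ m :> R.
      have : (-1) ^+ (N - m.+1) * (-1) ^+ m.+1 = 1 :> R by rewrite -exprD subnK.
      move/(congr1 (fun z => z * (-1) ^+ m.+1)); rewrite -mulrA -exprD addnn -mul2n exprM sqrrN !expr1n mulr1 mul1r => ->.
      by rewrite exprS mulN1r.
    rewrite natrB // NR mulNr; congr (- (_ / _)); ring.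
  have b1 := @bet_shift R (q * x^-1) N.+1 qx0; rewrite big_nat_recl // expr0 addr0 exprS sN mulr1 mulN1r in b1.
  have e1 : \sum_(0 <= i < N) (-1) ^+ i.+1 / (q * x^-1 + i.+1%:R) =
      \sum_(0 <= m < N) - ((-1) ^+ m / (q * x^-1 + m.+1%:R)).
    by apply: eq_bigr => m _; rewrite exprS mulN1r mulNr.
  rewrite e1 (_ : q * x^-1 + N.+1%:R = q * x + 1) in b1; last first.
    by rewrite -natr1 NR; ring.
  have qxp : 0 < q * x by rewrite mulr_gt0.
  have b2 := @bet_shift R (q * x) 1 qxp; rewrite big_nat1 expr0 expr1 mulN1r addr0 in b2.
  have e2 : (q * x^-1)^-1 = x / q by field; rewrite !gt_eqF.
  have e3 : 1 / (q * x) = x^-1 / q by field; rewrite !gt_eqF.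
  rewrite div1r e2 in b1; rewrite e3 in b2.
  move: b1 b2; set S := \sum_(0 <= m < N) _ => b1 b2.
  by rewrite b1 b2; ring.
rewrite mulr_sumr.
transitivity (\sum_(0 <= m < N) q^-1 * ((-1) ^+ m / (q * x^-1 + m%:R) + (-1) ^+ m / (q * x - m%:R))); last first.
  by rewrite -mulr_sumr big_split /= s1 s2; congr (_ * _); ring.
rewrite big_seq [RHS]big_seq; apply: eq_bigr => m; rewrite mem_index_iota => /andP[_ hm].
have hmR : m%:R <= q * (x - x^-1) by rewrite -NR ler_nat ltnW.
have m0 := ler0n R m.
have a1 : 0 < q * x^-1 + m%:R by lra.
have a2 : 0 < q * x - m%:R by lra.
have ef : f k m = (q * x^-1 + m%:R) * (q * x - m%:R).
  rewrite /f -/q -hx.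
  transitivity (q ^+ 2 * (x * x^-1) + (x - x^-1) * m%:R * q - m%:R ^+ 2); last by ring.
  by rewrite xix mulr1.
rewrite powR_inv1; last by rewrite ef mulr_ge0 // ltW.
rewrite ef; have a3 : 0 < q + m%:R * x by rewrite ltr_wpDr // mulr_ge0 // ltW.
by clearbody q; field; rewrite !gt_eqF.
Qed.

(** [Z0] and [Z1] both blow up at [s = 1], but [2 * Z1 - Z0] is a series of alternating rows,
    dominated uniformly in [s]; its limit is the sum of the rows evaluated at [s = 1]. *)
Lemma plus_lattice_sums : exists (Z0 Z1 : R -> R) (r0 A1 : R),
  [/\ forall s, 1 < s <= 2 ->
        \esum_(p in [set p : nat * nat | (p.2 < h * p.1.+1)%N]) (f p.1 p.2 `^ (- s))%:E = (Z0 s)%:E /\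
        \esum_(p in [set p : nat * nat | (p.2 < h * p.1.+1)%N && (odd p.1 != odd p.2)])
          (f p.1 p.2 `^ (- s))%:E = (Z1 s)%:E,
      ((x + x^-1) ^+ 2) `^ (s / 2) * Z0 s - ln (x ^+ 2) / (s - 1) @[s --> (1 : R)^'+] --> r0,
      2 * Z1 s - Z0 s @[s --> (1 : R)^'+] --> A1 &
      (x + x^-1) * A1 = 2 * (Wsum x - Wsum x^-1) + (x - x^-1) * (pi ^+ 2 / 12)].
Proof.
have D0 : 0 < (x + x^-1) ^+ 2 by rewrite exprn_gt0 // addr_gt0.
have [C1 hI1] := I1_bound.
have [cS [r0 hr0]] := sector_asymptotics La0 phi_bnd phi_lip D0 hI1.
rewrite I1_value in hr0.
pose Z0 s := limn (series (sector_term phi h s)).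
have eZ0 s : 1 < s <= 2 ->
    \esum_(p in [set p : nat * nat | (p.2 < h * p.1.+1)%N]) (f p.1 p.2 `^ (- s))%:E = (Z0 s)%:E.
  move=> hs; rewrite -esum_sector; last exact: cS.
  by apply: eq_esum => p _; rewrite fE.
pose a s k := \sum_(0 <= m < h * k.+1) (-1) ^+ m * f k m `^ (- s).
have /choice [Z1 hZ1] : forall s, exists z : R, 1 < s <= 2 ->
    \esum_(p in [set p : nat * nat | (p.2 < h * p.1.+1)%N && (odd p.1 != odd p.2)])
          (f p.1 p.2 `^ (- s))%:E = z%:E /\
    2 * z - Z0 s = - limn (series (fun k => (-1) ^+ k * a s k)).
  move=> s; have [hs|hs] := boolP (1 < s <= 2); last by exists 0.
  pose G q m : R := if (m < h * q.+1)%N then f q m `^ (- s) else 0.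
  have G0 q m : 0 <= G q m by rewrite /G; case: ifP => // _; exact: powR_ge0.
  have eG : \esum_(p in [set: nat * nat]) (G p.1 p.2)%:E = (Z0 s)%:E.
    rewrite -eZ0 // [RHS]esum_mkcond; apply: eq_esum => p _; rewrite /G.
    by case: (boolP (p \in _)); [rewrite inE /= => ->|rewrite notin_setE /= => /negP/negbTE ->].
  have [z e1 e2] := esum_alternating G0 eG.
  exists z => _; split.
    rewrite -e1.
    have -> : [set p : nat * nat | (p.2 < h * p.1.+1)%N && (odd p.1 != odd p.2)] =
        [set p | odd p.1 != odd p.2] `&` [set p | (p.2 < h * p.1.+1)%N].
      by apply/seteqP; split=> p /=; [move=> /andP[? ?]|move=> [? ?]; apply/andP].
    rewrite esum_mkcondr; apply: eq_esum => p _; rewrite /G.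
    by case: (boolP (p \in _)); [rewrite inE /= => ->|rewrite notin_setE /= => /negP/negbTE ->].
  rewrite e2; congr (- limn (series _)); apply/funext => k; congr (_ * _).
  apply/cvg_lim => //.
  have := @finite_series_cvg (fun m => (-1) ^+ m * G k m) (h * k.+1)%N.
  have -> : \sum_(0 <= m < h * k.+1) (-1) ^+ m * G k m = a s k.
    rewrite /a big_seq [RHS]big_seq; apply: eq_bigr => m.
    by rewrite mem_index_iota /G => /andP[_ ->].
  by apply=> m hm; rewrite /G ltnNge hm /= mulr0.
have cM : cvgn (series (fun k => (4 * n%:R ^+ 2) * ((k.+1%:R : R) ^+ 2)^-1)).
  by apply: series_mull_cvg; exact: inv_sqr_series_cvg.
have hb : \forall s \near (1 : R)^'+, forall k,
    `|(-1) ^+ k * a s k| <= (4 * n%:R ^+ 2) * ((k.+1%:R : R) ^+ 2)^-1.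
  near=> s => k; rewrite normrM normrX normrN1 expr1n mul1r; apply: plus_alternating_bound.
  apply/andP; split; first by near: s; exact: nbhs_right_ge.
  by near: s; apply: nbhs_right_ltW; lra.
have hl k : (-1) ^+ k * a s k @[s --> (1 : R)^'+] --> (-1) ^+ k * a 1 k.
  apply: cvgM; first exact: cvg_cst.
  have := @cvg_series_fun R (1 : R)^'+ _
    (fun s m => if (m < h * k.+1)%N then (-1) ^+ m * f k m `^ (- s) else 0)
    (fun m => if (m < h * k.+1)%N then (-1) ^+ m * f k m `^ (- 1) else 0) (h * k.+1)%N.
  have e s : series (fun m => if (m < h * k.+1)%N then (-1) ^+ m * f k m `^ (- s) else 0) (h * k.+1)%N = a s k.
    rewrite /series /a /= big_seq [RHS]big_seq; apply: eq_bigr => m.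
    by rewrite mem_index_iota => /andP[_ ->].
  rewrite e; under eq_fun do rewrite e; apply => m; case: ifP => hm; last exact: cvg_cst.
  apply: cvgM; first exact: cvg_cst.
  apply: powR_cvg; last by apply: cvgN; exact: cvg_at1.
  rewrite fE mulr_gt0 ?exprn_gt0 //.
  by have /andP[] := phi_bnd (sector_argument _ hm); lra.
have [_ hA] := tannery cM hb hl.
exists Z0, Z1, r0, (- limn (series (fun k => (-1) ^+ k * a 1 k))); split.
- by move=> s hs; split; [exact: eZ0|case: (hZ1 s hs)].
- exact: hr0.
- have hA' : - limn (series (fun k => (-1) ^+ k * a s k)) @[s --> (1 : R)^'+] -->
      - limn (series (fun k => (-1) ^+ k * a 1 k)) by apply: cvgN.
  apply: cvg_trans hA'; apply: near_eq_cvg; near=> s.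
  have hs : 1 < s <= 2.
    apply/andP; split; first by near: s; exact: nbhs_right_gt.
    by near: s; apply: nbhs_right_ltW; lra.
  by have [_ ->] := hZ1 s hs.
- have [w1 _] := Wsum_cvg x0; have [w2 _] := Wsum_cvg xi.
  have lim : series (fun k => (-1) ^+ k * a 1 k) @ \oo --> (x + x^-1)^-1 *
     (2 * (Wsum x^-1 - Wsum x) - (x - x^-1) * (pi ^+ 2 / 12)).
    have -> : series (fun k => (-1) ^+ k * a 1 k) = (fun N => (x + x^-1)^-1 *
      (2 * (series (fun k => (-1) ^+ k / k.+1%:R * bet (k.+1%:R * x^-1)) N
         - series (fun k => (-1) ^+ k / k.+1%:R * bet (k.+1%:R * x)) N)
         - (x - x^-1) * series (fun k => (-1) ^+ k * (k.+1%:R ^+ 2)^-1) N)).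
      apply/funext => N; rewrite /series /= -sumrB !mulr_sumr -sumrB mulr_sumr.
      apply: eq_bigr => k _; have s0 : 0 < x + x^-1 by rewrite addr_gt0.
      have e := plus_inner_value k; rewrite -/(a 1 k) in e.
      have -> : a 1 k = (x + x^-1)^-1 * ((x + x^-1) * a 1 k) by rewrite mulrA mulVf ?mul1r // gt_eqF.
      rewrite e; have : k.+1%:R != 0 :> R by [].
      move: (bet (k.+1%:R * x^-1)) (bet (k.+1%:R * x)) (k.+1%:R : R) ((-1) ^+ k : R) ((x + x^-1)^-1) => b1 b2 q sg i q0.
      by field; rewrite q0 (gt_eqF x0).
    apply: cvgM; first exact: cvg_cst.
    apply: cvgB.
      by apply: cvgM; [exact: cvg_cst|exact: cvgB].
    by apply: cvgM; [exact: cvg_cst|exact: alternating_basel].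
  have s0 : x + x^-1 != 0 by rewrite gt_eqF // addr_gt0.
  rewrite (cvg_lim _ lim) // mulrN (mulrA (x + x^-1)) (mulfV s0) mul1r.
  by move: (Wsum x) (Wsum x^-1) (x^-1) (pi : R) => w w' y p; field.
Unshelve. all: by end_near. Qed.

End PlusCase.
End LatticeSums.

(** * The case [n ^ 2 - 1]: the whole quadrant *)

Section MinusCase.
Variables (R : realType) (n : nat) (x : R).
Hypothesis n0 : (0 < n)%N.
Hypothesis x1 : 1 < x.
Hypothesis hx : x + x^-1 = 2 * n%:R.

Let f (k m : nat) : R := k.+1%:R ^+ 2 + 2 * n%:R * m%:R * k.+1%:R + m%:R ^+ 2.
Let phi (t : R) : R := 1 + 2 * n%:R * t + t ^+ 2.

Let nR : 1 <= n%:R :> R. Proof. by rewrite ler1n. Qed.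
Let x0 : 0 < x. Proof. by have := x1; lra. Qed.
Let xi : 0 < x^-1. Proof. by rewrite invr_gt0. Qed.
Let xi1 : x^-1 < 1. Proof. by rewrite invf_lt1. Qed.
Let xix : x * x^-1 = 1. Proof. by rewrite divff // gt_eqF. Qed.
Let xx0 : 0 < x - x^-1. Proof. by rewrite subr_gt0; exact: lt_trans xi1 x1. Qed.

Let fE k m : f k m = k.+1%:R ^+ 2 * phi (m%:R / k.+1%:R).
Proof. by rewrite /f /phi; have : k.+1%:R != 0 :> R by []; move=> ?; field. Qed.

Let f_factor k m : f k m = (k.+1%:R * x^-1 + m%:R) * (k.+1%:R * x + m%:R).
Proof.
rewrite /f -hx; move: (k.+1%:R : R) (m%:R : R) => q y.
transitivity (q ^+ 2 * (x * x^-1) + (x + x^-1) * y * q + y ^+ 2); last by ring.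
by rewrite xix mulr1.
Qed.

(** Rows are infinite here, and this bound dominates each of them for all [s >= 1]. *)
Let f_ge k m : (m.+1%:R : R) ^+ 2 <= f k m.
Proof.
rewrite /f; have -> : m.+1%:R = m%:R + 1 :> R by rewrite natr1.
have q1 : 1 <= k.+1%:R :> R by rewrite ler1n.
have m0 := ler0n R m; move: q1 m0 (nR); move: (k.+1%:R : R) (m%:R : R) (n%:R : R) => q y z q1 y0 z1.
have : 0 <= y * (z * q - 1) by rewrite mulr_ge0 // subr_ge0; nra.
by nra.
Qed.

Let f_ge1 k m : 1 <= f k m.
Proof. by apply: le_trans (f_ge k m); rewrite -natrX ler1n. Qed.

Let f_mono k m : f k m <= f k m.+1.
Proof.
rewrite /f; have -> : m.+1%:R = m%:R + 1 :> R by rewrite natr1.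
have q1 : 1 <= k.+1%:R :> R by rewrite ler1n.
have m0 := ler0n R m; move: q1 m0 (nR); move: (k.+1%:R : R) (m%:R : R) (n%:R : R) => q y z q1 y0 z1.
have zq : 0 <= z * q by rewrite mulr_ge0 //; lra.
by nra.
Qed.

Let fs_le s k m : 1 <= s -> f k m `^ (- s) <= (m.+1%:R ^+ 2)^-1.
Proof.
move=> s1; have f1 := f_ge1 k m.
apply: (@le_trans _ _ (f k m)^-1).
  by rewrite -[leRHS]powR_inv1 ?(le_trans _ f1) //; apply: ler_powR => //; lra.
by rewrite lef_pV2 ?posrE ?exprn_gt0 ?(lt_le_trans _ f1).
Qed.

Let L s k := limn (series (fun m => (-1) ^+ m * f k m `^ (- s))).

Let inv_sqr_cvg0 : ((m.+1%:R : R) ^+ 2)^-1 @[m --> \oo] --> 0.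
Proof. exact: (cvg_series_cvg_0 (@inv_sqr_series_cvg R)). Qed.

(** [f k m] increases with [m], so by Leibniz the alternating row is bounded by its first term
    [(k + 1) ^ (- 2 s)]. *)
Let alt_f s k : 1 <= s ->
  cvgn (series (fun m => (-1) ^+ m * f k m `^ (- s))) /\ `|L s k| <= (k.+1%:R ^+ 2)^-1.
Proof.
move=> s1.
have [|||c b] := @alt_series R (fun m => f k m `^ (- s)).
- by move=> m; exact: powR_ge0.
- move=> m; rewrite !powRN lef_pV2 ?posrE ?powR_gt0 ?(lt_le_trans _ (f_ge1 _ _)) //.
  have fn j : f k j \is Num.nneg by rewrite nnegrE (le_trans _ (f_ge1 _ _)).
  by apply: (ge0_ler_powR _ (fn _) (fn _) (f_mono _ _)); exact: le_trans s1.
- apply: (@squeeze_cvgr _ _ _ _ (fun=> 0) (fun m => (m.+1%:R ^+ 2)^-1)).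
  + by near=> m; rewrite powR_ge0 fs_le.
  + exact: cvg_cst.
  + exact: inv_sqr_cvg0.
- split=> //; have := b 0%N; rewrite {2}/series /= big_geq // subr0 => /le_trans; apply.
  by rewrite /f !(mulr0, mul0r, addr0) expr0n addr0; exact: natpow2_le.
Unshelve. all: by end_near. Qed.

Let L_cvg k : L s k @[s --> (1 : R)^'+] --> L 1 k.
Proof.
have hb : \forall s \near (1 : R)^'+, forall m,
    `|(-1) ^+ m * f k m `^ (- s)| <= ((m.+1%:R : R) ^+ 2)^-1.
  near=> s => m; rewrite normrM normrX normrN1 expr1n mul1r ger0_norm ?powR_ge0 //.
  by apply: fs_le; near: s; exact: nbhs_right_ge.
have hl m : (-1) ^+ m * f k m `^ (- s) @[s --> (1 : R)^'+] --> (-1) ^+ m * f k m `^ (- 1).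
  apply: cvgM; first exact: cvg_cst.
  apply: powR_cvg; first by apply: lt_le_trans (f_ge1 k m).
  by apply: cvgN; exact: cvg_at1.
by have [] := tannery (@inv_sqr_series_cvg R) hb hl.
Unshelve. all: by end_near. Qed.

Let L_value k : L 1 k = (x - x^-1)^-1 * (k.+1%:R)^-1 *
  (bet (k.+1%:R * x^-1) - bet (k.+1%:R * x)).
Proof.
have q0 : 0 < k.+1%:R :> R by [].
have p1 : 0 < k.+1%:R * x^-1 by rewrite mulr_gt0.
have p2 : 0 < k.+1%:R * x by rewrite mulr_gt0.
have [b1 _] := bet_series p1; have [b2 _] := bet_series p2.
apply/cvg_lim => //.
have -> : series (fun m => (-1) ^+ m * f k m `^ (- 1)) = (fun N => (x - x^-1)^-1 * (k.+1%:R)^-1 *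
   (series (fun m => (-1) ^+ m * (k.+1%:R * x^-1 + m%:R)^-1) N -
    series (fun m => (-1) ^+ m * (k.+1%:R * x + m%:R)^-1) N)).
  apply/funext => N; rewrite /series /= -sumrB mulr_sumr; apply: eq_bigr => m _.
  have a1 : 0 < k.+1%:R * x^-1 + m%:R by rewrite ltr_wpDr.
  have a2 : 0 < k.+1%:R * x + m%:R by rewrite ltr_wpDr.
  rewrite powR_inv1; last by apply: le_trans (f_ge1 k m).
  rewrite f_factor -mulrBr.
  have -> : (k.+1%:R * x^-1 + m%:R)^-1 - (k.+1%:R * x + m%:R)^-1 =
     k.+1%:R * (x - x^-1) * ((k.+1%:R * x^-1 + m%:R) * (k.+1%:R * x + m%:R))^-1.
    move: a1 a2; move: (x^-1) (k.+1%:R : R) (m%:R : R) => y q z a1 a2.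
    by field; rewrite !gt_eqF.
  have := xx0; move: (x - x^-1) (k.+1%:R : R) q0 (((k.+1%:R * x^-1 + m%:R) * _)^-1) => y q q0 z y0.
  by field; rewrite !gt_eqF.
by apply: cvgM; [exact: cvg_cst|exact: cvgB].
Qed.

(** This is [zeta (2 s)], the sum over the ray [m = 0]. *)
Let c s := limn (series (fun k => (k.+1%:R ^+ 2) `^ (- s) : R)).

Let c_dom s (k : nat) : 1 <= s -> `|(k.+1%:R ^+ 2) `^ (- s) : R| <= (k.+1%:R ^+ 2)^-1.
Proof. by move=> s1; rewrite ger0_norm ?powR_ge0 //; exact: natpow2_le. Qed.

Let c_cvg : c s @[s --> (1 : R)^'+] --> c 1.
Proof.
have hb : \forall s \near (1 : R)^'+, forall k, `|(k.+1%:R ^+ 2) `^ (- s) : R| <= (k.+1%:R ^+ 2)^-1.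
  by near=> s => k; apply: c_dom; near: s; exact: nbhs_right_ge.
have hl (k : nat) : (k.+1%:R ^+ 2) `^ (- s) @[s --> (1 : R)^'+] --> ((k.+1%:R ^+ 2) `^ (- 1) : R).
  by apply: powR_cvg; [rewrite exprn_gt0|apply: cvgN; exact: cvg_at1].
by have [] := tannery (@inv_sqr_series_cvg R) hb hl.
Unshelve. all: by end_near. Qed.

Let phi_bnd t : 0 <= t <= 1%:R -> 1 <= phi t <= 2 + 2 * n%:R.
Proof.
move=> /andP[t0 t1]; rewrite /phi.
have h1 : 0 <= n%:R * t by rewrite mulr_ge0.
have h2 : n%:R * t <= n%:R * 1 by rewrite ler_wpM2l.
have h3 : t ^+ 2 <= 1 by rewrite expr_le1.
by have := sqr_ge0 t; lra.
Qed.

Let phi_lip t t' : 0 <= t <= 1%:R -> 0 <= t' <= 1%:R ->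
  `|phi t - phi t'| <= (2 * n%:R + 2) * `|t - t'|.
Proof.
move=> /andP[a1 a2] /andP[b1 b2].
have -> : phi t - phi t' = (2 * n%:R + (t + t')) * (t - t') by rewrite /phi; ring.
by rewrite normrM ler_wpM2r // ler_norml; have := nR; lra.
Qed.

Let La0 : 0 <= 2 * n%:R + 2 :> R. Proof. by have := nR; lra. Qed.

Let I1 : R := (ln (1 + 1%:R * x) - ln (1 + 1%:R * x^-1)) / (x - x^-1).

(** [(1 + x) / (1 + 1 / x) = x]. Only half of [ln x] appears, because the sector below the diagonal
    is half of the quadrant. *)
Let I1_value : ((x - x^-1) ^+ 2) `^ 2^-1 * I1 / 2 = ln x / 2.
Proof.
rewrite powR12_sqrt ?sqr_ge0 // sqrtr_sqr gtr0_norm // /I1 !mul1r.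
have -> : 1 + x^-1 = (1 + x) / x by field; rewrite gt_eqF.
rewrite ln_div ?posrE ?addr_gt0 //; have := xx0; move: (x - x^-1) => y y0.
by field; rewrite gt_eqF.
Qed.

Let I1_bound : exists C1, forall q, (0 < q)%N ->
  `|rsum (fun t => (phi t)^-1) 1 q - q%:R * I1| <= C1.
Proof.
have [||t|C hC] := @rsum_inv_quadratic R x x^-1 1 1.
- by rewrite -subr_gt0.
- by [].
- by move=> /andP[t0 t1]; rewrite !lerDl !mulr_ge0 // ltW.
exists C => q q0; have := hC q q0; congr (`|_ - _| <= _); apply: eq_bigr => m _; congr (_^-1).
rewrite /phi -hx; move: (m%:R / q%:R) => t.
by transitivity (1 + (x + x^-1) * t + t ^+ 2 * (x * x^-1)); [ring|rewrite xix; ring].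
Qed.

Let S s := limn (series (sector_term phi 1 s)).

Let F s (p : nat * nat) : \bar R := (f p.1 p.2 `^ (- s))%:E.

Let F0 s p : (0 <= F s p)%E. Proof. by rewrite lee_fin powR_ge0. Qed.

(* [f] is symmetric in its two arguments, which folds the quadrant onto the
   sector below the diagonal; the diagonal and one boundary ray are counted apart. *)
Lemma minus_fold s : 1 < s <= 2 -> cvgn (series (sector_term phi 1 s)) ->
  \esum_(p in [set: nat * nat]) F s p =
  (2 * S s + ((2 + 2 * n%:R) `^ (- s) - 1) * c s)%:E.
Proof.
move=> /andP[s1 s2] cS.
have [cc _] := dominated_series (@inv_sqr_series_cvg R) (fun k => @c_dom s k (ltW s1)).
have eS : \esum_(p in [set p : nat * nat | (p.2 < p.1.+1)%N]) F s p = (S s)%:E.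
  rewrite -esum_sector //.
  have -> : [set p : nat * nat | (p.2 < 1 * p.1.+1)%N] = [set p | (p.2 < p.1.+1)%N].
    by apply/seteqP; split=> p /=; rewrite mul1n.
  by apply: eq_esum => p _; rewrite /F fE.
pose T3 := \esum_(p in [set p : nat * nat | (0 < p.2 < p.1.+1)%N]) F s p.
have T30 : (0 <= T3)%E by apply: esum_ge0 => p _; exact: F0.
have eC : \esum_(p in [set p : nat * nat | p.2 = 0%N]) F s p = (c s)%:E.
  rewrite (reindex_esum [set: nat] _ (fun k => (k, 0%N))).
    rewrite -esum_series //; apply: eq_esum => k _.
    by rewrite /F /f /= !(mulr0, mul0r, addr0) expr0n addr0.
  split=> //; first by move=> k l _ _ [].
  by move=> [k m] /= ->; exists k.
have eP : \esum_(p in [set p : nat * nat | p.2 = p.1.+1]) F s p = ((2 + 2 * n%:R) `^ (- s) * c s)%:E.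
  rewrite (reindex_esum [set: nat] _ (fun k => (k, k.+1))).
    have -> : (2 + 2 * n%:R) `^ (- s) * c s =
        limn (series (fun k => (2 + 2 * n%:R) `^ (- s) * (k.+1%:R ^+ 2) `^ (- s))).
      exact: (esym (@lim_seriesZ R _ ((2 + 2 * n%:R) `^ (- s)) cc)).
    rewrite -esum_series.
    - have n2 : 0 <= 2 + 2 * n%:R :> R by rewrite addr_ge0 ?mulr_ge0.
      apply: eq_esum => k _; rewrite -(powRM (- s) n2 (sqr_ge0 _)) // /F /f /=.
      by congr ((_ `^ _)%:E); ring.
    - by move=> k; rewrite mulr_ge0 ?powR_ge0.
    - exact: series_mull_cvg.
  split=> //; first by move=> k l _ _ [].
  by move=> [k m] /= ->; exists k.
(* The first index is shifted by one: exchanging the entries of [(k + 1, m)] is the map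
   [(k, m) -> (m - 1, k + 1)]. *)
have eU : \esum_(p in [set p : nat * nat | (p.1.+1 < p.2)%N]) F s p = T3.
  rewrite /T3 [RHS](reindex_esum [set p : nat * nat | (p.1.+1 < p.2)%N] _ (fun p => (p.2.-1, p.1.+1))).
    apply: eq_esum => -[k [|m]] //= _; rewrite /F /f /=; congr ((_ `^ _)%:E); ring.
  split.
  - by move=> [k [|m]] //=.
  - move=> [k [|m]] [k' [|m']]; rewrite !inE //= => _ _ [-> ->]; by [].
  - move=> [k [|m]] //= h; exists (m, k.+1) => //=; lia.
have hS : (S s)%:E = ((c s)%:E + T3)%E.
  rewrite -eS (esumID [set p : nat * nat | p.2 = 0%N]) //; congr (_ + _)%E.
    rewrite -eC; congr esum; apply/seteqP; split=> p /=; first by case.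
    by move=> ->.
  rewrite /T3; congr esum; apply/seteqP; split=> p /=.
    by move=> [h1 h2]; rewrite h1 andbT lt0n; apply/eqP.
  by move=> /andP[h1 h2]; split=> // h; rewrite h in h1.
have fT : T3 \is a fin_num.
  rewrite ge0_fin_numE //; apply: (@le_lt_trans _ _ (S s)%:E); last by rewrite ltry.
  rewrite hS leeDr //.
  by rewrite -eC; apply: esum_ge0 => p _; exact: F0.
have eT : fine T3 = S s - c s.
  by move: hS; rewrite -(fineK fT) -EFinD => -[->]; ring.
rewrite (esumID [set p : nat * nat | (p.2 < p.1.+1)%N]) // setTI eS setTI.
rewrite (esumID [set p : nat * nat | p.2 = p.1.+1]) //.
have -> : ~` [set p : nat * nat | (p.2 < p.1.+1)%N] `&` [set p | p.2 = p.1.+1] = [set p | p.2 = p.1.+1].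
  by apply/seteqP; split=> p /=; [case|move=> h; split=> //; rewrite h ltnn].
have -> : ~` [set p : nat * nat | (p.2 < p.1.+1)%N] `&` ~` [set p | p.2 = p.1.+1] =
    [set p | (p.1.+1 < p.2)%N].
  apply/seteqP; split=> p /=.
    by move=> [/negP h1 /eqP h2]; rewrite ltn_neqAle eq_sym h2 leqNgt.
  by move=> h; split; [apply/negP; rewrite -leqNgt ltnW|move=> e; rewrite e ltnn in h].
rewrite eP eU -(fineK fT) eT -!EFinD; congr (_%:E); ring.
Qed.

Lemma minus_lattice_sums : exists (Z0 Z1 : R -> R) (r0 A1 : R),
  [/\ forall s, 1 < s <= 2 ->
        \esum_(p in [set: nat * nat]) (f p.1 p.2 `^ (- s))%:E = (Z0 s)%:E /\
        \esum_(p in [set p : nat * nat | odd p.1 != odd p.2])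
          (f p.1 p.2 `^ (- s))%:E = (Z1 s)%:E,
      ((x - x^-1) ^+ 2) `^ (s / 2) * Z0 s - ln x / (s - 1) @[s --> (1 : R)^'+] --> r0,
      2 * Z1 s - Z0 s @[s --> (1 : R)^'+] --> A1 &
      (x - x^-1) * A1 = Wsum x - Wsum x^-1].
Proof.
have D0 : 0 < (x - x^-1) ^+ 2 by rewrite exprn_gt0.
have [C1 hI1] := I1_bound.
have [cS [r0 hr0]] := sector_asymptotics La0 phi_bnd phi_lip D0 hI1.
rewrite I1_value in hr0.
pose Z0 s := 2 * S s + ((2 + 2 * n%:R) `^ (- s) - 1) * c s.
have eZ0 s : 1 < s <= 2 -> \esum_(p in [set: nat * nat]) (f p.1 p.2 `^ (- s))%:E = (Z0 s)%:E.
  by move=> hs; apply: minus_fold => //; exact: cS.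
have /choice [Z1 hZ1] : forall s, exists z : R, 1 < s <= 2 ->
    \esum_(p in [set p : nat * nat | odd p.1 != odd p.2]) (f p.1 p.2 `^ (- s))%:E = z%:E /\
    2 * z - Z0 s = - limn (series (fun k => (-1) ^+ k * L s k)).
  move=> s; have [hs|hs] := boolP (1 < s <= 2); last by exists 0.
  have [z e1 e2] := @esum_alternating R (fun k m => f k m `^ (- s)) (Z0 s) (fun k m => powR_ge0 _ _) (eZ0 s hs).
  by exists z.
have hb : \forall s \near (1 : R)^'+, forall k, `|(-1) ^+ k * L s k| <= ((k.+1%:R : R) ^+ 2)^-1.
  near=> s => k; rewrite normrM normrX normrN1 expr1n mul1r.
  by have [] := @alt_f s k _ => //; near: s; exact: nbhs_right_ge.
have hl k : (-1) ^+ k * L s k @[s --> (1 : R)^'+] --> (-1) ^+ k * L 1 k.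
  by apply: cvgM; [exact: cvg_cst|exact: L_cvg].
have [_ hA] := tannery (@inv_sqr_series_cvg R) hb hl.
have dc : ((x - x^-1) ^+ 2) `^ (s / 2) @[s --> (1 : R)^'+] --> ((x - x^-1) ^+ 2) `^ (1 / 2).
  by apply: powR_cvg => //; apply: cvgM; [exact: cvg_at1|exact: cvg_cst].
have nc : (2 + 2 * n%:R) `^ (- s) @[s --> (1 : R)^'+] --> (2 + 2 * n%:R) `^ (- 1 : R).
  by apply: powR_cvg; [have := nR; lra|apply: cvgN; exact: cvg_at1].
exists Z0, Z1, (2 * r0 + ((x - x^-1) ^+ 2) `^ (1 / 2) * (((2 + 2 * n%:R) `^ (- 1) - 1) * c 1)),
  (- limn (series (fun k => (-1) ^+ k * L 1 k))); split.
- by move=> s hs; split; [exact: eZ0|case: (hZ1 s hs)].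
- have main : 2 * (((x - x^-1) ^+ 2) `^ (s / 2) * limn (series (sector_term phi 1 s)) - ln x / 2 / (s - 1))
      + ((x - x^-1) ^+ 2) `^ (s / 2) * (((2 + 2 * n%:R) `^ (- s) - 1) * c s)
      @[s --> (1 : R)^'+] -->
     2 * r0 + ((x - x^-1) ^+ 2) `^ (1 / 2) * (((2 + 2 * n%:R) `^ (- 1) - 1) * c 1).
    apply: cvgD; first by apply: cvgM => //; exact: cvg_cst.
    apply: cvgM => //; apply: cvgM; last exact: c_cvg.
    by apply: cvgB => //; exact: cvg_cst.
  apply: cvg_trans main; apply: near_eq_cvg; near=> s.
  have s1 : s - 1 != 0 by rewrite subr_eq0 gt_eqF //; near: s; exact: nbhs_right_gt.
  rewrite /Z0 -/(S s); move: (_ `^ (s / 2)) (_ `^ (- s)) (S s) (c s) (ln x) => d e a g l.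
  by field.
- have hA' : - limn (series (fun k => (-1) ^+ k * L s k)) @[s --> (1 : R)^'+] -->
      - limn (series (fun k => (-1) ^+ k * L 1 k)) by apply: cvgN.
  apply: cvg_trans hA'; apply: near_eq_cvg; near=> s.
  have hs : 1 < s <= 2.
    apply/andP; split; first by near: s; exact: nbhs_right_gt.
    by near: s; apply: nbhs_right_ltW; lra.
  by have [_ ->] := hZ1 s hs.
- have [w1 _] := Wsum_cvg x0; have [w2 _] := Wsum_cvg xi.
  have lim : series (fun k => (-1) ^+ k * L 1 k) @ \oo --> (x - x^-1)^-1 * (Wsum x^-1 - Wsum x).
    have -> : series (fun k => (-1) ^+ k * L 1 k) = (fun N => (x - x^-1)^-1 *
      (series (fun k => (-1) ^+ k / k.+1%:R * bet (k.+1%:R * x^-1)) N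
         - series (fun k => (-1) ^+ k / k.+1%:R * bet (k.+1%:R * x)) N)).
      apply/funext => N; rewrite /series /= -sumrB mulr_sumr.
      by apply: eq_bigr => k _; rewrite L_value; ring.
    by apply: cvgM; [exact: cvg_cst|exact: cvgB].
  by rewrite (cvg_lim _ lim) // mulrN mulrA divff ?gt_eqF // mul1r opprB.
Unshelve. all: by end_near. Qed.

End MinusCase.

(** * From sums over a cone to values of varrho *)

Section EsumScale.
Variables (R : realType) (T : choiceType).

Let esumZl_le (A : set T) (c : R) (a : T -> \bar R) : 0 < c -> (forall i, (0 <= a i)%E) ->
  (\esum_(i in A) (c%:E * a i) <= c%:E * \esum_(i in A) a i)%E.
Proof.
move=> c0 a0; apply: ge_ereal_sup => _ [F hF <-].
rewrite -ge0_mule_fsumr //; apply: lee_wpmul2l; first by rewrite lee_fin ltW.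
by apply: ereal_sup_ubound; exists F.
Qed.

Lemma esumZl (A : set T) (c : R) (a : T -> \bar R) : 0 < c -> (forall i, (0 <= a i)%E) ->
  (\esum_(i in A) (c%:E * a i) = c%:E * \esum_(i in A) a i)%E.
Proof.
move=> c0 a0; apply/eqP; rewrite eq_le esumZl_le //=.
have ci : 0 < c^-1 by rewrite invr_gt0.
have ca i : (0 <= c%:E * a i)%E by rewrite mule_ge0 // lee_fin ltW.
have := @esumZl_le A c^-1 (fun i => (c%:E * a i)%E) ci ca.
under eq_esum do rewrite muleA -EFinM mulVf ?gt_eqF // mul1e.
move=> h; have := lee_wpmul2l _ h; move=> /(_ c%:E); rewrite lee_fin ltW // => /(_ isT).
by rewrite muleA -EFinM mulfV ?gt_eqF // mul1e.
Qed.

End EsumScale.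

Section VarrhoCone.
Variables (R : realType) (D : int) (Q : qform).
Hypotheses (hD : is_discriminant D) (hQ : qdisc Q = D) (ha : 0 < qa Q) (hp : qprimitive Q).

(** With [u = eps ^+ j], both the sum over the cone and [ln u] are [j] times the quantities for the
    smallest unit. *)
Lemma varrho_form_cone (u r : R) (Z : R -> R) : unit1 D u -> 1 < u ->
  (forall s, 1 < s <= 2 ->
     \esum_(p in form_cone D Q u) (((qeval Q p.1 p.2)%:~R : R) `^ (- s))%:E = (Z s)%:E) ->
  D%:~R `^ (s / 2) * Z s - ln u / (s - 1) @[s --> (1 : R)^'+] --> r ->
  exists2 j : nat, (0 < j)%N & is_varrho D [set Q' | qequiv Q Q'] (r / j%:R).
Proof.
move=> hu u1 hZ hr.
have [eps [j [heps j0 uE hz]]] := zeta_class_form_cone hD hQ ha hp hu u1.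
have jR : j%:R != 0 :> R by rewrite pnatr_eq0 -lt0n.
have e0 : 0 < eps by case: heps => -[_ _ /(lt_trans ltr01)].
exists j => //; exists eps => //.
have zE s : 1 < s <= 2 -> zeta_class D [set Q' | qequiv Q Q'] s = (Z s / j%:R)%:E.
  move=> hs; rewrite mulrC EFinM -hZ // -hz muleA -EFinM mulVf // mul1e //.
have lE : ln u = j%:R * ln eps by rewrite uE lnXn // mulr_natl.
apply: cvg_EFin.
  near=> s; rewrite zE //; apply/andP; split; first by near: s; exact: nbhs_right_gt.
  by near: s; apply: nbhs_right_ltW; lra.
have h : (D%:~R `^ (s / 2) * Z s - ln u / (s - 1)) / j%:R @[s --> (1 : R)^'+] --> r / j%:R.
  by apply: cvgM => //; exact: cvg_cst.
apply: cvg_trans h; apply: near_eq_cvg; near=> s.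
rewrite /= zE; last first.
  apply/andP; split; first by near: s; exact: nbhs_right_gt.
  by near: s; apply: nbhs_right_ltW; lra.
have s1 : s - 1 != 0 by rewrite subr_eq0 gt_eqF //; near: s; exact: nbhs_right_gt.
rewrite -!EFinM -EFinD [fine _]/= lE.
move: (D%:~R `^ (s / 2)) (Z s) (ln eps) (j%:R) (jR) => a b c k k0.
by field; rewrite k0 s1.
Unshelve. all: by end_near. Qed.

(** The conditions are homogeneous, so they can be tested on [g] times the form, whose discriminant
    has square root [2 t]. This treats the discriminants [4 d] and [d] alike, with [g = 1] and
    [g = 2]. *)
Lemma form_cone_scale (g A1 B1 : int) (u t : R) (i j : int) :
  0 < g -> qa Q * g = A1 -> qb Q * g = B1 -> g%:~R * sqrtD R D = 2 * t ->
  let L' := i%:~R * A1%:~R + j%:~R * (B1%:~R / 2 - t) in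
  let L := i%:~R * A1%:~R + j%:~R * (B1%:~R / 2 + t) in
  form_cone D Q u (i, j) <-> 0 < L' /\ L' <= L < u ^+ 2 * L'.
Proof.
move=> g0 <- <- ht; have gR : 0 < g%:~R :> R by rewrite ltr0z.
pose l' := i%:~R * (qa Q)%:~R + j%:~R * (((qb Q)%:~R - sqrtD R D) / 2).
pose l := i%:~R * (qa Q)%:~R + j%:~R * (((qb Q)%:~R + sqrtD R D) / 2).
rewrite -[form_cone _ _ _ _]/(0 < l' /\ l' <= l < u ^+ 2 * l').
have tE : t = g%:~R * sqrtD R D / 2 by rewrite ht mulrAC divff ?mul1r.
have -> : i%:~R * (qa Q * g)%:~R + j%:~R * ((qb Q * g)%:~R / 2 - t) = g%:~R * l'.
  by rewrite /l' !intrM tE; field.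
have -> : i%:~R * (qa Q * g)%:~R + j%:~R * ((qb Q * g)%:~R / 2 + t) = g%:~R * l.
  by rewrite /l !intrM tE; field.
by rewrite /= (mulrCA _ g%:~R) pmulr_rgt0 // ler_pM2l // ltr_pM2l.
Qed.

End VarrhoCone.

(** * The unit and the two forms attached to [n ^ 2 + e] *)

Section NarrowClasses.
Variables (R : realType) (n : nat) (e : int).
Hypothesis he : e = 1 \/ e = -1.
Let d : int := n%:Z ^+ 2 + e.
Hypothesis d0 : 0 < d.
Hypothesis dsq : forall m : int, d <> m ^+ 2.
Let t : R := Num.sqrt d%:~R.
Let x : R := n%:R + t.

Let tE : t ^+ 2 = n%:R ^+ 2 + e%:~R.
Proof. by rewrite sqr_sqrtr ?ler0z ?ltW // /d rmorphD rmorphXn. Qed.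

Let dQ : d%:~R = n%:R ^+ 2 + e%:~R :> rat.
Proof. by rewrite /d rmorphD rmorphXn. Qed.

Let t0 : 0 < t. Proof. by rewrite sqrtr_gt0 ltr0z. Qed.

Let x0 : 0 < x. Proof. by rewrite ltr_wpDl. Qed.

Lemma inv_fundamental : x^-1 = - e%:~R * (n%:R - t).
Proof.
apply: (mulfI (lt0r_neq0 x0)); rewrite mulfV ?lt0r_neq0 // mulrCA /x [_ * (_ - _)]mulrC -subr_sqr tE.
by case: he => ->; ring.
Qed.

Lemma nonsquare_multiple (g D : int) : 0 < g -> 4 * d = D * g ^+ 2 ->
  forall m : int, D <> m ^+ 2.
Proof.
move=> g0 hD m hm; have h : (g%:~R * m%:~R / 2 : rat) ^+ 2 = d%:~R.
  have : (4 * d)%:~R = (D * g ^+ 2)%:~R :> rat by rewrite hD.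
  rewrite hm !intrM => h.
  have -> : d%:~R = 4%:~R * d%:~R / 4 :> rat by field.
  by rewrite h; field.
by have [k /dsq] := rat_sqr_int h.
Qed.

Section Order.
Variables (D g : int).
Hypotheses (hD : is_discriminant D) (g0 : 0 < g) (Dg : 4 * d = D * g ^+ 2).
Hypothesis order_t : quad_order D t.
Variable Q : qform.
Hypothesis hQ : qdisc Q = D.

Lemma sqrtD_scale : g%:~R * sqrtD R D = 2 * t.
Proof.
have D0 : 0 < D by case: hD.
apply: (@pexpIrn _ 2) => //; rewrite ?nnegrE ?mulr_ge0 ?sqrtr_ge0 ?ler0z ?(ltW g0) ?(ltW t0) //.
rewrite !exprMn sqrtD_sqr // sqr_sqrtr ?ler0z ?ltW //.
have : (4 * d)%:~R = (D * g ^+ 2)%:~R :> R by rewrite Dg.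
by rewrite !intrM => h; rewrite mulrC expr2 -h; ring.
Qed.

Let gR : g%:~R != 0 :> R. Proof. by rewrite intr_eq0 gt_eqF. Qed.

Let tq : t = ratr (g%:~R / 2) * sqrtD R D.
Proof.
rewrite rmorphM fmorphV /= ratr_int ratr_nat mulrAC sqrtD_scale mulrAC divff ?mul1r //.
Qed.

Lemma qconj_fundamental : qconj D x = n%:R - t.
Proof.
by have := @qconjE R D hD n%:R (g%:~R / 2); rewrite ratr_nat -tq.
Qed.

Lemma order_fundamental : quad_order D x /\ quad_order D x^-1.
Proof.
have on : quad_order D (n%:R : R) by have := quad_order_int R hQ n; rewrite pmulrn.
have one : quad_order D (- e%:~R : R) by rewrite -rmorphN; exact: (quad_order_int R hQ).
split; first exact: (quad_orderD hQ).
by rewrite inv_fundamental; apply: (quad_orderM hD hQ) => //; exact: (quad_orderB hQ).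
Qed.

(** The norm of [x] is [n ^ 2 - t ^ 2 = - e]. *)
Lemma unit1_minus : e = -1 -> unit1 D x.
Proof.
move=> e1; have [hx hxi] := order_fundamental; split=> //.
rewrite qconj_fundamental mulrC /x -subr_sqr tE e1; ring.
Qed.

Lemma unit1_plus : unit1 D (x ^+ 2).
Proof.
have [hx hxi] := order_fundamental; split.
- by rewrite expr2; exact: (quad_orderM hD hQ).
- by rewrite -exprVn expr2; exact: (quad_orderM hD hQ).
rewrite expr2 (qconjM hD) ?qconj_fundamental.
  transitivity ((n%:R ^+ 2 - t ^+ 2) ^+ 2); first by rewrite /x; ring.
  by rewrite tE; case: he => ->; ring.
all: exact: (quad_order_field hD hQ hx).
Qed.

End Order.

Let Q0 := QForm 1 (2 * n%:Z) (- e).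

Lemma discriminant_principal : is_discriminant (4 * d).
Proof.
split; first by rewrite mulr_gt0.
  by left; rewrite modzMr.
by apply: (@nonsquare_multiple 1) => //; rewrite expr1n mulr1.
Qed.

(** Putting [q = 2 i + j], [m = j] in [f] gives twice [[2, 2n+2, c]]. If [c] is odd this form is
    primitive and [g = 1]; if [c] is even a further factor [g = 2] comes out and the discriminant
    falls from [4 d] to [d]. *)
Lemma second_form : exists (D g : int) (Q : qform),
  [/\ is_discriminant D, 0 < g, 4 * d = D * g ^+ 2, qdisc Q = D & qprimitive Q] /\
  [/\ qa Q * g = 2, qb Q * g = 2 * n%:Z + 2, 2 * (qc Q * g) = 2 * n%:Z + 1 - e, quad_order D t &
      exists2 a : int, a \in [:: 0; 1; -1] & D%:~R = 4 ^ a * (n%:R ^+ 2 + e%:~R) :> rat].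
Proof.
have [c hc] : exists c : nat, 2 * c%:Z = 2 * n%:Z + 1 - e.
  by case: he => ->; [exists n|exists n.+1]; lia.
have [oc|oc] := boolP (odd c).
  exists (4 * d), 1, (QForm 2 (2 * n%:Z + 2) c%:Z); split; split => //=; rewrite ?mulr1 ?expr1n //.
  - exact: discriminant_principal.
  - rewrite /qdisc /= -mulrA hc /d; ring.
  - rewrite /qprimitive /=.
    have -> : gcdz 2 (2 * n%:Z + 2) = 2.
      by apply/eqP; rewrite eqz_nat; apply/eqP/gcdn_idPl; rewrite dvdn2; lia.
    by rewrite /gcdz /=; congr Posz; apply/eqP; rewrite -/(coprime 2 c) coprime2n.
  - exists (- (2 * d)), 1; have := sqrtD_scale discriminant_principal ltr01 (esym (mulr1 _)).
    by rewrite !mul1r => ->; rewrite intrN !intrM; field.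
  - by exists 1 => //; rewrite intrM dQ.
have [b bc] : exists b : nat, c = (2 * b)%N by exists c./2; lia.
(* [c] even means [n] even when [e = 1] and [n] odd when [e = - 1], so [d] is 1 or 0 modulo 4. *)
have hD : is_discriminant d.
  split=> //; case: he => e1.
    right; have nE : n%:Z = 2 * b%:Z by rewrite e1 in hc; lia.
    have -> : d = b%:Z ^+ 2 * 4 + 1 by rewrite /d nE e1; ring.
    by rewrite modzMDl.
  left; have nE : n%:Z = 2 * b%:Z - 1 by rewrite e1 in hc; lia.
  have -> : d = (b%:Z ^+ 2 - b%:Z) * 4 + 0 by rewrite /d nE e1; ring.
  by rewrite modzMDl.
have gD : 4 * d = d * 2 ^+ 2 by rewrite mulrC.
exists d, 2, (QForm 1 (n%:Z + 1) b%:Z); split; split => //=.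
- rewrite /qdisc /= mulr1 /d; have -> : e = 2 * n%:Z + 1 - 4 * b%:Z by lia.
  by ring.
- by rewrite /qprimitive /= !gcd1z.
- by ring.
- by lia.
- exists (- d), 2; have := @sqrtD_scale d 2 hD isT gD.
  move=> /(mulfI _) ->; rewrite ?pnatr_eq0 //.
  by rewrite intrN; field.
- by exists 0 => //; rewrite mul1r dQ.
Qed.

(** * The two lattice sums as zeta functions of two classes *)

Section Cones.
Variables (u : R) (P : nat -> nat -> bool) (f : nat -> nat -> R).
Hypothesis hcone : forall q m : int,
  let l' : R := q%:~R + m%:~R * (n%:R - t) in let l := q%:~R + m%:~R * (n%:R + t) in
  (0 < l' /\ l' <= l < u ^+ 2 * l') <-> [/\ 0 < q, 0 <= m & P `|q|.-1 `|m|].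
Hypothesis hf : forall k m : nat, f k m = (qeval Q0 k.+1 m)%:~R.
Hypothesis f_gt0 : forall k m, P k m -> 0 < f k m.

Lemma esum_principal_cone s :
  \esum_(p in form_cone (4 * d) Q0 u) (((qeval Q0 p.1 p.2)%:~R : R) `^ (- s))%:E =
  \esum_(p in [set p : nat * nat | P p.1 p.2]) (f p.1 p.2 `^ (- s))%:E.
Proof.
have cone i j : form_cone (4 * d) Q0 u (i, j) <-> [/\ 0 < i, 0 <= j & P `|i|.-1 `|j|].
  apply: iff_trans (hcone i j).
  have := @form_cone_scale R (4 * d) Q0 1 1 (2 * n%:Z) u t i j ltr01 erefl (mulr1 _).
  move=> /(_ (@sqrtD_scale (4 * d) 1 discriminant_principal ltr01 (esym (mulr1 _)))).
  by rewrite intrM mulrAC divff // mul1r mulr1.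
rewrite (reindex_esum [set p : nat * nat | P p.1 p.2] _ (fun p => (p.1.+1%:Z, p.2%:Z))).
  by apply: eq_esum => -[k m] _; rewrite hf.
split.
- by move=> [k m] /= h; apply/cone.
- by move=> [k m] [k' m'] _ _ /= [-> ->].
- move=> [i j] /cone [i0 j0 h]; exists (`|i|.-1, `|j|%N) => //=.
  by congr (_, _); lia.
Qed.

Section SecondForm.
Variables (D g : int) (Q : qform).
Hypotheses (hD : is_discriminant D) (g0 : 0 < g) (Dg : 4 * d = D * g ^+ 2).
Hypotheses (hQ : qdisc Q = D) (ga : qa Q * g = 2) (gb : qb Q * g = 2 * n%:Z + 2).
Hypothesis gc : 2 * (qc Q * g) = 2 * n%:Z + 1 - e.

(** [q = 2 i + j], [m = j] runs through the pairs of equal parity, and there [f = 2 g Q(i, j)],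
    which accounts for the power of [2 g]. *)
Lemma esum_second_cone s :
  \esum_(p in form_cone D Q u) (((qeval Q p.1 p.2)%:~R : R) `^ (- s))%:E =
  (((2 * g%:~R) `^ s)%:E *
  \esum_(p in [set p : nat * nat | P p.1 p.2 && (odd p.1 != odd p.2)]) (f p.1 p.2 `^ (- s))%:E)%E.
Proof.
have gR : 0 < g%:~R :> R by rewrite ltr0z.
have cone i j : form_cone D Q u (i, j) <-> [/\ 0 < 2 * i + j, 0 <= j & P `|2 * i + j|.-1 `|j|].
  apply: iff_trans (hcone (2 * i + j) j).
  have := @form_cone_scale R D Q g 2 (2 * n%:Z + 2) u t i j g0 ga gb (sqrtD_scale hD g0 Dg).
  have -> : i%:~R * 2%:~R + j%:~R * ((2 * n%:Z + 2)%:~R / 2 - t) =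
     (2 * i + j)%:~R + j%:~R * (n%:R - t) :> R by rewrite !intrD !intrM; field.
  have -> : i%:~R * 2%:~R + j%:~R * ((2 * n%:Z + 2)%:~R / 2 + t) =
     (2 * i + j)%:~R + j%:~R * (n%:R + t) :> R by rewrite !intrD !intrM; field.
  by [].
have val i j : 2 * g * qeval Q i j = qeval Q0 (2 * i + j) j.
  rewrite /qeval /=.
  transitivity (2 * (qa Q * g) * i ^+ 2 + 2 * (qb Q * g) * i * j + 2 * (qc Q * g) * j ^+ 2); first by ring.
  by rewrite ga gb gc; ring.
have half (k m : nat) : odd k != odd m -> exists i : int, 2 * i + m%:Z = k.+1%:Z.
  by move=> h; exists ((k.+1%:Z - m%:Z) %/ 2)%Z; lia.
rewrite (reindex_esum [set p : nat * nat | P p.1 p.2 && (odd p.1 != odd p.2)] _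
  (fun p => ((p.1.+1%:Z - p.2%:Z) %/ 2, p.2%:Z)%Z)).
  rewrite -esumZl ?powR_gt0 ?mulr_gt0 //; last by move=> p; rewrite lee_fin powR_ge0.
  apply: eq_esum => -[k m] /= /andP[hP /half [i hi]].
  have -> : ((k.+1%:Z - m%:Z) %/ 2)%Z = i by lia.
  rewrite -EFinM; congr (_%:E).
  have fE : f k m = 2 * g%:~R * (qeval Q i m)%:~R by rewrite hf -hi -val !intrM.
  have v0 : 0 < (qeval Q i m)%:~R :> R.
    by have := f_gt0 hP; rewrite fE pmulr_rgt0 // mulr_gt0.
  rewrite fE (@powRM _ (2 * g%:~R) _ (- s)) ?ltW ?mulr_gt0 // mulrA (powRN (2 * g%:~R)) mulfV ?mul1r //.
  by rewrite gt_eqF // powR_gt0 // mulr_gt0.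
split.
- move=> [k m] /= /andP[hP /half [i hi]]; apply/cone.
  have -> : ((k.+1%:Z - m%:Z) %/ 2)%Z = i by lia.
  by rewrite hi.
- move=> [k m] [k' m']; rewrite !inE /= => /andP[_ /half [i hi]] /andP[_ /half [i' hi']] [].
  have -> : ((k.+1%:Z - m%:Z) %/ 2)%Z = i by lia.
  have -> : ((k'.+1%:Z - m'%:Z) %/ 2)%Z = i' by lia.
  by move=> e1 e2; congr (_, _); lia.
- move=> [i j] /cone [i0 j0 h]; exists (`|2 * i + j|.-1, `|j|%N) => /=.
    by rewrite h /=; lia.
  by congr (_, _); lia.
Qed.

End SecondForm.

Hypothesis u1 : 1 < u.
Hypothesis hu : forall D g Q, is_discriminant D -> 0 < g -> 4 * d = D * g ^+ 2 ->
  quad_order D t -> qdisc Q = D -> unit1 D u.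
Variables (Z0 Z1 : R -> R) (r0 A1 : R).
Hypothesis hZ : forall s, 1 < s <= 2 ->
  \esum_(p in [set p : nat * nat | P p.1 p.2]) (f p.1 p.2 `^ (- s))%:E = (Z0 s)%:E /\
  \esum_(p in [set p : nat * nat | P p.1 p.2 && (odd p.1 != odd p.2)])
     (f p.1 p.2 `^ (- s))%:E = (Z1 s)%:E.
Hypothesis hr0 : ((2 * t) ^+ 2) `^ (s / 2) * Z0 s - ln u / (s - 1) @[s --> (1 : R)^'+] --> r0.
Hypothesis hA1 : 2 * Z1 s - Z0 s @[s --> (1 : R)^'+] --> A1.

Let E4 : (4 * d)%:~R = (2 * t) ^+ 2 :> R.
Proof. by rewrite intrM exprMn sqr_sqrtr ?ler0z ?ltW //; ring. Qed.

Let t20 : 0 < 2 * t. Proof. by rewrite mulr_gt0. Qed.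

(** As [D g ^ 2 = (2 t) ^ 2], the left-hand product is [2 ^ (s - 1) * (2 t) ^ s * (2 * Z1 s)].
    Splitting [2 * Z1] as [(2 * Z1 - Z0) + Z0] gives the first two terms of the limit; [2 ^ (s - 1)]
    acting on the pole of [Z0] gives [ln u * ln 2]. *)
Lemma second_limit (D g : int) : is_discriminant D -> 0 < g -> 4 * d = D * g ^+ 2 ->
  D%:~R `^ (s / 2) * ((2 * g%:~R) `^ s * Z1 s) - ln u / (s - 1) @[s --> (1 : R)^'+] -->
  2 * t * A1 + r0 + ln u * ln 2.
Proof.
move=> hD g0 Dg; have D0 : 0 <= D%:~R :> R by rewrite ler0z ltW //; case: hD.
have gR : 0 < g%:~R :> R by rewrite ltr0z.
have h2 : (2 : R) `^ (s - 1) @[s --> (1 : R)^'+] --> (2 : R) `^ (1 - 1).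
  by apply: powR_cvg => //; apply: cvgB; [exact: cvg_at1|exact: cvg_cst].
have hE : ((2 * t) ^+ 2) `^ (s / 2) @[s --> (1 : R)^'+] --> ((2 * t) ^+ 2) `^ (1 / 2).
  by apply: powR_cvg; [rewrite exprn_gt0|apply: cvgM; [exact: cvg_at1|exact: cvg_cst]].
have main : (2 : R) `^ (s - 1) * (((2 * t) ^+ 2) `^ (s / 2) * (2 * Z1 s - Z0 s))
    + (2 : R) `^ (s - 1) * (((2 * t) ^+ 2) `^ (s / 2) * Z0 s - ln u / (s - 1))
    + ln u * (((2 : R) `^ (1 * (s - 1)) - 1) / (s - 1)) @[s --> (1 : R)^'+] -->
  (2 : R) `^ (1 - 1) * (((2 * t) ^+ 2) `^ (1 / 2) * A1) + (2 : R) `^ (1 - 1) * r0 + ln u * (1 * ln 2).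
  apply: cvgD; first apply: cvgD.
  - by apply: cvgM => //; exact: cvgM.
  - exact: cvgM.
  - by apply: cvgM; [exact: cvg_cst|exact: powR_quotient_cvg].
rewrite subrr powRr0 !mul1r powR12_sqrt ?sqr_ge0 // sqrtr_sqr gtr0_norm // in main.
apply: cvg_trans main; apply: near_eq_cvg; near=> s.
have s1 : s - 1 != 0 by rewrite subr_eq0 gt_eqF //; near: s; exact: nbhs_right_gt.
have -> : D%:~R `^ (s / 2) * ((2 * g%:~R) `^ s * Z1 s) =
    ((2 * t) ^+ 2) `^ (s / 2) * (2 * 2 `^ (s - 1)) * Z1 s.
  have -> : ((2 * t) ^+ 2) `^ (s / 2) = D%:~R `^ (s / 2) * g%:~R `^ s.
    have -> : (2 * t) ^+ 2 = D%:~R * g%:~R `^ 2%:R.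
      by rewrite powR_mulrn ?ltW // -E4 Dg intrM rmorphXn.
    rewrite powRM ?powR_ge0 // -powRrM; congr (_ * _ `^ _).
    by rewrite mulrCA divff ?mulr1.
  rewrite (@powRM _ 2) ?ltW //.
  have -> : (2 : R) `^ s = 2 * 2 `^ (s - 1).
    have -> : (2 : R) `^ s = 2 `^ (1 + (s - 1)) by congr (_ `^ _); ring.
    by rewrite powRD ?powRr1 // pnatr_eq0 implybT.
  by ring.
rewrite (mul1r (s - 1)); move: (_ `^ (s / 2)) (2 `^ (s - 1)) (Z0 s) (Z1 s) (ln u) => a b z z' l.
by field.
Unshelve. all: by end_near. Qed.

(** The two entries of [j] are the exponents of [u] over the smallest units of the two orders; they
    may differ. *)
Lemma two_narrow_classes : exists (D : 'I_2 -> int) (B : 'I_2 -> set qform)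
    (r : 'I_2 -> R) (j : 'I_2 -> nat),
  (forall i, [/\ is_discriminant (D i),
     exists2 a : int, a \in [:: 0; 1; -1]
       & (D i)%:~R = 4 ^ a * (n%:R ^+ 2 + e%:~R) :> rat,
     narrow_form_class (D i) (B i) & is_varrho (D i) (B i) (r i)]) /\
  2 * t * A1 = (j ord_max)%:R * r ord_max - (j ord0)%:R * r ord0 - ln 2 * ln u.
Proof.
have [D [g [Q [[hD g0 Dg hQ hp] [ga gb gc ot ha]]]]] := second_form.
have hD4 := discriminant_principal.
have ot4 : quad_order (4 * d) t.
  exists (- (2 * d)), 1; have := sqrtD_scale hD4 ltr01 (esym (mulr1 _)).
  by rewrite !mul1r => ->; rewrite intrN !intrM; field.
have hQ0 : qdisc Q0 = 4 * d by rewrite /qdisc /= /d; ring.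
have hp0 : qprimitive Q0 by rewrite /qprimitive /= !gcd1z.
have qa0 : 0 < qa Q by rewrite -(pmulr_lgt0 _ g0) ga.
have [||||j0 j00 v0] := @varrho_form_cone R (4 * d) Q0 hD4 hQ0 isT hp0 u r0 Z0.
- by apply: (hu hD4 ltr01 _ ot4 hQ0); rewrite expr1n mulr1.
- exact: u1.
- by move=> s hs; rewrite esum_principal_cone; case: (hZ hs).
- by rewrite E4.
have [||||j1 j10 v1] := @varrho_form_cone R D Q hD hQ qa0 hp u (2 * t * A1 + r0 + ln u * ln 2)
   (fun s => (2 * g%:~R) `^ s * Z1 s).
- exact: (hu hD g0 Dg ot hQ).
- exact: u1.
- by move=> s hs; rewrite (esum_second_cone hD g0 Dg hQ ga gb gc); case: (hZ hs) => _ ->.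
- exact: second_limit.
exists (fun i => if i == ord0 then 4 * d else D),
  (fun i => if i == ord0 then [set Q' | qequiv Q0 Q'] else [set Q' | qequiv Q Q']),
  (fun i => if i == ord0 then r0 / j0%:R else (2 * t * A1 + r0 + ln u * ln 2) / j1%:R),
  (fun i => if i == ord0 then j0 else j1); split.
  move=> i; case: ifP => _; split => //.
  - by exists 1 => //; rewrite intrM dQ.
  - by exists Q0.
  - by exists Q.
rewrite /= ![_ * (_ / _)]mulrC !divfK ?pnatr_eq0 -?lt0n //.
by ring.
Qed.
End Cones.
End NarrowClasses.

(** * The cones in coordinates and the final assembly *)

Section Cases.
Variables (R : realType) (n : nat) (t : R).
Hypotheses (n1 : (1 <= n)%N) (t0 : 0 < t).
Let x : R := n%:R + t.

Let N1 : 1 <= n%:R :> R. Proof. by rewrite ler1n. Qed.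
Let x0 : 0 < x. Proof. by rewrite addr_gt0 // (lt_le_trans _ N1). Qed.

Let sector_order (q m : int) :
  (q%:~R + m%:~R * (n%:R - t) <= q%:~R + m%:~R * (n%:R + t)) = (0 <= m).
Proof.
rewrite -subr_ge0 -[RHS](ler0z R).
have -> : q%:~R + m%:~R * (n%:R + t) - (q%:~R + m%:~R * (n%:R - t)) = m%:~R * (2 * t) by ring.
by rewrite pmulr_lge0 // mulr_gt0.
Qed.

(** Here [l = q + m x] and [l' = q - m / x]. The upper bound on [l] is [m < 2 n q], because [x ^ 4 *
    l' - l = (x ^ 2 + 1) * x * (2 n q - m)]; positivity of [l'] then follows from [2 n < x]. *)
Lemma plus_cone (q m : int) : t ^+ 2 = n%:R ^+ 2 + 1 ->
  let l' := q%:~R + m%:~R * (n%:R - t) in let l := q%:~R + m%:~R * (n%:R + t) in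
  (0 < l' /\ l' <= l < (x ^+ 2) ^+ 2 * l') <->
  [/\ 0 < q, 0 <= m & (`|m| < 2 * n * (`|q|.-1).+1)%N].
Proof.
move=> tE l' l; rewrite sector_order.
have xz : x * (n%:R - t) = -1 by rewrite mulrC -subr_sqr tE; ring.
have x2 : x ^+ 2 = 2 * n%:R * x + 1 by rewrite sqrrD tE /x; ring.
have lE : (l < (x ^+ 2) ^+ 2 * l') = (m < (2 * n)%N%:Z * q).
  rewrite -subr_gt0 -[RHS](ltr_int R) -[RHS]subr_gt0.
  have -> : (x ^+ 2) ^+ 2 * l' - l = (x ^+ 2 + 1) * x * (((2 * n)%N%:Z * q)%:~R - m%:~R).
    rewrite /l' /l intrM -pmulrn natrM -/x; move: (q%:~R : R) (m%:~R : R) => a b.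
    transitivity (x ^+ 2 * x ^+ 2 * a + x ^+ 2 * x * (x * (n%:R - t)) * b - a - b * x); first by ring.
    rewrite xz; transitivity ((x ^+ 2 + 1) * (a * (x ^+ 2 - 1) - b * x)); first by ring.
    by rewrite [X in _ * (a * (X - 1) - _)]x2; ring.
  by rewrite pmulr_rgt0 // mulr_gt0 // addr_gt0 // exprn_gt0.
have bound : 0 < q -> 0 <= m ->
    (m < (2 * n)%N%:Z * q) = (`|m| < 2 * n * (`|q|.-1).+1)%N.
  by case: q {l' l lE} => // -[|k] // _; case: m => // m' _; rewrite -PoszM ltz_nat.
rewrite lE; split.
  move=> [l0 /andP[m0 hm]].
  have q0 : 0 < q.
    rewrite -(ltr0z R); apply: lt_le_trans l0 _; rewrite /l' gerDl.
    apply: mulr_ge0_le0; first by rewrite ler0z.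
    by rewrite -(pmulr_rle0 _ x0) xz; lra.
  by split=> //; rewrite -bound.
move=> [q0 m0]; rewrite -bound // => h.
split; last by rewrite m0.
rewrite -(pmulr_rgt0 _ x0) /l' mulrDr mulrCA xz mulrN1 subr_gt0.
move: h; rewrite -(ltr_int R) intrM -pmulrn natrM => /lt_le_trans; apply.
rewrite ler_pM2r ?ltr0z //.
rewrite -(ler_pM2r x0) -expr2 x2; lra.
Qed.

(** Here [l' = q + m / x] and [x ^ 2 * l' - l = (x ^ 2 - 1) * q]. *)
Lemma minus_cone (q m : int) : t ^+ 2 = n%:R ^+ 2 - 1 ->
  let l' := q%:~R + m%:~R * (n%:R - t) in let l := q%:~R + m%:~R * (n%:R + t) in
  (0 < l' /\ l' <= l < x ^+ 2 * l') <-> [/\ 0 < q, 0 <= m & true].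
Proof.
move=> tE l' l; rewrite sector_order.
have xz : x * (n%:R - t) = 1 by rewrite mulrC -subr_sqr tE; ring.
have z0 : 0 < n%:R - t by rewrite -(pmulr_rgt0 _ x0) xz.
have x2 : 1 < x ^+ 2 by rewrite exprn_egt1 // -[1]addr0 /x ler_ltD.
have lE : (l < x ^+ 2 * l') = (0 < q).
  rewrite -subr_gt0 -[RHS](ltr0z R).
  have -> : x ^+ 2 * l' - l = (x ^+ 2 - 1) * q%:~R.
    rewrite /l' /l -/x; move: (q%:~R : R) (m%:~R : R) => a b.
    transitivity (x ^+ 2 * a + x * (x * (n%:R - t)) * b - a - b * x); first by ring.
    by rewrite xz; ring.
  by rewrite pmulr_rgt0 // subr_gt0.
rewrite lE; split=> [[_ /andP[m0 q0]] //|[q0 m0 _]]; split; last by rewrite m0.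
by rewrite /l' ltr_pwDl ?ltr0z // mulr_ge0 ?ler0z // ltW.
Qed.

End Cases.

(** Apart from the excluded pair, where it is 0, the number lies strictly between two consecutive
    squares. *)
Lemma nonsquare_near_square (n : nat) (e : int) : (1 <= n)%N -> e = 1 \/ e = -1 ->
  ~ (n = 1%N /\ e = -1) -> 0 < n%:Z ^+ 2 + e /\ forall m : int, n%:Z ^+ 2 + e <> m ^+ 2.
Proof.
move=> n1 he ne.
have hn : n%:Z = 1 /\ e = 1 \/ 2 <= n%:Z by case: he => e1; lia.
split=> [|m]; first by rewrite expr2; move: n%:Z hn => z; case: he => -> [[-> ]|] //; nia.
have -> : m ^+ 2 = `|m|%N%:Z ^+ 2 by rewrite abszE real_normK ?num_real.
have k0 : 0 <= `|m|%N%:Z by [].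
move: (`|m|%N%:Z) k0 => k k0.
move: n%:Z n1 hn => z _ hn h.
have [hk|[hk|hk]] : k <= z - 1 \/ k = z \/ z + 1 <= k by lia.
- have kz : k * k <= (z - 1) * (z - 1) by apply: ler_pM.
  by move: h kz; rewrite !expr2; case: he hn => -> [[-> e1]|h2] //; nia.
- by subst k; case: he h => ->; lia.
- have kz : (z + 1) * (z + 1) <= k * k by apply: ler_pM => //; case: hn => [[->]|]; lia.
  by move: h kz; rewrite !expr2; case: he hn => -> [[-> e1]|h2] //; nia.
Qed.

Theorem theorem5 (R : realType) (n : nat) (e : int)
    (hn : (1 <= n)%N) (he : e = 1 \/ e = -1) :
  let x : R := n%:R + Num.sqrt (n%:R ^+ 2 + e%:~R) in
  exists (k : nat) (D : 'I_k -> int) (B : 'I_k -> set qform) (r : 'I_k -> R)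
         (c0 c1 : rat) (c : 'I_k -> rat),
    [/\ (k <= 4)%N,
        forall i : 'I_k,
          [/\ is_discriminant (D i),
              exists2 a : int, a \in [:: 0; 1; -1]
                & (D i)%:~R = 4 ^ a * (n%:R ^+ 2 + e%:~R) :> rat,
              narrow_form_class (D i) (B i)
            & is_varrho (D i) (B i) (r i)]
      & calJ x = ratr c0 * riemann_zeta 2 + ratr c1 * (ln 2 * ln x)
                 + \sum_i ratr (c i) * r i].
Proof.
move=> x.
(* In this degenerate case [x = 1], reflection gives [J(1) = log ^ 2 2 / 2], and [calJ 1 = 0] is the
   empty combination. *)
have [[n1 e1]|ne] := pselect (n = 1%N /\ e = -1).
  exists 0%N, (fun=> 0), (fun=> set0), (fun=> 0), 0, 0, (fun=> 0); split=> //; first by case.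
  have x1 : x = 1 by rewrite /x n1 e1 expr1n subrr sqrtr0 addr0.
  have := @Jfun_reflection R 1 ltr01; rewrite invr1 => h.
  rewrite big_ord0 rmorph0 !mul0r !addr0 x1 /calJ invr1 subrr mulr0 addr0 -h.
  by field.
have [d0 dsq] := nonsquare_near_square hn he ne.
set t : R := Num.sqrt (n%:Z ^+ 2 + e)%:~R.
have xE : x = n%:R + t by rewrite /x /t intrD rmorphXn.
have t0 : 0 < t by rewrite sqrtr_gt0 ltr0z.
have tE : t ^+ 2 = n%:R ^+ 2 + e%:~R by rewrite sqr_sqrtr ?ler0z ?ltW // intrD rmorphXn.
have N1 : 1 <= n%:R :> R by rewrite ler1n.
have x1 : 1 < x by rewrite xE; lra.
have x0 : 0 < x by apply: lt_trans x1.
have xi : x^-1 = - e%:~R * (n%:R - t) by rewrite xE; exact: inv_fundamental.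
(* The left-hand side is [2 t * A1]. In terms of [calJ], [Wsum_diff] says
   [W(x) - W(1/x) = - 2 calJ x]. For [e = 1] this difference enters twice, the boundary term adds
   [2 n * pi ^ 2 / 12 = n zeta(2)], and [ln u = 2 ln x]. *)
have [D [B [r [j [hB hA]]]]] : exists (D : 'I_2 -> int) (B : 'I_2 -> set qform) (r : 'I_2 -> R)
    (j : 'I_2 -> nat), (forall i, [/\ is_discriminant (D i),
     exists2 a : int, a \in [:: 0; 1; -1]
       & (D i)%:~R = 4 ^ a * (n%:R ^+ 2 + e%:~R) :> rat,
     narrow_form_class (D i) (B i) & is_varrho (D i) (B i) (r i)]) /\
  (if e == 1 then - 4 * calJ x + n%:R * riemann_zeta 2 else - 2 * calJ x) =
     (j ord_max)%:R * r ord_max - (j ord0)%:R * r ord0 - (if e == 1 then 2 else 1) * (ln 2 * ln x).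
  have J := Wsum_diff x0.
  case: he => e1; rewrite e1 in tE xi.
    have hx : x - x^-1 = 2 * n%:R by rewrite xi xE; ring.
    have [Z0 [Z1 [r0 [A1 [hZ hr hA hW]]]]] := plus_lattice_sums hn x1 hx.
    have hx2 : x + x^-1 = 2 * t by rewrite xi xE; ring.
    rewrite hx2 in hr hW.
    have [|||||||||D [B [r [j [hB hj]]]]] := @two_narrow_classes R n e _ d0 dsq (x ^+ 2)
       (fun k m => m < 2 * n * k.+1)%N
       (fun k m => k.+1%:R ^+ 2 + 2 * n%:R * m%:R * k.+1%:R - m%:R ^+ 2) _ _ _ _ _ Z0 Z1 r0 A1.
    - by left.
    - by move=> q m; rewrite xE; apply: plus_cone.
    - by move=> k m; rewrite /qeval e1 /=; rewrite ?(intrD, intrM, rmorphXn, rmorphN1) /=; ring.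
    - move=> k m hm /=.
      have : (m%:R : R) <= 2 * n%:R * k.+1%:R by rewrite -!natrM ler_nat ltnW.
      have : 0 < k.+1%:R :> R by [].
      have := ler0n R m; move: (k.+1%:R : R) (m%:R : R) => q y y0 q0 yq.
      have : 0 <= y * (2 * n%:R * q - y) by rewrite mulr_ge0 // subr_ge0.
      have : 0 < q ^+ 2 by rewrite exprn_gt0.
      by nra.
    - by rewrite exprn_egt1.
    - move=> D g Q hD g0 Dg ot hQ; rewrite xE; apply: (unit1_plus _ d0 hD g0 Dg ot hQ).
      by left.
    - exact: hZ.
    - exact: hr.
    - exact: hA.
    exists D, B, r, j; split=> //; rewrite e1 /=.
    rewrite lnXn // in hj.
    rewrite hx in J hW; rewrite -/t hW in hj.
    rewrite riemann_zeta2 /calJ hx.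
    by move: J hj; move: (Wsum x) (Wsum x^-1) (Jfun x) => W W' J J1 J2; lra.
  have hx : x + x^-1 = 2 * n%:R by rewrite xi xE; ring.
  have [Z0 [Z1 [r0 [A1 [hZ hr hA hW]]]]] := minus_lattice_sums hn x1 hx.
  have hx2 : x - x^-1 = 2 * t by rewrite xi xE; ring.
  have [|||||||||D [B [r [j [hB hj]]]]] := @two_narrow_classes R n e _ d0 dsq x
     (fun k m => true)
     (fun k m => k.+1%:R ^+ 2 + 2 * n%:R * m%:R * k.+1%:R + m%:R ^+ 2) _ _ _ _ _ Z0 Z1 r0 A1.
  - by right.
  - by move=> q m; rewrite xE; apply: minus_cone.
  - by move=> k m; rewrite /qeval e1 /=; rewrite ?(intrD, intrM, rmorphXn, rmorphN1) /=; ring.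
  - by move=> k m _ /=; rewrite ltr_pwDl ?sqr_ge0 // ltr_pwDl ?exprn_gt0 // !mulr_ge0.
  - exact: x1.
  - move=> D g Q hD g0 Dg ot hQ; rewrite xE; apply: (unit1_minus _ d0 hD g0 Dg ot hQ e1).
    by right.
  - have setE : [set p : nat * nat | true] = setT by apply/seteqP.
    by move=> s hs; rewrite setE; exact: hZ.
  - by rewrite -hx2.
  - exact: hA.
  exists D, B, r, j; split=> //; rewrite e1 /=.
  rewrite -hx2 hW in hj; rewrite mul1r -hj J /calJ.
  by move: (x - x^-1) => y; field.
(* Solving for [calJ x] divides by [- 4] or [- 2]; the coefficient of [ln 2 * ln x] is [1 / 2] in
   both cases. *)
pose k i : rat := (if i == ord0 then 1 else -1) * (j i)%:R / (if e == 1 then 4 else 2).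
exists 2%N, D, B, r, (if e == 1 then n%:R / 4 else 0), 2^-1, k; split=> //.
rewrite big_ord_recl big_ord_recl big_ord0 addr0 /k /=.
have -> : lift ord0 ord0 = ord_max :> 'I_2 by apply/val_inj.
rewrite mul1r mulN1r.
case: ifP hA => _ hA.
  rewrite !(rmorphM, rmorphN, fmorphV) /= !ratr_nat; lra.
rewrite !(rmorphM, rmorphN, fmorphV, rmorph0) /= !ratr_nat; lra.
Qed.
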